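(* For every integer $N\ge 2$ and every $D>0$ there exists a constant $c(N,D)>0$ such that every horoconvex domain $\Omega\subset\mathbb{H}^N$ of diameter $D$ satisfies $$\Gamma(\Omega)\ \geq\ c(N,D).$$
   Context: $\mathbb{H}^N$ is hyperbolic $N$-space (constant sectional curvature $-1$). A horosphere is a hypersurface of $\mathbb{H}^N$ obtained as a limit of expanding hyperbolic balls (spheres) sharing a common tangent hyperplane and point of tangency; in the Poincaré ball model horospheres are the Euclidean spheres inside the unit ball $B$ that are tangent to $\partial B$. A (bounded) domain $\Omega\subset\mathbb{H}^N$ is horoconvex if for every $p\in\partial\Omega$ there is a horosphere passing through $p$ which contains $\Omega$ entirely (i.e. $\Omega$ lies in the horoball bounded by it). The diameter is taken with respect to the hyperbolic metric. Let $0<\lambda_1(\Omega)<\lambda_2(\Omega)\le\cdots$ be the Dirichlet eigenvalues (with multiplicity) of the hyperbolic Laplacian, $-\Delta u=\lambda u$ in $\Omega$, $u=0$ on $\partial\Omega$; the fundamental gap is $\Gamma(\Omega)=\lambda_2(\Omega)-\lambda_1(\Omega)$. *)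

(* Defs.v *)
From mathcomp Require Import all_boot all_order all_algebra.
From mathcomp Require Import all_classical all_reals all_analysis.

Set Implicit Arguments.
Unset Strict Implicit.
Unset Printing Implicit Defensive.

Import Order.TTheory GRing.Theory Num.Theory.
Import numFieldNormedType.Exports.

Local Open Scope classical_set_scope.
Local Open Scope ring_scope.

(* Hyperbolic space is represented by the Poincaré ball model, as a subset of
   'rV[R]_N.  The library's norm on 'rV[R]_N is the sup norm: it is used only
   through the topology it induces, and the Euclidean norm enters through
   [sqnorm]. *)

Section HyperbolicGeometry.
Context {R : realType} {N : nat}.
Implicit Types (x y xi p : 'rV[R]_N) (r : R) (Omega : set 'rV[R]_N).

Definition sqnorm x : R := \sum_(i < N) x 0 i ^+ 2.

Definition hyperbolic_space : set 'rV[R]_N := [set x | sqnorm x < 1].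

Definition arcosh (z : R) : R := ln (z + Num.sqrt (z ^+ 2 - 1)).

Definition hdist x y : R :=
  arcosh (1 + 2 * sqnorm (x - y) / ((1 - sqnorm x) * (1 - sqnorm y))).

Definition hdiameter Omega : \bar R :=
  ereal_sup [set (hdist z.1 z.2)%:E | z in Omega `*` Omega].

(* For [sqnorm xi = 1] and [0 < r < 1]: the Euclidean sphere and open ball of
   radius r that are internally tangent to the unit sphere at the ideal point
   xi.  Intersecting with the unit ball removes xi itself. *)
Definition horosphere xi r : set 'rV[R]_N :=
  hyperbolic_space `&` [set x | sqnorm (x - (1 - r) *: xi) = r ^+ 2].

Definition horoball xi r : set 'rV[R]_N :=
  [set x | sqnorm (x - (1 - r) *: xi) < r ^+ 2].

Definition domain Omega : Prop :=
  [/\ Omega !=set0, Omega `<=` hyperbolic_space, open Omega & connected Omega].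

(* Topological boundary relative to hyperbolic space. *)
Definition boundary Omega : set 'rV[R]_N :=
  hyperbolic_space `&` (closure Omega `\` interior Omega).

Definition horoconvex Omega : Prop :=
  forall p, boundary Omega p ->
    exists xi r, [/\ sqnorm xi = 1, 0 < r < 1,
                     horosphere xi r p & Omega `<=` horoball xi r].

End HyperbolicGeometry.

Section DirichletEigenvalues.
Context {R : realType} {N : nat}.
Implicit Types (u v : 'rV[R]_N -> R) (x : 'rV[R]_N) (Omega : set 'rV[R]_N).

Definition partial (i : 'I_N) u : 'rV[R]_N -> R := 'D_(delta_mx 0 i) u.

(* u is of class C^k on the open set Omega. *)
Fixpoint class_C (k : nat) Omega u : Prop :=
  if k is k'.+1 then
    [/\ forall x, Omega x -> {for x, continuous u},
        forall (i : 'I_N) x, Omega x -> derivable u x (delta_mx 0 i)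
      & forall i, class_C k' Omega (partial i u)]
  else forall x, Omega x -> {for x, continuous u}.

(* The Poincaré metric is g = rho^2 |dx|^2 with rho the following factor. *)
Definition conformal_factor x : R := 2 / (1 - sqnorm x).

(* Laplace-Beltrami operator of g:
   (det g)^(-1/2) d_i ((det g)^(1/2) g^(ij) d_j u),
   where (det g)^(1/2) = rho^N and g^(ij) = rho^(-2) delta_ij.  The truncated
   subtraction N - 2 is the true one for N >= 2. *)
Definition hlaplacian u x : R :=
  conformal_factor x ^- N *
  \sum_(i < N)
    partial i (fun y => conformal_factor y ^+ (N - 2) * partial i u y) x.

(* Classical solutions of - Delta u = mu u in Omega, u = 0 on the boundary,
   the zero solution included; only the values of u on the closure of Omega
   are constrained. *)
Definition dirichlet_solution Omega (mu : R) u : Prop :=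
  [/\ class_C 2 Omega u,
      {within hyperbolic_space `&` closure Omega, continuous u},
      forall x, Omega x -> - hlaplacian u x = mu * u x
    & forall x, boundary Omega x -> u x = 0].

(* The eigenspace of mu has dimension m: it has a basis of m functions, all
   identities between functions being understood on Omega. *)
Definition multiplicity Omega (mu : R) (m : nat) : Prop :=
  exists e : 'I_m -> ('rV[R]_N -> R),
    [/\ forall i, dirichlet_solution Omega mu (e i),
        forall a : 'I_m -> R,
          (forall x, Omega x -> \sum_(i < m) a i * e i x = 0) ->
          forall i, a i = 0
      & forall u, dirichlet_solution Omega mu u ->
          exists a : 'I_m -> R,
            forall x, Omega x -> u x = \sum_(i < m) a i * e i x].

(* lam lists all the Dirichlet eigenvalues in nondecreasing order, each one
   repeated according to its multiplicity; the numbering starts at 0, so that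
   lambda_k is [lam (k - 1)]. *)
Definition dirichlet_eigenvalues Omega (lam : nat -> R) : Prop :=
  nondecreasing_seq lam /\
  forall mu : R, exists m : nat,
    multiplicity Omega mu m /\ ([set k | lam k = mu] #= `I_m)%card.

End DirichletEigenvalues.

Definition fundamental_gap {R : realType} (lam : nat -> R) : R :=
  lam 1%N - lam 0%N.

(* Main.v *)
Require Import Defs.
From mathcomp Require Import all_boot all_order all_algebra.
From mathcomp Require Import all_classical all_reals all_analysis.
From mathcomp Require Import ring lra zify.
Import Order.TTheory GRing.Theory Num.Theory.
Import numFieldNormedType.Exports.
Local Open Scope classical_set_scope.
Local Open Scope ring_scope.

(** Why the gap is bounded below. Everything is done with the maximum principle and Harnack's
inequality for classical solutions; no integral of an eigenfunction occurs.

Geometry. A horoball at the ideal point xi is a sublevel set of |z - xi|^2 / (1 - |z|^2), a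
function which is linear in the hyperboloid model. Hence the midpoint of two points at distance at
least D / 2 lies well inside every horoball containing both, by an amount depending on D only, and
a horoconvex domain, being an intersection of horoballs, contains a ball around that midpoint
whose radius is comparable to the size of the domain ([horoconvex_size]). In the ball model
horoballs are Euclidean balls, so the domain is also convex in the Euclidean sense, with a
supporting hyperplane at each boundary point ([horoconvex_supported]).

Flattening. With rho the conformal factor and v = rho^((N-2)/2) u, the equation - Delta u = lambda
u on hyperbolic space becomes - Delta v = (lambda - N (N - 2) / 4) rho^2 v for the Euclidean
Laplacian ([conformal_laplacian]). By the size estimate, rho is pinched between constant multiples
of the inverse radius on the domain, so that after scaling all the data are bounded in terms of N
and D.

Uniform simplicity. Let u0 > 0 be an eigenfunction for lambda_0, and u1 one for lambda_1 =
lambda_0 + gamma, scaled so that u1 <= u0 with equality somewhere, on the set K of the points not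
too close to the boundary. A convex domain is thin near its boundary, so there the maximum
principle holds in spite of the zeroth order term ([strip_max]); it gives u1 <= u0 + O(gamma)
everywhere. Thus u0 - u1 + O(gamma) is a positive function, of size O(gamma) at one point of K,
and by Harnack's inequality of size O(gamma) on K. As u0 is bounded below on K, for gamma small u1
is positive on K, hence everywhere; but two positive eigenfunctions belong to the same eigenvalue
and are proportional. So if gamma is below a constant depending on N and D, every eigenfunction
for lambda_1 is a multiple of u0 ([uniform_simplicity]).

Existence of u0. A sequence of eigenvalues does not by itself provide a positive eigenfunction.
One is constructed as a limit of ground states of the lattice Laplacian ([exists_ground_state]);
it lies at the bottom of the spectrum because a solution whose eigenvalue is smaller than that of
a positive one vanishes ([principal_min]). If now the gap were below the constant, all
eigenfunctions for lambda_1 would be multiples of u0, which contradicts the multiplicity when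
lambda_1 = lambda_0, and the equation when lambda_1 > lambda_0. *)

Set Implicit Arguments.
Unset Strict Implicit.
Unset Printing Implicit Defensive.

(** * Coordinates, Euclidean products and boxes *)

Section Coordinates.
Context {R : realType} {N : nat}.
Implicit Types (x y z c : 'rV[R]_N) (r s t : R) (i j : 'I_N).

Definition ax i : 'rV[R]_N := delta_mx 0 i.

Definition dot x y : R := \sum_(i < N) x 0 i * y 0 i.

(** Closed balls of the sup norm, the one which defines the topology. *)
Definition box c r : set 'rV[R]_N := [set y | forall i, `|y 0 i - c 0 i| <= r].

Lemma axE i j : ax i 0 j = (j == i)%:R.
Proof. by rewrite mxE eqxx. Qed.

Lemma shiftE x i t j : (x + t *: ax i) 0 j = x 0 j + t * (j == i)%:R.
Proof. by rewrite !mxE eqxx. Qed.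

Lemma sqnorm_dot x : sqnorm x = dot x x.
Proof. by apply: eq_bigr => i _; rewrite expr2. Qed.

Lemma dot_ax x i : dot x (ax i) = x 0 i.
Proof.
rewrite /dot (bigD1 i) //= axE eqxx mulr1 big1 ?addr0 // => j ji.
by rewrite axE (negPf ji) mulr0.
Qed.

Lemma dotC x y : dot x y = dot y x.
Proof. by apply: eq_bigr => i _; rewrite mulrC. Qed.

Lemma dotDr x y z : dot x (y + z) = dot x y + dot x z.
Proof. by rewrite -big_split; apply: eq_bigr => i _; rewrite mxE mulrDr. Qed.

Lemma dotZr x t y : dot x (t *: y) = t * dot x y.
Proof. by rewrite /dot mulr_sumr; apply: eq_bigr => i _; rewrite mxE mulrCA. Qed.

Lemma dotNr x y : dot x (- y) = - dot x y.
Proof. by rewrite -scaleN1r dotZr mulN1r. Qed.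

Lemma dotBr x y z : dot x (y - z) = dot x y - dot x z.
Proof. by rewrite dotDr dotNr. Qed.

Lemma dotDl x y z : dot (y + z) x = dot y x + dot z x.
Proof. by rewrite dotC dotDr !(dotC x). Qed.

Lemma dotBl x y z : dot (y - z) x = dot y x - dot z x.
Proof. by rewrite dotC dotBr !(dotC x). Qed.

Lemma dotZl x t y : dot (t *: y) x = t * dot y x.
Proof. by rewrite dotC dotZr dotC. Qed.

Lemma sqnorm_ge0 x : 0 <= sqnorm x.
Proof. by apply: sumr_ge0 => i _; rewrite sqr_ge0. Qed.

Lemma sqnormD x y : sqnorm (x + y) = sqnorm x + 2 * dot x y + sqnorm y.
Proof. by rewrite !sqnorm_dot dotDr !dotDl (dotC y x); ring. Qed.

Lemma sqnormZ t x : sqnorm (t *: x) = t ^+ 2 * sqnorm x.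
Proof. by rewrite !sqnorm_dot dotZr dotZl; ring. Qed.

Lemma sqnormN x : sqnorm (- x) = sqnorm x.
Proof. by rewrite -scaleN1r sqnormZ; ring. Qed.

Lemma sqnormB x y : sqnorm (x - y) = sqnorm x - 2 * dot x y + sqnorm y.
Proof. by rewrite sqnormD dotNr sqnormN; ring. Qed.

Lemma sqnormBC x y : sqnorm (x - y) = sqnorm (y - x).
Proof. by rewrite -sqnormN opprB. Qed.

Lemma sqnorm_ax i : sqnorm (ax i) = 1.
Proof. by rewrite sqnorm_dot dot_ax axE eqxx. Qed.

Lemma sqnorm_shift x i t : sqnorm (x + t *: ax i) = sqnorm x + 2 * t * x 0 i + t ^+ 2.
Proof. by rewrite sqnormD sqnormZ sqnorm_ax dotZr dot_ax; ring. Qed.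

Lemma sqnorm0 : sqnorm (0 : 'rV[R]_N) = 0.
Proof. by rewrite -(scale0r (0 : 'rV[R]_N)) sqnormZ; ring. Qed.

Lemma sqnorm_eq0 x : sqnorm x = 0 -> x = 0.
Proof.
move=> /eqP; rewrite psumr_eq0 => [/allP x0|i _]; last exact: sqr_ge0.
apply/rowP => i; rewrite mxE; apply/eqP.
by have := x0 i (mem_index_enum _); rewrite sqrf_eq0.
Qed.

Lemma coord_sqnorm x i : x 0 i ^+ 2 <= sqnorm x.
Proof. by rewrite /sqnorm (bigD1 i) //= lerDl sumr_ge0 // => j _; rewrite sqr_ge0. Qed.

Lemma normr_coord_sqnorm x i r : 0 <= r -> sqnorm x <= r ^+ 2 -> `|x 0 i| <= r.
Proof.
move=> r0 xr; rewrite -(@ler_pXn2r _ 2) ?nnegrE //.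
by rewrite real_normK ?num_real // (le_trans (coord_sqnorm x i)).
Qed.

Lemma sqnorm_box c r x : box c r x -> sqnorm (x - c) <= N%:R * r ^+ 2.
Proof.
move=> xc; have -> : N%:R * r ^+ 2 = \sum_(i < N) r ^+ 2.
  by rewrite sumr_const card_ord mulr_natl.
apply: ler_sum => i _; rewrite !mxE -[X in X <= _]real_normK ?num_real //.
by have := xc i; have := normr_ge0 (x 0 i - c 0 i); set a := `|_|; nra.
Qed.

Lemma CauchySchwarz_dot x y : dot x y ^+ 2 <= sqnorm x * sqnorm y.
Proof.
have [y0|y0] := eqVneq (sqnorm y) 0.
  by rewrite (sqnorm_eq0 y0) /dot big1 ?expr0n ?sqnorm0 ?mulr0 // => i _; rewrite mxE mulr0.
have yp : 0 < sqnorm y by rewrite lt_def y0 sqnorm_ge0.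
have := sqnorm_ge0 (sqnorm y *: x - dot x y *: y).
rewrite sqnormB !sqnormZ dotZl dotZr.
set a := sqnorm x; set b := sqnorm y in y0 yp *; set d := dot x y => H.
have : 0 <= b * (a * b - d ^+ 2) by move: H; congr (_ <= _); ring.
by rewrite pmulr_rge0 // subr_ge0.
Qed.

Lemma normr_mxP x r : 0 <= r -> (forall i, `|x 0 i| <= r) <-> `|x| <= r.
Proof.
move=> r0; rewrite [X in _ <-> (X <= _)]/Num.Def.normr /= mx_normrE; split => [xr|xr i].
  by apply: (bigmax_le _ r0) => -[k i] _ /=; rewrite ord1.
by rewrite (le_trans _ xr) //; exact: (le_bigmax _ (fun ij => `|x ij.1 ij.2|) (0, i)).
Qed.

Lemma box_norm c r y : 0 <= r -> box c r y <-> `|y - c| <= r.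
Proof.
by move=> r0; rewrite -normr_mxP //; split=> yc i; have := yc i; rewrite !mxE.
Qed.

Lemma nbhs_boxP x (A : set 'rV[R]_N) :
  nbhs x A <-> exists2 r, 0 < r & box x r `<=` A.
Proof.
split=> [/nbhs_ballP[e /= e0 xe]|[r r0 xr]].
  exists (e / 2); first by rewrite divr_gt0.
  move=> y /box_norm yx; apply: xe; rewrite -ball_normE /= distrC.
  by rewrite (le_lt_trans (yx _)) ?divr_ge0 ?ltW // ltr_pdivrMr // ltr_pMr // ltr1n.
apply/nbhs_ballP; exists r => //= y; rewrite -ball_normE /= => xy.
by apply/xr/box_norm; [exact: ltW|rewrite distrC ltW].
Qed.

Lemma box_refl c r : 0 <= r -> box c r c.
Proof. by move=> r0 i; rewrite subrr normr0. Qed.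

Lemma box_sym c r x : box c r x -> box x r c.
Proof. by move=> xc i; rewrite distrC. Qed.

Lemma box_trans c r s x y : box c r x -> box x s y -> box c (r + s) y.
Proof.
move=> xc yx i; rewrite -(subrK (x 0 i) (y 0 i)) -addrA addrC.
by rewrite (le_trans (ler_normD _ _)) // lerD.
Qed.

Lemma box_le c r s : r <= s -> box c r `<=` box c s.
Proof. by move=> rs x xc i; rewrite (le_trans (xc i)). Qed.

Lemma box_shift c r s t x i : box c r x -> `|t| <= s -> box c (r + s) (x + t *: ax i).
Proof.
move=> xc ts; apply: (box_trans xc) => j; rewrite shiftE addrC addKr.
by case: eqP; rewrite ?mulr1 ?mulr0 ?normr0 // (le_trans _ ts).
Qed.

Lemma continuous_boxP (u : 'rV[R]_N -> R) x :
  {for x, continuous u} <->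
  forall e : R, 0 < e -> exists2 d : R, 0 < d & forall y, box x d y -> `|u y - u x| <= e.
Proof.
split=> [/cvgrPdist_le ux e e0|ux].
  have /nbhs_boxP[d d0 xd] := ux _ e0.
  by exists d => // y /xd /=; rewrite distrC.
apply/(@cvgrPdist_le _ _ _ (nbhs x)) => e e0; apply/nbhs_boxP; have [d d0 xd] := ux _ e0.
by exists d => // y /xd /=; rewrite distrC.
Qed.

Lemma continuous_dot y : continuous (dot y : _ -> R).
Proof.
move=> x; apply/continuous_boxP => e e0.
pose m := \sum_(i < N) `|y 0 i| + 1.
have m0 : 0 < m by rewrite ltr_wpDl // sumr_ge0.
exists (e / m); first by rewrite divr_gt0.
move=> z zx; rewrite -dotBr (le_trans (ler_norm_sum _ _ _)) //.
apply: (@le_trans _ _ (\sum_(i < N) `|y 0 i| * (e / m))).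
  by apply: ler_sum => i _; rewrite normrM ler_wpM2l // !mxE.
rewrite -mulr_suml mulrCA mulrA ler_pdivrMr // ler_wpM2l ?ltW //.
by rewrite /m ltrDl ltr01.
Qed.

(** Boundedness is expressed by a box, so that it can be checked coordinatewise. *)
Lemma EVT_box (u : 'rV[R]_N -> R) (A : set 'rV[R]_N) c r :
  continuous u -> closed A -> A !=set0 -> A `<=` box c r ->
  exists2 x, A x & forall y, A y -> u y <= u x.
Proof.
move=> uc Ac A0 Ab.
have cA : compact A.
  apply: bounded_closed_compact => //.
  exists (`|r| + `|c|); split; first exact: num_real.
  move=> M /ltW rM x /Ab xc /=; rewrite (le_trans _ rM) // -(subrK c x).
  rewrite (le_trans (ler_normD _ _)) // lerD2r //.
  by apply/box_norm => //; apply: box_le xc; exact: ler_norm.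
have [] := @EVT_max_rV _ _ u A A0 cA; first exact: continuous_subspaceT.
move=> x; rewrite inE => Ax xm; exists x => // y Ay.
by apply: xm; rewrite inE.
Qed.

(** Two points of a box are joined by N moves along the axes inside the box, so a bound on
axis-parallel increments bounds all increments. *)
Lemma axis_path (f : 'rV[R]_N -> R) c r (e d : R) x y :
  (forall z i t, box c r z -> box c r (z + t *: ax i) -> `|t| <= d ->
     `|f (z + t *: ax i) - f z| <= e) ->
  box c r x -> box c r y -> box x d y -> `|f y - f x| <= N%:R * e.
Proof.
move=> fe xc yc xy.
pose p k : 'rV[R]_N := \row_i (if (i < k)%N then y 0 i else x 0 i).
have pc k : box c r (p k) by move=> i; rewrite mxE; case: ifP.
have pS (k : 'I_N) : p k.+1 = p k + (y 0 k - x 0 k) *: ax k.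
  apply/rowP => i; rewrite shiftE !mxE ltnS leq_eqVlt (_ : (i == k :> nat) = (i == k)) //.
  have [->|ik] := eqVneq i k; first by rewrite ltnn mulr1 addrC subrK.
  by rewrite mulr0 addr0.
have pk k : (k <= N)%N -> `|f (p k) - f x| <= k%:R * e.
  elim: k => [_|k IH kN].
    rewrite mul0r; suff -> : p 0%N = x by rewrite subrr normr0.
    by apply/rowP => i; rewrite mxE.
  have := fe (p k) (Ordinal kN) _ (pc k) _ (xy (Ordinal kN)).
  rewrite -(pS (Ordinal kN)) => /(_ (pc _)) H.
  rewrite -(subrK (f (p k)) (f (p k.+1))) -addrA (le_trans (ler_normD _ _)) //.
  by rewrite -natr1 mulrDl mul1r [X in _ <= X]addrC lerD // IH // ltnW.
suff <- : p N = y by exact: pk.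
by apply/rowP => i; rewrite mxE ltn_ord.
Qed.

End Coordinates.

(** * The lattice Laplacian: maximum principle and gradient estimate *)

Section DiscreteLaplacian.
Context {R : realType} {N : nat}.
Implicit Types (x y z c nu : 'rV[R]_N) (r s t h : R) (i j : 'I_N) (u w : 'rV[R]_N -> R).

(** Not divided by the square of the mesh: h^2 times the usual lattice Laplacian. *)
Definition dlap h u x : R :=
  \sum_(i < N) (u (x + h *: ax i) + u (x - h *: ax i) - 2 * u x).

Definition lattice_nbr h x y : Prop :=
  exists i, y = x + h *: ax i \/ y = x - h *: ax i.

(** If a positive value at a point of A forces the Laplacian up by d, then some neighbour is
larger by at least d / (2 (N + 1)), and lies in A; climbing forever contradicts the upper bound.
*)
Lemma discrete_max_principle h (A : set 'rV[R]_N) w (B d : R) : 0 < d ->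
  (forall x, A x -> w x <= B) ->
  (forall x, A x -> 0 < w x -> d <= dlap h w x) ->
  (forall x y, A x -> 0 < w x -> lattice_nbr h x y -> ~ A y -> w y <= 0) ->
  forall x, A x -> w x <= 0.
Proof.
move=> d0 wB wd wbd x Ax; rewrite leNgt; apply/negP => wx.
pose e := d / (N.+1%:R * 2).
have e0 : 0 < e by rewrite divr_gt0 // mulr_gt0.
have step y : A y -> 0 < w y -> exists2 z, A z & w y + e <= w z.
  move=> Ay wy; apply: contrapT => noz.
  have small z : lattice_nbr h y z -> w z < w y + e.
    move=> yz; rewrite ltNge; apply/negP => wz.
    have [Az|nAz] := pselect (A z); first by apply: noz; exists z.
    by have := wbd _ _ Ay wy yz nAz; rewrite leNgt (lt_le_trans _ wz) ?addr_gt0.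
  have : dlap h w y <= \sum_(i < N) (2 * e).
    apply: ler_sum => i _.
    have h1 := small (y + h *: ax i) (ex_intro _ i (or_introl erefl)).
    have h2 := small (y - h *: ax i) (ex_intro _ i (or_intror erefl)).
    by lra.
  apply/negP; rewrite -ltNge (lt_le_trans _ (wd _ Ay wy)) //.
  rewrite sumr_const card_ord -[X in X < _]mulr_natr.
  have -> : 2 * e * N%:R = d * (N%:R / N.+1%:R).
    by rewrite /e; field; rewrite nat1r pnatr_eq0.
  by rewrite gtr_pMr // ltr_pdivrMr // mul1r ltr_nat.
have climb n : exists2 z, A z & w x + n%:R * e <= w z.
  elim: n => [|n [z Az wz]]; first by exists x; rewrite // mul0r addr0.
  have [|y Ay wy] := step z Az.
    by rewrite (lt_le_trans _ wz) // ltr_wpDr // mulr_ge0 // ltW.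
  by exists y => //; rewrite -natr1 mulrDl mul1r addrA (le_trans _ wy) // lerD2r.
have [n Bn] : exists n, B < n%:R * e.
  exists (Num.bound (`|B| / e)).
  have := archi_boundP (divr_ge0 (normr_ge0 B) (ltW e0)).
  by rewrite ltr_pdivrMr //; apply: le_lt_trans; exact: ler_norm.
have [z Az wz] := climb n; have := wB z Az.
by rewrite leNgt (lt_le_trans Bn) // (le_trans _ wz) // lerDr ltW.
Qed.

Lemma dlapB h u w x : dlap h (fun y => u y - w y) x = dlap h u x - dlap h w x.
Proof. by rewrite /dlap -sumrB; apply: eq_bigr => i _; ring. Qed.

Lemma dlapD h u w x : dlap h (fun y => u y + w y) x = dlap h u x + dlap h w x.
Proof. by rewrite /dlap -big_split; apply: eq_bigr => i _ /=; ring. Qed.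

Lemma dlapZ h a u x : dlap h (fun y => a * u y) x = a * dlap h u x.
Proof. by rewrite /dlap mulr_sumr; apply: eq_bigr => i _; ring. Qed.

Lemma dlap_sqnorm h c x : dlap h (fun y => sqnorm (y - c)) x = 2 * N%:R * h ^+ 2.
Proof.
rewrite /dlap (eq_bigr (fun=> 2 * h ^+ 2)).
  by rewrite sumr_const card_ord -mulr_natr; ring.
move=> i _; rewrite -scaleNr ![_ + _ - c]addrAC !sqnorm_shift; ring.
Qed.

Lemma dlap_quadratic h nu a b x :
  dlap h (fun y => (dot nu y + a) * (b - dot nu y)) x = - (2 * sqnorm nu * h ^+ 2).
Proof.
have -> : - (2 * sqnorm nu * h ^+ 2) = \sum_(i < N) - (2 * nu 0 i ^+ 2 * h ^+ 2).
  by rewrite sumrN -mulr_suml -mulr_sumr.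
apply: eq_bigr => i _.
by rewrite -scaleNr !dotDr !dotZr !dot_ax; ring.
Qed.

(** Reflection in the hyperplane through c orthogonal to the axis i. *)
Definition flip i c x : 'rV[R]_N := x - (2 * (x 0 i - c 0 i)) *: ax i.

Lemma flipE i c x j :
  flip i c x 0 j = x 0 j - 2 * (x 0 i - c 0 i) * (j == i)%:R.
Proof. by rewrite /flip -scaleNr shiftE mulNr. Qed.

Lemma flip_box i c r x : box c r x -> box c r (flip i c x).
Proof.
move=> xc j; rewrite flipE; have := xc j; case: eqP => [->|_].
  by rewrite mulr1 -normrN; congr (`|_| <= _); ring.
by rewrite mulr0 subr0.
Qed.

Lemma flip_shift i c x j t :
  flip i c (x + t *: ax j) = flip i c x + ((-1) ^+ (j == i) * t) *: ax j.
Proof.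
apply/rowP => k; rewrite !(flipE, shiftE).
have [->|ji] := eqVneq j i; rewrite ?eqxx /= ?(negPf ji) ?[i == j]eq_sym ?(negPf ji) /=.
  by rewrite ?eqxx; ring.
by ring.
Qed.

Lemma dlap_flip h i c u x : dlap h (fun y => u (flip i c y)) x = dlap h u (flip i c x).
Proof.
apply: eq_bigr => j _; rewrite -scaleNr !flip_shift.
by case: (j == i); rewrite ?expr1 ?expr0 ?mulN1r ?mul1r ?opprK -?scaleNr //= addrC [in RHS]addrC; ring.
Qed.

(** Brandt's interior gradient estimate. The antisymmetric part of u across the mid-plane of a
cube changes sign under reflection, hence is dominated there by a quadratic barrier growing
linearly from the mid-plane; the comparison is exact for lattice functions, since the lattice
Laplacian of a quadratic polynomial is that of the continuum. *)
Lemma discrete_gradient_le h r i c u (M F : R) :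
  0 < h -> h <= r -> 0 < M -> 0 <= F ->
  (forall x, box c (2 * r) x -> `|u x| <= M) ->
  (forall x, box c (2 * r) x -> `|dlap h u x| <= F * h ^+ 2) ->
  u (c + (h / 2) *: ax i) - u (c - (h / 2) *: ax i) <=
    h * (4 * N.+2%:R * M / r + 2 * r * F).
Proof.
move=> h0 hr M0 F0 uM uF.
have r0 : 0 < r by exact: lt_le_trans hr.
pose phi y := u y - u (flip i c y).
pose G := N.+1%:R * (2 * M) / r ^+ 2 + F.
have G0 : 0 <= G by rewrite addr_ge0 // divr_ge0 ?sqr_ge0 // !mulr_ge0 // ltW.
pose B y := 2 * M / r ^+ 2 * sqnorm (y - c) +
  G * ((dot (ax i) y + (h / 2 - c 0 i)) * (2 * r + c 0 i - dot (ax i) y)).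
have dE y : dot (ax i) y = y 0 i by rewrite dotC dot_ax.
have phiM y : box c (2 * r) y -> `|phi y| <= 2 * M.
  move=> yc; rewrite (le_trans (ler_normB _ _)) // mulr2n mulrDl mul1r lerD ?uM //.
  exact: flip_box.
have phiF y : box c (2 * r) y -> - (2 * F * h ^+ 2) <= dlap h phi y.
  move=> yc; rewrite dlapB dlap_flip.
  have := uF _ yc; have := uF _ (flip_box i yc); rewrite !ler_norml; lra.
have dB y : dlap h B y = - h ^+ 2 * (2 * (2 * M) / r ^+ 2 + 2 * F).
  rewrite dlapD !dlapZ dlap_sqnorm dlap_quadratic sqnorm_ax /G -natr1.
  by field; rewrite gt_eqF.
have B_ge y : 0 <= y 0 i - c 0 i + h / 2 -> y 0 i - c 0 i <= 2 * r ->
    2 * M / r ^+ 2 * sqnorm (y - c) <= B y.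
  move=> t0 tr; rewrite lerDl mulr_ge0 // dE mulr_ge0 //; first by lra.
  by lra.
have Mr : 0 < 2 * M / r ^+ 2 by rewrite divr_gt0 ?mulr_gt0 ?exprn_gt0.
have Bs y : 0 <= 2 * M / r ^+ 2 * sqnorm (y - c).
  by rewrite mulr_ge0 ?sqnorm_ge0 // ltW.
(* half-integer multiples of h: the lattice through the two points compared, which has no point on
the mid-plane itself *)
pose A := [set y | box c r y /\ exists k : nat, y 0 i - c 0 i = h * (k%:R + 2^-1)].
have tk0 k : 0 <= h * (k%:R + 2^-1) by rewrite mulr_ge0 ?(ltW h0) // addr_ge0 ?invr_ge0.
have h20 : 0 <= h / 2 by lra.
have rr : r <= 2 * r by lra.
have r2 : r + h <= 2 * r by lra.
suff wA : forall y, A y -> phi y - B y <= 0.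
  pose y : 'rV[R]_N := c + (h / 2) *: ax i.
  have yi : y 0 i - c 0 i = h / 2 by rewrite shiftE eqxx mulr1 addrC addKr.
  have fy : flip i c y = c - (h / 2) *: ax i.
    by apply/rowP => j; rewrite flipE yi /y -[- (_ *: ax i)]scaleNr !shiftE; move: (_ == _)%:R => b; field.
  have /wA : A y.
    split; last by exists 0%N; rewrite yi add0r.
    have := @box_shift _ _ c 0 r (h / 2) c i (box_refl _ (lexx 0)); rewrite add0r; apply.
    by rewrite ger0_norm; lra.
  rewrite subr_le0 /phi fy => /le_trans; apply.
  have -> : B y = 2 * M / r ^+ 2 * (h ^+ 2 / 4) + G * (h * (2 * r - h / 2)).
    rewrite /B dE /y addrAC subrr add0r sqnormZ sqnorm_ax shiftE eqxx mulr1n.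
    by field; rewrite gt_eqF.
  apply: (@le_trans _ _ (h * ((2 * M) / r + G * (2 * r)))); last first.
    rewrite ler_pM2l // /G -[N.+2%:R]natr1 [X in _ <= X](_ : _ =
      2 * M / r + (N.+1%:R * (2 * M) / r ^+ 2 + F) * (2 * r) + 2 * M / r) ?lerDl.
      by rewrite ltW // divr_gt0 // mulr_gt0.
    by field; rewrite gt_eqF.
  rewrite [X in _ <= X]mulrDr; apply: lerD; last by rewrite [X in _ <= X]mulrCA !ler_wpM2l ?(ltW h0) //; lra.
  rewrite -subr_ge0.
  have -> : h * (2 * M / r) - 2 * M / r ^+ 2 * (h ^+ 2 / 4) =
            (2 * M / r ^+ 2) * h * (r - h / 4) by field; rewrite gt_eqF.
  by apply: mulr_ge0; [apply: mulr_ge0; exact: ltW|lra].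
apply: (@discrete_max_principle h A (fun y => phi y - B y) (2 * M) (h ^+ 2 * (2 * (2 * M) / r ^+ 2))).
- by rewrite mulr_gt0 ?exprn_gt0 // -mulrA mulr_gt0.
- move=> z [zc [k zk]]; rewrite lerBlDr ler_wpDr //.
    apply: le_trans (B_ge z _ _); last 2 first.
    + by rewrite zk addr_ge0.
    + by rewrite (le_trans _ rr) // (le_trans (ler_norm _)).
    exact: Bs.
  by rewrite (le_trans (ler_norm _)) // phiM //; exact: box_le zc.
- move=> z [zc _] _; rewrite dlapB dB.
  have := phiF z (box_le rr zc); lra.
move=> y z [yc [k yk]] wy [j yz] nAz.
have zr : box c (2 * r) z.
  apply: (box_le r2).
  by case: yz => ->; rewrite -?scaleNr; apply: box_shift => //; rewrite ?normrN ger0_norm // ltW.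
have zi_le : z 0 i - c 0 i <= 2 * r by rewrite (le_trans (ler_norm _)).
have [neg|pos] := ltP (z 0 i - c 0 i) 0.
  (* the only way down through the mid-plane: z is the mirror image of y *)
  have ij : j = i.
    apply/eqP; case: eqP => // ji; move: neg; have {}ji : (i == j) = false by apply/eqP => /esym.
    case: yz => ->; rewrite -?scaleNr shiftE ji mulr0 addr0 yk ltNge tk0 //.
  subst j; case: yz => zE.
    move: neg; rewrite zE shiftE eqxx mulr1 addrAC yk ltNge addr_ge0 ?(ltW h0) //.
  have k0 : k = 0%N.
    case: k yk => // k yk; move: neg; rewrite zE -scaleNr shiftE eqxx mulr1 addrAC yk.
    rewrite ltNge -natr1 (_ : _ - h = h * (k%:R + 2^-1)); last by ring.
    by rewrite tk0.
  move: yk; rewrite k0 add0r => yk.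
  have zi : z 0 i - c 0 i = - (h / 2).
    by rewrite zE -scaleNr shiftE eqxx mulr1 addrAC yk; field.
  have zy : flip i c z = y.
    by apply/rowP => l; rewrite flipE zi zE -[- (_ *: ax i)]scaleNr !shiftE; move: (_ == _)%:R => b; field.
  have yz' : flip i c y = z.
    by apply/rowP => l; rewrite flipE yk zE -[- (_ *: ax i)]scaleNr !shiftE; move: (_ == _)%:R => b; field.
  have phiz : phi z = - phi y by rewrite /phi zy yz'; ring.
  have By : 0 <= B y.
    apply: le_trans (B_ge y _ _); rewrite ?yk ?Bs //.
      by rewrite addr_ge0.
    by lra.
  have Bz : 0 <= B z.
    apply: le_trans (B_ge z _ _); rewrite ?zi ?Bs //.
      by rewrite addNr.
    by lra.
  by move: wy; rewrite phiz; lra.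
have [l lr] : exists l, r < `|z 0 l - c 0 l|.
  apply: contrapT => nol; apply: nAz; split.
    by move=> l; rewrite leNgt; apply/negP => lr; apply: nol; exists l.
  have [ji|ji] := eqVneq i j; last first.
    exists k; rewrite -yk; case: yz => ->; rewrite -?scaleNr shiftE (negPf ji) ?mulr0 ?addr0 //.
  subst j; case: yz => zE; rewrite zE -?scaleNr shiftE eqxx mulr1 addrAC yk.
    by exists k.+1; rewrite -natr1; ring.
  case: k yk => [|k] yk; last by exists k; rewrite -natr1; ring.
  by move: pos; rewrite zE -scaleNr shiftE eqxx mulr1 addrAC yk add0r; lra.
rewrite subr_le0 (le_trans (ler_norm _)) // (le_trans (phiM z zr)) //.
apply: le_trans (B_ge z _ zi_le); last by rewrite addr_ge0.
rewrite mulrAC ler_pdivlMr ?exprn_gt0 // ler_pM2l ?mulr_gt0 //.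
have := coord_sqnorm (z - c) l; rewrite !mxE; apply: le_trans.
by rewrite -[X in _ <= X]real_normK ?num_real //; move: lr; set a := `|_|; nra.
Qed.

Lemma discrete_gradient h r i c u (M F : R) :
  0 < h -> h <= r -> 0 < M -> 0 <= F ->
  (forall x, box c (2 * r) x -> `|u x| <= M) ->
  (forall x, box c (2 * r) x -> `|dlap h u x| <= F * h ^+ 2) ->
  `|u (c + (h / 2) *: ax i) - u (c - (h / 2) *: ax i)| <=
    h * (4 * N.+2%:R * M / r + 2 * r * F).
Proof.
move=> h0 hr M0 F0 uM uF; rewrite ler_norml; apply/andP; split; last first.
  exact: discrete_gradient_le.
have := @discrete_gradient_le h r i c (fun x => -1 * u x) M F h0 hr M0 F0.
have m1 : `|-1 : R| = 1 by rewrite normrN1.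
rewrite !mulN1r lerNl opprB opprK addrC; apply=> x xc.
  by rewrite normrM m1 mul1r uM.
by rewrite dlapZ normrM m1 mul1r uF.
Qed.
End DiscreteLaplacian.

(** * Ground states of finite quadratic forms *)

Lemma cvg_sumr (R : realType) (T : Type) (G : set_system T) (FG : Filter G) (I : Type)
    (s : seq I) (P : pred I) (f : I -> T -> R) (l : I -> R) :
  (forall i, P i -> f i x @[x --> G] --> l i) ->
  \sum_(i <- s | P i) f i x @[x --> G] --> \sum_(i <- s | P i) l i.
Proof.
move=> fl; elim: s => [|i s IH].
  by rewrite big_nil; under eq_fun do rewrite big_nil; exact: cvg_cst.
rewrite big_cons; under eq_fun do rewrite big_cons.
by case: ifP => // Pi; apply: cvgD => //; exact: fl.
Qed.

Section GroundState.
Context {R : realType} {n : nat}.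
Implicit Types (m c : 'I_n -> 'I_n -> R) (x y v : 'I_n -> R) (w : 'I_n -> R).

Definition qform m x y : R := \sum_k \sum_l m k l * x k * y l.

Lemma qformDl m x x' y : qform m (fun k => x k + x' k) y = qform m x y + qform m x' y.
Proof.
rewrite -big_split; apply: eq_bigr => k _; rewrite -big_split.
by apply: eq_bigr => l _ /=; ring.
Qed.

Lemma qformZl m t x y : qform m (fun k => t * x k) y = t * qform m x y.
Proof.
rewrite /qform mulr_sumr; apply: eq_bigr => k _; rewrite mulr_sumr.
by apply: eq_bigr => l _ /=; ring.
Qed.

Lemma qformC m x y : (forall k l, m k l = m l k) -> qform m x y = qform m y x.
Proof.
move=> mC; rewrite /qform exchange_big; apply: eq_bigr => k _; apply: eq_bigr => l _ /=.
by rewrite mC; ring.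
Qed.

Lemma qformDr m x y y' : qform m x (fun k => y k + y' k) = qform m x y + qform m x y'.
Proof.
rewrite -big_split; apply: eq_bigr => k _; rewrite -big_split.
by apply: eq_bigr => l _ /=; ring.
Qed.

Lemma qformZr m t x y : qform m x (fun k => t * y k) = t * qform m x y.
Proof.
rewrite /qform mulr_sumr; apply: eq_bigr => k _; rewrite mulr_sumr.
by apply: eq_bigr => l _ /=; ring.
Qed.

Lemma qform_delta m k y :
  qform m (fun l => (l == k)%:R) y = \sum_l m k l * y l.
Proof.
rewrite /qform (bigD1 k) //= [X in _ + X]big1 ?addr0 => [|j /negPf jk].
  by apply: eq_bigr => l _; rewrite eqxx mulr1.
by rewrite jk big1 // => l _; rewrite mulr0 mul0r.
Qed.

(** A zero of a positive semidefinite form is a minimum, so the derivative of the form vanishes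
there; the test value of t is the one minimising the quadratic polynomial P, with p + 1 in place
of p to avoid a zero denominator. *)
Lemma semidefinite_kernel m v : (forall k l, m k l = m l k) ->
  (forall x, 0 <= qform m x x) -> qform m v v = 0 ->
  forall k, \sum_l m k l * v l = 0.
Proof.
move=> mC m0 mv k; set g := \sum_l _.
pose e : 'I_n -> R := fun l => (l == k)%:R.
pose p := qform m e e.
have P t : 0 <= 2 * t * g + t ^+ 2 * p.
  have := m0 (fun l => v l + t * e l).
  rewrite qformDl qformZl !qformDr !qformZr mv.
  rewrite (qformC v e) // (qform_delta _ k v) -/g -/p add0r.
  by move=> H; rewrite [X in 0 <= X](_ : _ = t * g + t * (g + t * p)) //; ring.
have q0 : 0 < p + 1 by rewrite ltr_wpDl // m0.
have := P (- g / (p + 1)).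
have -> : 2 * (- g / (p + 1)) * g + (- g / (p + 1)) ^+ 2 * p =
   - (g ^+ 2 * (p + 2)) / (p + 1) ^+ 2 by field; rewrite gt_eqF.
rewrite mulNr oppr_ge0 pmulr_lle0 ?invr_gt0 ?exprn_gt0 // pmulr_lle0; last first.
  by rewrite (lt_trans q0) // ltrD2l ltr1n.
by move=> g0; apply/eqP; rewrite -sqrf_eq0 eq_le g0 sqr_ge0.
Qed.

(** A minimiser of the Rayleigh quotient may be replaced by its absolute value, because the
off-diagonal coefficients only gain from equal signs. This is where positivity of the first
eigenfunction comes from. *)
Lemma ground_state c w : (0 < n)%N -> (forall k l, c k l = c l k) ->
  (forall k l, k != l -> c k l <= 0) -> (forall k, 0 < w k) ->
  exists v (mu : R), [/\ forall k, 0 <= v k, exists k, 0 < v k,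
    forall k, \sum_l c k l * v l = mu * w k * v k &
    forall x, mu * (\sum_k w k * x k ^+ 2) <= qform c x x].
Proof.
move=> n0 cC cneg w0.
pose W x := \sum_k w k * x k ^+ 2.
pose tox (z : 'rV[R]_n) : 'I_n -> R := z 0.
pose S := [set z : 'rV[R]_n | W (tox z) = 1].
have coordC k : continuous (fun z : 'rV[R]_n => z 0 k) by exact: coord_continuous.
have Wc : continuous (fun z : 'rV[R]_n => W (tox z)).
  move=> z; apply: (cvg_sumr (nbhs_filter z)) => k _; apply: cvgM; first exact: cvg_cst.
  by under eq_fun do rewrite expr2; apply: cvgM; exact: coordC.
have Qc0 : continuous (fun z : 'rV[R]_n => qform c (tox z) (tox z)).
  move=> z; apply: (cvg_sumr (nbhs_filter z)) => k _; apply: (cvg_sumr (nbhs_filter z)) => l _.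
  by apply: cvgM; [apply: cvgM; [exact: cvg_cst|exact: coordC]|exact: coordC].
have Qc : continuous (fun z : 'rV[R]_n => - qform c (tox z) (tox z)).
  by move=> z; apply: (cvgN (Qc0 z)).
have W_gt0 x : (exists k, x k != 0) -> 0 < W x.
  move=> [k xk]; rewrite /W (bigD1 k) //= ltr_pwDl //; first by rewrite mulr_gt0 // lt_def sqr_ge0 sqrf_eq0 xk.
  by apply: sumr_ge0 => l _; rewrite mulr_ge0 ?sqr_ge0 ?ltW.
have WZ t x : W (fun k => t * x k) = t ^+ 2 * W x.
  by rewrite /W mulr_sumr; apply: eq_bigr => k _; ring.
have QZ t x : qform c (fun k => t * x k) (fun k => t * x k) = t ^+ 2 * qform c x x.
  by rewrite qformZl qformZr; ring.
have norm_S x : (exists k, x k != 0) ->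
    S (\row_k ((Num.sqrt (W x))^-1 * x k)) /\
    tox (\row_k ((Num.sqrt (W x))^-1 * x k)) = (fun k => (Num.sqrt (W x))^-1 * x k).
  move=> x0; have Wx := W_gt0 x x0.
  have E : tox (\row_k ((Num.sqrt (W x))^-1 * x k)) = (fun k => (Num.sqrt (W x))^-1 * x k).
    by apply/funext => k; rewrite /tox mxE.
  by split=> //; rewrite /S /= E WZ exprVn sqr_sqrtr ?ltW // mulVf ?gt_eqF.
have S0 : S !=set0.
  have [|h _] := norm_S (fun=> 1); first by exists (Ordinal n0); rewrite oner_eq0.
  by eexists; exact: h.
have Scl : closed S.
  apply: (closed_comp (f := fun z : 'rV[R]_n => W (tox z)) (D := [set 1])).
    by move=> z _; exact: Wc.
  exact: closed_eq.
have Sb : S `<=` box 0 (\sum_k (w k)^-1 + 1).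
  move=> z Sz k; rewrite mxE subr0.
  have wz : w k * z 0 k ^+ 2 <= 1.
    rewrite -Sz /W (bigD1 k) //= lerDl sumr_ge0 // => l _.
    by rewrite mulr_ge0 ?sqr_ge0 // ltW.
  have h1 : z 0 k ^+ 2 <= (w k)^-1 by rewrite -[leRHS]mul1r ler_pdivlMr // mulrC.
  have h2 : (w k)^-1 <= \sum_k (w k)^-1.
    by rewrite (bigD1 k) //= lerDl sumr_ge0 // => l _; rewrite invr_ge0 ltW.
  have : `|z 0 k| ^+ 2 <= \sum_k (w k)^-1 by rewrite real_normK ?num_real // (le_trans h1).
  have : 0 <= \sum_k (w k)^-1 by apply: sumr_ge0 => l _; rewrite invr_ge0 ltW.
  by move: (normr_ge0 (z 0 k)); set a := `|_|; set b := \sum_k _; nra.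
have [z Sz zmin] := EVT_box Qc Scl S0 Sb.
pose mu := qform c (tox z) (tox z).
have P x : mu * W x <= qform c x x.
  have [x0|x0] := pselect (exists k, x k != 0); last first.
    have xE : x = (fun k => 0 * x k).
      by apply/funext => k; rewrite mul0r; apply/eqP; apply: contra_notT x0 => xk; exists k.
    by rewrite xE WZ QZ expr0n /= !mul0r mulr0.
  have [Sx xE] := norm_S x x0; have Wx := W_gt0 x x0.
  have := zmin _ Sx; rewrite lerN2 xE QZ exprVn sqr_sqrtr ?(ltW Wx) //.
  by rewrite [X in _ <= X]mulrC ler_pdivlMr.
pose v k : R := `|z 0 k|.
have Wv : W v = 1.
  by rewrite -Sz; apply: eq_bigr => k _; rewrite /v real_normK ?num_real.
pose m k l : R := c k l - mu * w k * (k == l)%:R.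
have qm x : qform m x x = qform c x x - mu * W x.
  rewrite /qform /W mulr_sumr -sumrB; apply: eq_bigr => k _.
  have -> : mu * (w k * x k ^+ 2) = \sum_l mu * w k * (k == l)%:R * x k * x l.
    rewrite (bigD1 k) //= eqxx mulr1 big1 ?addr0 => [|l]; first by ring.
    by rewrite eq_sym => /negPf ->; rewrite mulr0 !mul0r.
  by rewrite -sumrB; apply: eq_bigr => l _; rewrite /m; ring.
have vm : qform m v v = 0.
  apply/eqP; rewrite eq_le qm subr_ge0 P andbT subr_le0 Wv mulr1.
  apply: ler_sum => k _; apply: ler_sum => l _.
  have [<-|kl] := eqVneq k l.
    by rewrite -!mulrA /v -expr2 real_normK ?num_real // expr2.
  rewrite -!mulrA ler_wnM2l ?cneg // /v -normrM; exact: ler_norm.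
have ker := @semidefinite_kernel m v _ _ vm.
exists v, mu; split.
- by move=> k; exact: normr_ge0.
- apply: contrapT => nov; suff : W v = 0 by rewrite Wv => /eqP; rewrite oner_eq0.
  apply: big1 => k _; suff -> : v k = 0 by rewrite expr0n mulr0.
  apply/eqP; apply: contra_notT nov => vk; exists k.
  by rewrite lt_def vk normr_ge0.
- move=> k; have : \sum_l m k l * v l = 0.
    apply: ker => [i j|x]; last by rewrite qm subr_ge0.
    rewrite /m cC; have [->//|ij] := eqVneq i j.
    by rewrite !mulr0.
  rewrite /m; under eq_bigr do rewrite mulrBl.
  rewrite sumrB (bigD1 k (F := fun i => mu * w k * (k == i)%:R * v i)) //= eqxx.
  rewrite [X in _ - (_ + X)]big1 => [|l]; last by rewrite eq_sym => /negPf ->; rewrite mulr0 mul0r.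
  by rewrite addr0 mulr1 => /subr0_eq.
- exact: P.
Qed.

End GroundState.

(** * Ground states of the lattice Laplacian *)

Section Lattice.
Context {R : realType} {N : nat}.
Implicit Types (x y z c p : 'rV[R]_N) (r s t h mu : R) (i j : 'I_N)
  (u v : 'rV[R]_N -> R) (V : 'rV[R]_N -> R) (Omega : set 'rV[R]_N).

(** Functions on the lattice of mesh h are encoded as functions on the whole space which factor
through this projection, so that functions for different meshes have a common domain. *)
Definition gridp h x : 'rV[R]_N := \row_i (h * (Num.floor (x 0 i / h))%:~R).

Lemma gridp_ge h x i : 0 < h -> gridp h x 0 i <= x 0 i.
Proof.
by move=> h0; rewrite mxE mulrC -ler_pdivlMr // floor_le_tmp.
Qed.

Lemma gridp_lt h x i : 0 < h -> x 0 i < gridp h x 0 i + h.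
Proof.
move=> h0; rewrite mxE -[X in _ + X]mulr1 -mulrDr mulrC -ltr_pdivrMr //.
by rewrite -intrD1 floorD1_gt.
Qed.

Lemma gridp_box h x : 0 < h -> box x h (gridp h x).
Proof.
move=> h0 i; rewrite distrC ger0_norm ?subr_ge0 ?gridp_ge //.
by rewrite lerBlDl ltW ?gridp_lt.
Qed.

Lemma gridp_shift h x i (k : int) : 0 < h ->
  gridp h (x + (k%:~R * h) *: ax i) = gridp h x + (k%:~R * h) *: ax i.
Proof.
move=> h0; apply/rowP => j; rewrite shiftE [in LHS]mxE shiftE [in RHS]mxE.
have [->|ji] := eqVneq j i; last by rewrite !mulr0 !addr0.
rewrite !mulr1 mulrDl mulfK ?gt_eqF // real_floorDrz ?num_real ?intr_int // intrKfloor.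
by rewrite intrD mulrDr [_ * h]mulrC.
Qed.

Lemma gridp_idem h x : 0 < h -> gridp h (gridp h x) = gridp h x.
Proof.
move=> h0; apply/rowP => j; rewrite [in LHS]mxE [in RHS]mxE [in LHS]mxE.
by rewrite mulrAC divff ?gt_eqF // mul1r intrKfloor.
Qed.

Lemma gridp_shift1 h x i : 0 < h -> gridp h (x + h *: ax i) = gridp h x + h *: ax i.
Proof. by move=> h0; have := gridp_shift x i 1 h0; rewrite mul1r. Qed.

Lemma gridp_shiftN1 h x i : 0 < h -> gridp h (x - h *: ax i) = gridp h x - h *: ax i.
Proof. by move=> h0; have := gridp_shift x i (-1) h0; rewrite mulrN1z mulN1r scaleNr. Qed.

Definition cellwise h v := forall x, v (gridp h x) = v x.

Lemma dlap_cellwise h v x : 0 < h -> cellwise h v -> dlap h v (gridp h x) = dlap h v x.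
Proof.
move=> h0 vc; apply: eq_bigr => i _.
by rewrite -gridp_shift1 // -gridp_shiftN1 // !vc.
Qed.

(** The coordinates of a lattice point of the unit box are h times integers between - m and m. *)
Lemma grid_enum (m : nat) Omega : (0 < m)%N -> Omega `<=` box 0 1 ->
  exists2 s : seq 'rV[R]_N, uniq s &
    forall x, x \in s <-> Omega x /\ gridp m%:R^-1 x = x.
Proof.
move=> m0 Ob; pose h : R := m%:R^-1.
have mp : 0 < m%:R :> R by rewrite ltr0n.
have h0 : 0 < h by rewrite invr_gt0.
pose T := {ffun 'I_N -> 'I_(2 * m).+1}.
pose pt (z : T) : 'rV[R]_N := \row_i (h * ((z i : nat)%:Z - m%:Z)%:~R).
have ptg (z : T) : gridp h (pt z) = pt z.
  apply/rowP => i; rewrite !mxE mulrAC divff ?gt_eqF // mul1r intrKfloor.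
  by [].
exists (undup [seq pt g | g <- [seq g : T <- enum {: T} | `[<Omega (pt g)>]]]).
  exact: undup_uniq.
move=> x; rewrite mem_undup; split.
  by move=> /mapP[z]; rewrite mem_filter => /andP[/asboolP Oz _] ->; split=> //; exact: ptg.
move=> [Ox xg].
pose z : T := [ffun i => inord (absz (Num.floor (x 0 i / h) + m%:Z))].
have zx : pt z = x.
  rewrite -xg; apply/rowP => i; rewrite !mxE ffunE; congr (_ * _%:~R).
  have xi : `|x 0 i| <= 1 by have := Ob _ Ox i; rewrite mxE subr0.
  have /andP[x1 x2] : - m%:R <= x 0 i / h <= m%:R.
    rewrite -ler_norml normrM (gtr0_norm (x := h^-1)) ?invr_gt0 // /h invrK.
    by rewrite ler_piMl // ltW.
  have f1 : (- m%:Z <= Num.floor (x 0 i / h))%R.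
    by rewrite floor_ge_int_tmp rmorphN /=.
  have f2 : (Num.floor (x 0 i / h) <= m%:Z)%R.
    by rewrite -(ler_int R) (le_trans (floor_le_tmp _)).
  rewrite -/h inordK; last by lia.
  by lia.
by apply/mapP; exists z => //; rewrite mem_filter mem_enum andbT zx; apply/asboolP.
Qed.

(** With q = r^2 - |x - p|^2, the function q alone has Laplacian - 2 N, which is not bounded by a
multiple of q near the edge of the ball; the square corrects this, since its Laplacian is there
approximately 8 r^2. *)
Definition bump p r x : R :=
  let q := r ^+ 2 - sqnorm (x - p) in q + N%:R / r ^+ 2 * q ^+ 2.

Lemma bump_dlap h p r x : 0 < r -> (0 < N)%N ->
  - dlap h (bump p r) x <=
    h ^+ 2 * ((4 * N%:R ^+ 2 + 8 * N%:R) / r ^+ 2 * (r ^+ 2 - sqnorm (x - p))).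
Proof.
move=> r0 N0; set q := r ^+ 2 - sqnorm (x - p).
pose A : R := N%:R / r ^+ 2.
have A0 : 0 <= A by rewrite divr_ge0 ?sqr_ge0.
have dE : dlap h (bump p r) x = \sum_(i < N) (- 2 * h ^+ 2
    + A * (h ^+ 2 * (- 4 * q + 2 * h ^+ 2) + 8 * h ^+ 2 * (x - p) 0 i ^+ 2)).
  apply: eq_bigr => i _; rewrite /bump -/A -[- (h *: ax i)]scaleNr !(addrAC x _ (- p)) !sqnorm_shift /q.
  by ring.
have -> : dlap h (bump p r) x = h ^+ 2 * (- (6 * N%:R) * - 1
    - (4 * N%:R ^+ 2 + 8 * N%:R) / r ^+ 2 * q) + 2 * h ^+ 4 * N%:R * A.
  rewrite dE big_split /= sumr_const card_ord -mulr_sumr big_split /= sumr_const card_ord.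
  rewrite -mulr_sumr -/(sqnorm (x - p)) -[_ * h ^+ 2 *+ N]mulr_natr -[h ^+ 2 * _ *+ N]mulr_natr /q /A.
  by field; rewrite gt_eqF.
rewrite opprD mulrBr opprB.
have h4 : 0 <= 2 * h ^+ 4 * N%:R * A.
  by rewrite mulr_ge0 // mulr_ge0 // mulr_ge0 // (_ : h ^+ 4 = (h ^+ 2) ^+ 2) ?sqr_ge0 // -exprM.
have h2 : 0 <= h ^+ 2 * (- (6 * N%:R) * - 1).
  by rewrite mulr_ge0 ?sqr_ge0 // mulrNN mulr1 mulr_ge0.
by lra.
Qed.

(** Within one mesh outside of the ball the bump is not positive, so replacing it by zero there
only increases the Laplacian inside. *)
Lemma bump_le0 h p r x y : (0 < N)%N -> 0 < r -> 0 <= h -> h <= r / (3 * N%:R) ->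
  sqnorm (x - p) < r ^+ 2 -> lattice_nbr h x y -> r ^+ 2 <= sqnorm (y - p) ->
  bump p r y <= 0.
Proof.
move=> N0 r0 h0 hr xr xy yr.
have N1 : 1 <= N%:R :> R by rewrite ler1n.
have hr' : 3 * N%:R * h <= r by rewrite mulrC -ler_pdivlMr // mulr_gt0 // ltr0n.
have [i xi] : exists i, sqnorm (y - p) <= sqnorm (x - p) + 2 * h * `|(x - p) 0 i| + h ^+ 2.
  case: xy => i xy; exists i.
  have [t [ty tt th]] : exists t, [/\ y = x + t *: ax i, t ^+ 2 = h ^+ 2 & `|t| = h].
    case: xy => ->; first by exists h; rewrite ger0_norm.
    by exists (- h); rewrite scaleNr sqrrN normrN ger0_norm.
  rewrite ty addrAC sqnorm_shift tt lerD2r lerD2l -mulrA -[X in _ <= X]mulrA.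
  by rewrite ler_wpM2l // -[X in _ <= X * _]th -normrM ler_norm.
have xi2 : `|(x - p) 0 i| <= r by apply: normr_coord_sqnorm; exact: ltW.
rewrite /bump; set q := r ^+ 2 - _.
have q0 : q <= 0 by rewrite subr_le0.
have qr : - (r ^+ 2 / N%:R) <= q.
  rewrite lerNl ler_pdivlMr ?ltr0n // /q opprB.
  move: xi xi2 hr' xr N1; set a := sqnorm _; set b := sqnorm _; set n := N%:R; set d := `|_|.
  move=> ab dr hr' br n1.
  have hd : h * d <= h * r by rewrite ler_wpM2l.
  have : n * h * r <= r / 3 * r by rewrite ler_pM2r //; lra.
  have : n * h * h <= r / 3 * r by apply: ler_pM; rewrite ?mulr_ge0 //; nra.
  have : (a - r ^+ 2) * n <= (2 * (h * r) + h ^+ 2) * n.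
    by rewrite ler_wpM2r //; lra.
  by rewrite !expr2; lra.
have -> : q + N%:R / r ^+ 2 * q ^+ 2 = q * (N%:R / r ^+ 2 * (r ^+ 2 / N%:R + q)).
  by field; rewrite !gt_eqF // ltr0n.
rewrite mulr_le0_ge0 // mulr_ge0 ?divr_ge0 ?sqr_ge0 //.
by rewrite -lerBlDl sub0r.
Qed.

(** The positive part of the bump is a test function whose Rayleigh quotient is bounded
independently of the mesh. *)
Lemma lattice_ground_state (m : nat) Omega V p r (v1 : R) (h := m%:R^-1 : R) :
  (0 < N)%N -> (0 < m)%N -> Omega `<=` box 0 1 ->
  0 < r -> h <= r / (3 * N%:R) ->
  (forall x, sqnorm (x - p) < r ^+ 2 -> Omega x) ->
  0 < v1 -> (forall x, Omega x -> v1 <= V x) ->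
  exists v mu,
  [/\ cellwise h v, forall x, 0 <= v x <= 1 /\ (~ Omega (gridp h x) -> v x = 0),
      exists x, [/\ Omega x, gridp h x = x & v x = 1],
      forall x, Omega (gridp h x) -> - dlap h v x = mu * h ^+ 2 * V (gridp h x) * v x
    & 0 <= mu <= (4 * N%:R ^+ 2 + 8 * N%:R) / (r ^+ 2 * v1)].
Proof.
move=> N0 m0 Ob r0 hr pO v10 v1V.
have h0 : 0 < h by rewrite invr_gt0 ltr0n.
have [s us sP] := grid_enum m0 Ob; rewrite -/h in sP.
pose K := size s.
pose P (k : 'I_K) : 'rV[R]_N := s`_k.
have Ps k : P k \in s by rewrite mem_nth.
have Pinj k l : P k = P l -> k = l.
  by move=> /eqP; rewrite /P nth_uniq // => /eqP/val_inj.
have Psurj x : Omega x -> gridp h x = x -> exists k, P k = x.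
  move=> Ox xg; have xs : x \in s by apply/sP.
  by exists (Ordinal (etrans (index_mem x s) xs)); rewrite /P /= nth_index.
have PO k : Omega (P k) by have /sP[] := Ps k.
have Pg k : gridp h (P k) = P k by have /sP[] := Ps k.
have pr : sqnorm (gridp h p - p) < r ^+ 2.
    apply: (@le_lt_trans _ _ (N%:R * h ^+ 2)).
      by apply: sqnorm_box; exact: gridp_box.
    have N1 : 1 <= N%:R :> R by rewrite ler1n.
    have hr' : 3 * N%:R * h <= r by rewrite mulrC -ler_pdivlMr // mulr_gt0 // ltr0n.
    move: hr' N1; set n := N%:R => hr' n1.
    have : n * h <= r / 3 by lra.
    have : n * h * h <= r / 3 * (r / 3) by apply: ler_pM; rewrite ?mulr_ge0 //; nra.
    by have := mulr_gt0 r0 r0; rewrite !expr2; lra.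
have [kp kpE] := Psurj _ (pO _ pr) (gridp_idem _ h0).
have K0 : (0 < K)%N by exact: leq_ltn_trans (ltn_ord kp).
(* extension by zero of a function on the lattice points of Omega *)
pose ext (phi : 'I_K -> R) x : R := \sum_k (P k == gridp h x)%:R * phi k.
have extP phi k : ext phi (P k) = phi k.
  rewrite /ext (bigD1 k) //= Pg eqxx mul1r big1 ?addr0 // => l lk.
  suff -> : (P l == P k) = false by rewrite mul0r.
  by apply/eqP => /Pinj/eqP; rewrite (negPf lk).
have ext0 phi x : ~ Omega (gridp h x) -> ext phi x = 0.
  move=> nO; apply: big1 => k _; suff -> : (P k == gridp h x) = false by rewrite mul0r.
  by apply/eqP => kx; apply: nO; rewrite -kx.
have extc phi : cellwise h (ext phi) by move=> x; rewrite /ext gridp_idem.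
have extE phi x : Omega (gridp h x) -> exists k, P k = gridp h x /\ ext phi x = phi k.
  move=> Ox; have [k kx] := Psurj _ Ox (gridp_idem _ h0).
  by exists k; rewrite -extP kx extc.
pose a k l : R := \sum_(i < N) ((P l == P k + h *: ax i)%:R + (P l == P k - h *: ax i)%:R).
pose c k l : R := 2 * N%:R * (k == l)%:R - a k l.
have a0 k l : 0 <= a k l by apply: sumr_ge0 => i _; rewrite addr_ge0.
have aC k l : a k l = a l k.
  apply: eq_bigr => i _; rewrite addrC; congr (_%:R + _%:R).
    by rewrite eq_sym subr_eq.
  by congr nat_of_bool; rewrite [RHS]eq_sym subr_eq.
have cdlap phi k : \sum_l c k l * phi l = - dlap h (ext phi) (P k).
  rewrite /c; under eq_bigr do rewrite mulrBl.
  rewrite sumrB (bigD1 k) //= eqxx mulr1 big1 ?addr0 => [|l]; last first.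
    by rewrite eq_sym => /negPf ->; rewrite mulr0 mul0r.
  have -> : \sum_l a k l * phi l =
      \sum_(i < N) (ext phi (P k + h *: ax i) + ext phi (P k - h *: ax i)).
    rewrite /a; under eq_bigr do rewrite mulr_suml.
    rewrite exchange_big /=; apply: eq_bigr => i _.
    rewrite /ext gridp_shift1 // gridp_shiftN1 // Pg -big_split /=.
    by apply: eq_bigr => l _; rewrite mulrDl.
  rewrite /dlap sumrB opprB sumr_const card_ord extP -[_ *+ N]mulr_natr; ring.
have cC k l : c k l = c l k by rewrite /c aC eq_sym.
have cneg k l : k != l -> c k l <= 0.
  by move=> /negPf kl; rewrite /c kl mulr0 sub0r oppr_le0.
have w0 k : 0 < h ^+ 2 * V (P k).
  by rewrite mulr_gt0 ?exprn_gt0 // (lt_le_trans v10) // v1V.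
have [v [mu [v0 [k0 vk0] veq vmin]]] := ground_state K0 cC cneg w0.
pose M := \big[Num.max/0]_k v k.
have vM k : v k <= M by exact: le_bigmax.
have M0 : 0 < M by exact: lt_le_trans (vM k0).
have [k1 vk1] : exists k, v k = M.
  apply: contrapT => nk; have : M < M by apply/bigmax_ltP; split=> // k _; rewrite lt_neqAle vM andbT; apply/eqP => kM; apply: nk; exists k.
  by rewrite ltxx.
pose u x := M^-1 * ext v x.
have u01 x : 0 <= u x <= 1.
  have [Ox|/ext0 e0] := pselect (Omega (gridp h x)); last by rewrite /u e0 mulr0 lexx ler01.
  have [k [_ kE]] := extE v x Ox.
  by rewrite /u kE mulr_ge0 ?invr_ge0 ?(ltW M0) //= ler_pdivrMl // mulr1.
have uk1 : u (P k1) = 1 by rewrite /u extP vk1 mulVf ?gt_eqF.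
have ueq x : Omega (gridp h x) -> - dlap h u x = mu * h ^+ 2 * V (gridp h x) * u x.
  move=> Ox; have [k [kx ek]] := extE v x Ox.
  rewrite dlapZ -(dlap_cellwise x h0 (extc v)) -kx -mulrN -cdlap veq /u ek.
  by ring.
exists u, mu; split.
- by move=> x; rewrite /u extc.
- by move=> x; split=> // /ext0 e0; rewrite /u e0 mulr0.
- by exists (P k1); split.
- exact: ueq.
apply/andP; split.
  have := ueq (P k1); rewrite Pg => /(_ (PO _)); rewrite uk1 mulr1 => E.
  have : 0 <= - dlap h u (P k1).
    rewrite oppr_ge0; apply: sumr_le0 => i _; rewrite uk1.
    have /andP[_ h1] := u01 (P k1 + h *: ax i); have /andP[_ h2] := u01 (P k1 - h *: ax i).
    by lra.
  by rewrite E -mulrA pmulr_lge0.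
(* the Rayleigh quotient of the bump *)
pose phi k := if sqnorm (P k - p) < r ^+ 2 then bump p r (P k) else 0.
pose C : R := (4 * N%:R ^+ 2 + 8 * N%:R) / (r ^+ 2 * v1).
have C0 : 0 <= C.
  by rewrite divr_ge0 ?addr_ge0 ?mulr_ge0 ?sqr_ge0 // ltW.
have q_le x : r ^+ 2 - sqnorm (x - p) <= bump p r x.
  by rewrite /bump lerDl mulr_ge0 ?divr_ge0 ?sqr_ge0.
have in_bump k : sqnorm (P k - p) < r ^+ 2 -> forall y, lattice_nbr h (P k) y ->
    bump p r y <= ext phi y.
  move=> kr y ky.
  have yg : gridp h y = y by case: ky => i [] ->; rewrite ?gridp_shift1 ?gridp_shiftN1 ?Pg.
  have out : r ^+ 2 <= sqnorm (y - p) -> bump p r y <= 0.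
    exact: bump_le0 (ltW h0) hr kr ky.
  have [Oy|nOy] := pselect (Omega y); last first.
    rewrite ext0 ?yg //; apply: out; rewrite leNgt; apply/negP => /pO; exact: nOy.
  have [k' k'y] := Psurj _ Oy yg.
  by rewrite -[X in ext _ X]k'y extP /phi k'y; case: ltP => // /out.
have key k : phi k * (\sum_l c k l * phi l) <= C * (h ^+ 2 * V (P k) * phi k ^+ 2).
  rewrite /phi; case: ltP => kr; last by rewrite mul0r expr0n !mulr0.
  have q0 : 0 < r ^+ 2 - sqnorm (P k - p) by rewrite subr_gt0.
  have b0 : 0 <= bump p r (P k) by rewrite (le_trans (ltW q0)).
  have phik : ext phi (P k) = bump p r (P k) by rewrite extP /phi kr.
  rewrite -/phi cdlap [X in _ <= X](_ : _ = bump p r (P k) * (h ^+ 2 * (C * V (P k) * bump p r (P k)))); last by ring.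
  rewrite ler_wpM2l // (@le_trans _ _ (- dlap h (bump p r) (P k))) //.
    rewrite lerN2; apply: ler_sum => i _; rewrite phik lerD2r; apply: lerD.
      exact: (in_bump k kr _ (ex_intro _ i (or_introl erefl))).
    exact: (in_bump k kr _ (ex_intro _ i (or_intror erefl))).
  rewrite (le_trans (bump_dlap h p (P k) r0 N0)) // ler_wpM2l ?sqr_ge0 //.
  apply: ler_pM; rewrite ?(ltW q0) //.
    apply: divr_ge0; last exact: sqr_ge0.
    by apply: addr_ge0; rewrite mulr_ge0 ?sqr_ge0.
  have -> : (4 * N%:R ^+ 2 + 8 * N%:R) / r ^+ 2 = C * v1.
    by rewrite /C; field; rewrite !gt_eqF.
  by rewrite ler_wpM2l // v1V.
have Wpos : 0 < \sum_k h ^+ 2 * V (P k) * phi k ^+ 2.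
  rewrite (bigD1 kp) //= ltr_pwDl //; last first.
    by apply: sumr_ge0 => l _; rewrite mulr_ge0 ?sqr_ge0 // ltW.
  rewrite mulr_gt0 // exprn_gt0 // /phi kpE pr (lt_le_trans _ (q_le _)) // subr_gt0 //.
rewrite -(ler_pM2r Wpos) (le_trans (vmin phi)) // mulr_sumr.
apply: ler_sum => k _; apply: le_trans (key k).
by rewrite mulr_sumr; apply: ler_sum => l _; rewrite mulrCA mulrA.
Qed.

End Lattice.

(** * Functions with bounded difference quotients *)

Section DifferenceCalculus.
Context {R : realType} {N : nat}.
Implicit Types (x y z : 'rV[R]_N) (r C : R) (i j : 'I_N) (n k : nat)
  (f g : nat -> 'rV[R]_N -> R) (Omega : set 'rV[R]_N).

Definition mesh n : R := n.+1%:R^-1.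

Lemma mesh_gt0 n : 0 < mesh n.
Proof. by rewrite invr_gt0 ltr0n. Qed.

Lemma near_mesh r : 0 < r -> \forall n \near \oo, mesh n <= r.
Proof.
move=> r0; near=> n; apply: ltW; near: n.
exact: (near_infty_natSinv_lt (PosNum r0)).
Unshelve. all: by end_near. Qed.

(** The index n of a family stands for the mesh 1 / (n + 1); the bound holds on boxes and not only
at lattice points, and for fine meshes only, since a neighbour has to stay in the box. *)
Definition lbd Omega f : Prop := forall x, Omega x ->
  exists r C, [/\ 0 < r, 0 <= C & \forall n \near \oo, forall y, box x r y -> `|f n y| <= C].

Definition dq i f n x : R := (f n (x + mesh n *: ax i) - f n x) / mesh n.

Definition fshift i f n x : R := f n (x + mesh n *: ax i).

Definition fmul f g n x : R := f n x * g n x.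

(** The analogue of C^k bounds for functions depending on the mesh. *)
Fixpoint lbdk k Omega f : Prop :=
  lbd Omega f /\ if k is k'.+1 then forall i, lbdk k' Omega (dq i f) else True.

Lemma lbdkSP k Omega f :
  lbdk k.+1 Omega f <-> lbd Omega f /\ forall i, lbdk k Omega (dq i f).
Proof. by []. Qed.

Lemma lbdk_lbd k Omega f : lbdk k Omega f -> lbd Omega f.
Proof. by case: k => [[]|k []]. Qed.

Lemma lbdkS k Omega f : lbdk k.+1 Omega f -> lbdk k Omega f.
Proof.
elim: k f => [f [fO _]|k IH f [fO dfO]] //.
by split=> // i; apply: IH; exact: dfO.
Qed.

Lemma lbdD Omega f g : lbd Omega f -> lbd Omega g -> lbd Omega (fun n x => f n x + g n x).
Proof.
move=> fO gO x Ox; have [r [C [r0 C0 fC]]] := fO x Ox; have [s [D [s0 D0 gD]]] := gO x Ox.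
exists (Num.min r s), (C + D); split; rewrite ?lt_min ?r0 ?addr_ge0 //.
apply: filterS2 fC gD => n fC gD y xy; rewrite (le_trans (ler_normD _ _)) // lerD //.
  by apply: fC; apply: box_le xy; rewrite ge_min lexx.
by apply: gD; apply: box_le xy; rewrite ge_min lexx orbT.
Qed.

Lemma lbdM Omega f g : lbd Omega f -> lbd Omega g -> lbd Omega (fmul f g).
Proof.
move=> fO gO x Ox; have [r [C [r0 C0 fC]]] := fO x Ox; have [s [D [s0 D0 gD]]] := gO x Ox.
exists (Num.min r s), (C * D); split; rewrite ?lt_min ?r0 ?mulr_ge0 //.
apply: filterS2 fC gD => n fC gD y xy; rewrite normrM ler_pM //.
  by apply: fC; apply: box_le xy; rewrite ge_min lexx.
by apply: gD; apply: box_le xy; rewrite ge_min lexx orbT.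
Qed.

Lemma lbd_shift Omega i f : lbd Omega f -> lbd Omega (fshift i f).
Proof.
move=> fO x Ox; have [r [C [r0 C0 fC]]] := fO x Ox.
exists (r / 2), C; split; rewrite ?divr_gt0 //.
have hr := near_mesh (divr_gt0 r0 (ltr0n R 2)).
apply: filterS2 fC hr => n fC hr y xy; apply: fC; rewrite [r]splitr.
by apply: box_shift => //; rewrite ger0_norm // ltW // mesh_gt0.
Qed.

Lemma dqD i f g : dq i (fun n x => f n x + g n x) = (fun n x => dq i f n x + dq i g n x).
Proof. by apply/funext => n; apply/funext => x; rewrite /dq; ring. Qed.

Lemma dqM i f g :
  dq i (fmul f g) = (fun n x => fmul (dq i f) (fshift i g) n x + fmul f (dq i g) n x).
Proof. by apply/funext => n; apply/funext => x; rewrite /fmul /fshift /dq; ring. Qed.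

Lemma dq_shift i j f : dq j (fshift i f) = fshift i (dq j f).
Proof. by apply/funext => n; apply/funext => x; rewrite /dq /fshift addrAC. Qed.

Lemma lbdkD k Omega f g : lbdk k Omega f -> lbdk k Omega g ->
  lbdk k Omega (fun n x => f n x + g n x).
Proof.
elim: k f g => [f g [fO _] [gO _]|k IH f g /lbdkSP[fO df] /lbdkSP[gO dg]].
  by split=> //; exact: lbdD.
by apply/lbdkSP; split=> [|i]; [exact: lbdD|rewrite dqD; apply: IH].
Qed.

Lemma lbdk_shift k Omega i f : lbdk k Omega f -> lbdk k Omega (fshift i f).
Proof.
elim: k f => [f [fO _]|k IH f /lbdkSP[fO df]].
  by split=> //; exact: lbd_shift.
by apply/lbdkSP; split=> [|j]; [exact: lbd_shift|rewrite dq_shift; apply: IH].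
Qed.

Lemma lbdkM k Omega f g : lbdk k Omega f -> lbdk k Omega g -> lbdk k Omega (fmul f g).
Proof.
elim: k f g => [f g [fO _] [gO _]|k IH f g F G]; first by split=> //; exact: lbdM.
have /lbdkSP[fO df] := F; have /lbdkSP[gO dg] := G; apply/lbdkSP; split; first exact: lbdM.
move=> i; rewrite dqM; apply: lbdkD; apply: IH => //.
- by apply: lbdk_shift; exact: lbdkS.
- exact: lbdkS.
Qed.

Lemma lbdk_cst k Omega (c : nat -> R) C : (forall n, `|c n| <= C) -> lbdk k Omega (fun n _ => c n).
Proof.
move=> cC; have b D d : (forall n, `|d n| <= D) -> lbd Omega (fun n _ => d n : R).
  move=> dD x _; exists 1, D; split=> //; first exact: le_trans (dD 0%N).
  by near=> n => y _.
have dq0 d i : dq i (fun n _ => d n) = (fun _ _ => 0).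
  by apply/funext => n; apply/funext => x; rewrite /dq subrr mul0r.
have z k' : lbdk k' Omega (fun _ _ => 0).
  elim: k' => [|k' IH]; split; rewrite //; try by apply: (b 0) => n; rewrite normr0.
  by move=> i; rewrite (dq0 (fun=> 0)).
by case: k => [|k]; split=> //; try (exact: b cC); move=> i; rewrite dq0; exact: z.
Unshelve. all: by end_near. Qed.

Lemma lbdk_near k Omega f g :
  (forall x, Omega x -> exists2 r, 0 < r &
     \forall n \near \oo, forall y, box x r y -> f n y = g n y) ->
  lbdk k Omega f -> lbdk k Omega g.
Proof.
have base f1 f2 : (forall x, Omega x -> exists2 r, 0 < r &
     \forall n \near \oo, forall y, box x r y -> f1 n y = f2 n y) ->
    lbd Omega f1 -> lbd Omega f2.
  move=> E F1 x Ox; have [r [C [r0 C0 fC]]] := F1 x Ox; have [s s0 fE] := E x Ox.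
  exists (Num.min r s), C; split; rewrite ?lt_min ?r0 //.
  apply: filterS2 fC fE => n fC fE y xy; rewrite -fE; first apply: fC.
    by apply: box_le xy; rewrite ge_min lexx.
  by apply: box_le xy; rewrite ge_min lexx orbT.
elim: k f g => [|k IH] f g E; first by move=> [F _]; split=> //; exact: base E F.
move=> /lbdkSP[F dF]; apply/lbdkSP; split; first exact: base E F.
move=> j; apply: (IH (dq j f)) (dF j) => x Ox; have [s s0 fE] := E x Ox.
exists (s / 2); rewrite ?divr_gt0 //.
have hs := near_mesh (divr_gt0 s0 (ltr0n R 2)).
apply: filterS2 fE hs => n fE hs y xy.
have e1 : f n y = g n y.
  by apply: fE; apply: box_le xy; rewrite ler_pdivrMr // ler_pMr // ler1n.
rewrite /dq e1 fE // [s]splitr; apply: box_shift => //.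
by rewrite ger0_norm // ltW // mesh_gt0.
Qed.

(** The quotient rule, which holds only where the denominator is nonzero, hence the local
comparison. *)
Lemma lbdkV k Omega f :
  (forall x, Omega x -> exists r c, [/\ 0 < r, 0 < c &
     \forall n \near \oo, forall y, box x r y -> c <= f n y]) ->
  lbdk k Omega f -> lbdk k Omega (fun n x => (f n x)^-1).
Proof.
move=> fpos F.
have b : lbd Omega (fun n x => (f n x)^-1).
  move=> x Ox; have [r [c [r0 c0 fc]]] := fpos x Ox; exists r, c^-1; split=> //.
    by rewrite invr_ge0 ltW.
  apply: filterS fc => n fc y /fc cf; have fp := lt_le_trans c0 cf.
  by rewrite normrV ?unitfE ?gt_eqF // gtr0_norm // lef_pV2.
elim: k F => [|k IH] F; first by split.
apply/lbdkSP; split=> // i.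
have /lbdkSP[_ dF] := F.
pose g n x := - 1 * (dq i f n x * ((f n x)^-1 * fshift i (fun n x => (f n x)^-1) n x)).
have G : lbdk k Omega g.
  apply: (@lbdkM k Omega (fun _ _ => -1)); first by apply: (@lbdk_cst _ _ _ 1) => n; rewrite normrN1.
  apply: (@lbdkM k Omega (dq i f)); first exact: dF.
  have I := IH (lbdkS F).
  by apply: (@lbdkM k Omega (fun n x => (f n x)^-1)) => //; exact: lbdk_shift.
apply: lbdk_near G => x Ox; have [r [c [r0 c0 fc]]] := fpos x Ox.
exists (r / 2); rewrite ?divr_gt0 //.
have hr := near_mesh (divr_gt0 r0 (ltr0n R 2)).
apply: filterS2 fc hr => n fc hr y xy.
have f1 : f n y != 0.
  rewrite gt_eqF // (lt_le_trans c0) // fc //; apply: box_le xy.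
  by rewrite ler_pdivrMr // ler_pMr // ler1n.
have f2 : f n (y + mesh n *: ax i) != 0.
  rewrite gt_eqF // (lt_le_trans c0) // fc // [r]splitr.
  by apply: box_shift => //; rewrite ger0_norm // ltW // mesh_gt0.
by rewrite /g /dq /fshift; field; rewrite f1 f2 gt_eqF // mesh_gt0.
Qed.

Definition lapn f n x : R := dlap (mesh n) (f n) x / mesh n ^+ 2.

Lemma lapn_dq f n x : lapn f n x = \sum_(i < N) dq i (dq i f) n (x - mesh n *: ax i).
Proof.
rewrite /lapn /dlap mulr_suml; apply: eq_bigr => i _; rewrite /dq subrK.
by field; rewrite gt_eqF // mesh_gt0.
Qed.

Lemma dq_lapn i f : lapn (dq i f) = dq i (lapn f).
Proof.
apply/funext => n; apply/funext => x; rewrite /lapn /dq /dlap -mulrBl -sumrB !mulr_suml.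
apply: eq_bigr => j _; rewrite !(addrAC _ _ (mesh n *: ax i)).
by field; rewrite gt_eqF // mesh_gt0.
Qed.

(** The difference quotient is the increment about the midpoint c of one lattice step. *)
Lemma lbd_gradient Omega f i : lbd Omega f -> lbd Omega (lapn f) -> lbd Omega (dq i f).
Proof.
move=> fO lO x Ox; have [r [C [r0 C0 fC]]] := fO x Ox; have [s [D [s0 D0 gD]]] := lO x Ox.
pose d := Num.min r s / 8.
have m0 : 0 < Num.min r s by rewrite lt_min r0.
have d0 : 0 < d by rewrite divr_gt0.
exists d, (4 * N.+2%:R * (C + 1) / d + 2 * d * D); split=> //.
  by rewrite addr_ge0 // ?divr_ge0 ?mulr_ge0 ?addr_ge0 // ltW.
have hd := near_mesh d0.
have d8 : d * 8 = Num.min r s by rewrite /d mulfVK.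
apply: filterS3 fC gD hd => n fC gD hd y xy.
have h0 := mesh_gt0 n.
pose c : 'rV[R]_N := y + (mesh n / 2) *: ax i.
have bxc z : box c (2 * d) z -> box x (Num.min r s) z.
  move=> cz; rewrite -d8; apply: (@box_le _ _ _ (d + d + 2 * d)); first by lra.
  apply: box_trans cz; apply: box_shift => //.
  by rewrite ger0_norm ?divr_ge0 ?(ltW h0) //; lra.
have := @discrete_gradient _ _ (mesh n) d i c (f n) (C + 1) D h0 hd.
rewrite ltr_wpDl // => /(_ isT D0).
have -> : c + (mesh n / 2) *: ax i = y + mesh n *: ax i.
  by rewrite /c -addrA -scalerDl -splitr.
have -> : c - (mesh n / 2) *: ax i = y by rewrite /c addrK.
move=> H; rewrite /dq normrM (gtr0_norm (x := _^-1)) ?invr_gt0 // ler_pdivrMr // mulrC H //.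
  move=> z /bxc xz; rewrite (le_trans (fC z _)) ?lerDl //.
  by apply: box_le xz; rewrite ge_min lexx.
move=> z /bxc xz; have := gD z; rewrite /lapn normrM (gtr0_norm (x := _^-1)) ?invr_gt0 ?exprn_gt0 //.
by rewrite ler_pdivrMr ?exprn_gt0 //; apply; apply: box_le xz; rewrite ge_min lexx orbT.
Qed.

(** Regularity: the lattice Laplacian commutes with difference quotients, so the gradient estimate
may be applied to each of them in turn. *)
Lemma lbdk_elliptic k Omega f : lbd Omega f -> lbdk k Omega (lapn f) -> lbdk k.+1 Omega f.
Proof.
elim: k f => [|k IH] f fO lO; apply/lbdkSP; split=> // i.
  by split=> //; apply: lbd_gradient => //; case: lO.
apply: IH; first by apply: lbd_gradient => //; exact: lbdk_lbd lO.
by rewrite dq_lapn; have /lbdkSP[_] := lO.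
Qed.

End DifferenceCalculus.

(** * Limits of lattice functions *)

(** Limits are taken along an ultrafilter finer than the filter of fine meshes: bounded sequences
then converge without passing to subsequences, and the limits of a function and of its difference
quotients are taken along the same filter. *)

Section UltraLimit.
Context {R : realType} {N : nat} (U : set_system nat) (UU : UltraFilter U).
Context (Uoo : forall A : set nat, (\forall n \near \oo, A n) -> U A).

Lemma ultra_bounded_cvg (f : nat -> R) C : (\forall n \near \oo, `|f n| <= C) ->
  exists l : R, f n @[n --> U] --> l.
Proof.
have FU : ProperFilter U := @ultra_proper _ _ UU.
move=> fC; pose A := [set a | U [set n | a <= f n]].
have UC : U [set n | `|f n| <= C] by exact: Uoo.
have Ane : A !=set0.
  by exists (- C); apply: filterS UC => n /=; rewrite ler_norml => /andP[].
have Aub : ubound A C.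
  move=> a Aa; rewrite leNgt; apply/negP => Ca.
  have [n [/= fa fn]] := filter_ex (filterI Aa UC).
  by have := le_trans fa (le_trans (ler_norm _) fn); rewrite leNgt Ca.
have Asup : has_sup A by split=> //; exists C.
exists (sup A); apply/cvgrPdist_le => e e0.
have [a Aa ae] := sup_adherent e0 Asup.
have h1 : U [set n | sup A - e <= f n].
  by apply: filterS Aa => n /=; apply: le_trans; exact: ltW.
have h2 : U [set n | f n < sup A + e].
  have [//|nU] := in_ultra_setVsetC [set n | f n < sup A + e] UU.
  have : A (sup A + e) by apply: filterS nU => n /= /negP; rewrite -leNgt.
  by move=> /(ub_le_sup (ex_intro _ C Aub)); rewrite gerDl leNgt e0.
by apply: filterS2 h1 h2 => n /= h1 h2; rewrite ler_norml; apply/andP; split; lra.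
Qed.

Implicit Types (x y z : 'rV[R]_N) (Omega : set 'rV[R]_N) (f g : nat -> 'rV[R]_N -> R).

Definition ulim f x : R := lim (f n x @[n --> U]).

Lemma ulim_cvg Omega f x : lbd Omega f -> Omega x -> f n x @[n --> U] --> ulim f x.
Proof.
move=> fO Ox; have [r [C [r0 C0 fC]]] := fO x Ox.
have fx : \forall n \near \oo, `|f n x| <= C.
  by apply: filterS fC => n; apply; exact: box_refl (ltW r0).
have [l fl] := ultra_bounded_cvg fx.
by have FU : ProperFilter U := @ultra_proper _ _ UU; exact: cvgP fl.
Qed.

Lemma cvg_mesh_ultra : mesh n @[n --> U] --> (0 : R).
Proof.
have FU : ProperFilter U := @ultra_proper _ _ UU.
apply/cvgrPdist_le => e e0; apply: Uoo.
near=> n; rewrite sub0r normrN ger0_norm; last by rewrite ltW // mesh_gt0.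
by near: n; exact: near_mesh.
Unshelve. all: by end_near. Qed.

Definition cellwise_seq f := forall n, cellwise (mesh n) (f n).

Lemma cellwise_dq i f : cellwise_seq f -> cellwise_seq (dq i f).
Proof.
by move=> fc n x; have h0 : 0 < mesh n := mesh_gt0 n; rewrite /dq -gridp_shift1 // !fc.
Qed.

(** A displacement along an axis is a whole number of lattice steps, up to one mesh; the last term
is the price of this rounding. *)
Lemma lattice_mean_value f n x i (t G E : R) : cellwise (mesh n) (f n) -> 0 <= t ->
  (forall s, 0 <= s <= t -> `|dq i f n (x + s *: ax i) - G| <= E) ->
  `|f n (x + t *: ax i) - f n x - t * G| <= (t + mesh n) * E + mesh n * `|G|.
Proof.
move=> fc t0 dE; set h := mesh n; have h0 : 0 < h := mesh_gt0 n.
have E0 : 0 <= E by apply: le_trans (dE 0 _); rewrite ?lexx.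
pose a := Num.floor (x 0 i / h); pose b := Num.floor ((x 0 i + t) / h).
have ab : a <= b.
  by rewrite /a /b floor_ge_int_tmp (le_trans (floor_le_tmp _)) // ler_pM2r ?invr_gt0 // lerDl.
pose k := absz (b - a).
have kE : k%:R = (b - a)%:~R :> R by rewrite -[LHS]/(k%:Z%:~R) gez0_abs // subr_ge0.
have kh_lt : k%:R * h < t + h.
  have h1 := floor_le_tmp ((x 0 i + t) / h); have h2 := floorD1_gt (x 0 i / h).
  rewrite ler_pdivlMr // -/b in h1; rewrite intrD ltr_pdivrMr // -/a in h2.
  by rewrite kE intrB; move: h1 h2; rewrite !mulrDl mulNr; lra.
have kh_gt : t - h < k%:R * h.
  have h1 := floorD1_gt ((x 0 i + t) / h); have h2 := floor_le_tmp (x 0 i / h).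
  rewrite intrD ltr_pdivrMr // -/b in h1; rewrite ler_pdivlMr // -/a in h2.
  by rewrite kE intrB; move: h1 h2; rewrite !mulrDl mulNr; lra.
have gx : gridp h (x + t *: ax i) = gridp h (x + (k%:Z%:~R * h) *: ax i).
  rewrite gridp_shift //; apply/rowP => j; rewrite shiftE [in LHS]mxE shiftE [in RHS]mxE.
  have [->|ji] := eqVneq j i; last by rewrite !mulr0 !addr0.
  rewrite !mulr1 -/a -/b [k%:Z%:~R](_ : _ = (b - a)%:~R) // intrB; ring.
have fk : f n (x + t *: ax i) = f n (x + (k%:R * h) *: ax i) by rewrite -fc gx fc.
have step j : (j <= k)%N -> `|f n (x + (j%:R * h) *: ax i) - f n x - (j%:R * h) * G| <= (j%:R * h) * E.
  elim: j => [_|j IH jk]; first by rewrite !mul0r scale0r addr0 subrr subr0 normr0.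
  have sj : 0 <= j%:R * h <= t.
    rewrite mulr_ge0 ?(ltW h0) //=; have : j.+1%:R * h <= k%:R * h by rewrite ler_pM2r // ler_nat.
    by rewrite -natr1 mulrDl mul1r; lra.
  have := dE _ sj; rewrite /dq -addrA -scalerDl -/h.
  have -> : j%:R * h + h = j.+1%:R * h by rewrite -natr1; ring.
  set A := f n (_ + (j.+1%:R * h) *: _); set B := f n (_ + (j%:R * h) *: _) => H1.
  have H2 := IH (ltnW jk); rewrite -/B in H2.
  have -> : A - f n x - j.+1%:R * h * G =
     ((A - B) / h - G) * h + (B - f n x - j%:R * h * G).
    by rewrite -natr1; field; rewrite gt_eqF.
  rewrite (le_trans (ler_normD _ _)) // [X in _ <= X](_ : _ = h * E + j%:R * h * E); last by rewrite -natr1; ring.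
  by rewrite lerD // normrM (gtr0_norm h0) [X in _ <= X]mulrC ler_pM2r.
have -> : f n (x + t *: ax i) - f n x - t * G =
   (f n (x + (k%:R * h) *: ax i) - f n x - k%:R * h * G) + (k%:R * h - t) * G.
  by rewrite fk; ring.
rewrite (le_trans (ler_normD _ _)) // lerD //.
  by rewrite (le_trans (step _ (leqnn k))) // ler_wpM2r // ltW.
rewrite normrM ler_wpM2r // ler_norml; apply/andP; split; lra.
Qed.

Lemma equi_lipschitz Omega f x : cellwise_seq f -> Omega x ->
  (forall i, lbd Omega (dq i f)) ->
  exists r C, [/\ 0 < r, 0 <= C & \forall n \near \oo, forall y z d,
    box x r y -> box x r z -> box y d z -> `|f n z - f n y| <= C * (d + mesh n)].
Proof.
move=> fc Ox df.
have [r [C [r0 C0 rC]]] : exists r C, [/\ 0 < r, 0 <= C & \forall n \near \oo,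
    forall i y, box x r y -> `|dq i f n y| <= C].
  have H (s : seq 'I_N) : exists r C, [/\ 0 < r, 0 <= C & \forall n \near \oo,
      forall i y, i \in s -> box x r y -> `|dq i f n y| <= C].
    elim: s => [|i s [r [C [r0 C0 rC]]]].
      by exists 1, 0; split=> //; near=> n => i y; rewrite in_nil.
    have [r' [C' [r'0 C'0 rC']]] := df i x Ox.
    exists (Num.min r r'), (C + C'); split; rewrite ?lt_min ?r0 ?addr_ge0 //.
    apply: filterS2 rC rC' => n rC rC' j y; rewrite inE => /orP[/eqP -> xy|js xy].
      by rewrite (le_trans (rC' y _)) ?lerDr //; apply: box_le xy; rewrite ge_min lexx orbT.
    by rewrite (le_trans (rC j y js _)) ?lerDl //; apply: box_le xy; rewrite ge_min lexx.
  have [r [C [r0 C0 rC]]] := H (enum 'I_N); exists r, C; split=> //.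
  by apply: filterS rC => n rC i y; apply: rC; rewrite mem_enum.
exists r, (N%:R * C); split; rewrite ?mulr_ge0 //.
apply: filterS rC => n rC y z d xy xz yz; rewrite -mulrA.
apply: (@axis_path _ _ (f n) x r _ d) => // w i t xw xwt td.
have aux v s : 0 <= s -> box x r v -> box x r (v + s *: ax i) ->
    `|f n (v + s *: ax i) - f n v| <= C * (s + mesh n).
  move=> s0 xv xvs; have := @lattice_mean_value f n v i s 0 C (fc n) s0.
  rewrite mulr0 subr0 normr0 mulr0 addr0 mulrC; apply=> e /andP[e0 es].
  rewrite subr0; apply: rC => j; have := xv j; have := xvs j; rewrite !shiftE.
  by case: eqP => _; rewrite ?mulr1 ?mulr0 ?addr0 // !ler_norml => /andP[? ?] /andP[? ?]; apply/andP; split; lra.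
have t_le : C * (`|t| + mesh n) <= C * (d + mesh n) by rewrite ler_wpM2l // lerD2r.
apply: le_trans t_le; have [t0|t0] := leP 0 t; first by rewrite (ger0_norm t0); exact: aux.
have wE : w = (w + t *: ax i) + (- t) *: ax i by rewrite scaleNr addrK.
rewrite distrC (ltr0_norm t0) {1}wE; apply: aux => //; first by lra.
by rewrite -wE.
Unshelve. all: by end_near. Qed.

Lemma ulim_continuous Omega f x : open Omega -> cellwise_seq f -> lbdk 1 Omega f ->
  Omega x -> {for x, continuous (ulim f)}.
Proof.
move=> Oo fc /lbdkSP[f0 f1] Ox; have FU : ProperFilter U := @ultra_proper _ _ UU.
have [r [C [r0 C0 fC]]] := equi_lipschitz fc Ox (fun i => lbdk_lbd (f1 i)).
have /nbhs_boxP[s s0 xs] : nbhs x Omega by exact: open_nbhs_nbhs.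
apply/continuous_boxP => e e0.
pose d := Num.min (Num.min r s) (e / (C + 1)).
have C1 : 0 < C + 1 by rewrite ltr_wpDl.
exists d; first by rewrite !lt_min r0 s0 divr_gt0.
move=> y xy.
have xyr : box x r y by apply: box_le xy; rewrite !ge_min lexx.
have Oy : Omega y by apply: xs; apply: box_le xy; rewrite !ge_min lexx orbT.
have L : `|f n y - f n x| @[n --> U] --> `|ulim f y - ulim f x|.
  by apply: cvg_norm; apply: cvgB; exact: (ulim_cvg f0).
have Rr : C * (d + mesh n) @[n --> U] --> C * (d + 0).
  by apply: cvgMr; apply: cvgD; [exact: cvg_cst|exact: cvg_mesh_ultra].
have : `|ulim f y - ulim f x| <= C * (d + 0).
  apply: (ler_cvg_to L Rr); apply: Uoo; apply: filterS fC => n; apply=> //.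
  exact: box_refl (ltW r0).
move=> /le_trans; apply; rewrite addr0.
apply: (@le_trans _ _ ((C + 1) * (e / (C + 1)))); last by rewrite mulrC divfK ?gt_eqF.
by apply: ler_pM; rewrite ?lerDl // ?ge_min ?lexx ?orbT // !le_min !ltW // divr_gt0.
Qed.

Lemma is_derive_quadratic (V : normedModType R) (F : V -> R) (x v : V) (L C d : R) : 0 < d ->
  (forall t, `|t| <= d -> `|F (x + t *: v) - F x - t * L| <= C * t ^+ 2) ->
  is_derive x v F L.
Proof.
move=> d0 FL.
suff cv : (h^-1 *: ((F \o shift x) (h *: v) - F x) @[h --> 0^'] --> L).
  by apply: DeriveDef; [exact: cvgP cv|exact: cvg_lim cv].
apply/cvgrPdist_le => e e0.
have C1 : 0 < `|C| + 1 by rewrite ltr_wpDl.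
near=> t.
have t0 : t != 0 by near: t; exact: nbhs_dnbhs_neq.
have td : `|t| <= Num.min d (e / (`|C| + 1)).
  near: t; apply: dnbhs0_le; by rewrite lt_min d0 divr_gt0.
move: td; rewrite le_min => /andP[td te].
have := FL t td; rewrite /= [t *: v + x]addrC => H.
have -> : L - t^-1 *: (F (x + t *: v) - F x) = - (t^-1 * (F (x + t *: v) - F x - t * L)).
  by rewrite /GRing.scale /=; field.
rewrite normrN normrM normfV ler_pdivrMl ?normr_gt0 // (le_trans H) //.
rewrite -(real_normK (num_real t)) expr2 mulrCA ler_wpM2l // mulrC.
apply: (@le_trans _ _ ((e / (`|C| + 1)) * (`|C| + 1))); last by rewrite divfK // gt_eqF.
rewrite (@le_trans _ _ (`|t| * `|C|)) ?ler_wpM2l ?ler_norm //.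
by apply: ler_pM => //; rewrite lerDl.
Unshelve. all: by end_near. Qed.

(** The expansion f(x + t) = f(x) + t f'(x) + O(t^2) holds on the lattice with uniform constants,
up to errors of the order of the mesh, and survives in the limit. *)
Lemma ulim_is_derive Omega f x i : open Omega -> cellwise_seq f -> lbdk 2 Omega f ->
  Omega x -> is_derive x (ax i) (ulim f) (ulim (dq i f) x).
Proof.
move=> Oo fc /lbdkSP[f0 f1] Ox; have FU : ProperFilter U := @ultra_proper _ _ UU.
have /lbdkSP[di0 di1] := f1 i.
have [r [C [r0 C0 fC]]] := equi_lipschitz (cellwise_dq i fc) Ox (fun j => lbdk_lbd (di1 j)).
have [r' [C' [r'0 C'0 fC']]] := di0 x Ox.
have /nbhs_boxP[s s0 xs] : nbhs x Omega by exact: open_nbhs_nbhs.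
apply: (@is_derive_quadratic _ _ _ _ _ C (Num.min r s)); first by rewrite lt_min r0.
move=> t; rewrite le_min => /andP[tr ts].
have bx a b : `|a| <= b -> box x b (x + a *: ax i).
  by move=> ab; rewrite -[b]add0r; apply: box_shift => //; exact: box_refl.
have Oy : Omega (x + t *: ax i) by apply: xs; exact: bx.
have L : `|f n (x + t *: ax i) - f n x - t * dq i f n x| @[n --> U] -->
    `|ulim f (x + t *: ax i) - ulim f x - t * ulim (dq i f) x|.
  apply: cvg_norm; apply: cvgB; first by apply: cvgB; exact: (ulim_cvg f0).
  by apply: cvgMr; exact: (ulim_cvg di0).
have Rr : (`|t| + mesh n) * (C * (`|t| + mesh n)) + mesh n * C' @[n --> U] -->
   (`|t| + 0) * (C * (`|t| + 0)) + 0 * C'.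
  have T : `|t| + mesh n @[n --> U] --> `|t| + 0.
    by apply: cvgD; [exact: cvg_cst|exact: cvg_mesh_ultra].
  apply: cvgD; last by apply: cvgMl; exact: cvg_mesh_ultra.
  by apply: cvgM => //; apply: cvgMr.
have -> : C * t ^+ 2 = (`|t| + 0) * (C * (`|t| + 0)) + 0 * C'.
  by rewrite -(real_normK (num_real t)); ring.
apply: (ler_cvg_to L Rr); apply: Uoo; apply: filterS2 fC fC' => n fC fC'.
have xx : box x r x by exact: box_refl (ltW r0).
have dx : mesh n * `|dq i f n x| <= mesh n * C'.
  by rewrite ler_wpM2l ?fC' ?(ltW (mesh_gt0 n)) //; exact: box_refl (ltW r'0).
have [t0|t0] := leP 0 t.
  have := @lattice_mean_value f n x i t (dq i f n x) (C * (t + mesh n)) (fc n) t0.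
  rewrite [`|t|]ger0_norm // => H; apply: le_trans (H _) _; last by rewrite lerD2l.
  move=> e /andP[e0 et]; apply: fC => //.
    by apply: bx; rewrite ger0_norm // (le_trans et) // -(ger0_norm t0).
  by apply: bx; rewrite ger0_norm.
have t0' : 0 <= - t by lra.
have := @lattice_mean_value f n (x + t *: ax i) i (- t) (dq i f n x) (C * (- t + mesh n)) (fc n) t0'.
rewrite scaleNr addrK => H; rewrite [`|t|]ltr0_norm //.
have -> : f n (x + t *: ax i) - f n x - t * dq i f n x =
   - (f n x - f n (x + t *: ax i) - - t * dq i f n x) by ring.
rewrite normrN; apply: le_trans (H _) _; last by rewrite lerD2l.
have tN : `|t| = - t by rewrite ltr0_norm.
move=> e /andP[e0 et]; rewrite -addrA -scalerDl.
apply: fC => //; apply: bx; rewrite ler_norml; apply/andP; split; lra.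
Qed.

End UltraLimit.

(** * Existence of a positive eigenfunction *)

Section Existence.
Context {R : realType} {N : nat}.
Implicit Types (x y z p q nu : 'rV[R]_N) (r C : R) (i j : 'I_N) (n k : nat)
  (u w V : 'rV[R]_N -> R) (Omega : set 'rV[R]_N).

(** The form in which convexity is used at the boundary. *)
Definition supported Omega : Prop := forall q, closure Omega q -> ~ Omega q ->
  exists nu, sqnorm nu = 1 /\ forall x, Omega x -> 0 < dot nu (x - q).

Lemma dot_box nu z d : sqnorm nu = 1 -> (forall i, `|z 0 i| <= d) -> `|dot nu z| <= N%:R * d.
Proof.
move=> nu1 zd; rewrite (le_trans (ler_norm_sum _ _ _)) //.
have -> : N%:R * d = \sum_(i < N) d by rewrite sumr_const card_ord mulr_natl.
apply: ler_sum => i _; rewrite normrM -[leRHS]mul1r ler_pM //.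
by apply: normr_coord_sqnorm; rewrite // nu1 expr1n.
Qed.

Lemma closure_box Omega c r : 0 <= r -> Omega `<=` box c r -> closure Omega `<=` box c r.
Proof.
move=> r0 Ob x Ox i; apply/ler_addgt0Pr => e e0.
have [|y [/Ob yc xy]] := Ox (box x e); first by apply/nbhs_boxP; exists e.
have := yc i; have := box_sym xy i => h1 h2.
by rewrite -(subrK (y 0 i) (x 0 i)) -addrA (le_trans (ler_normD _ _)) // [r + e]addrC lerD.
Qed.

Lemma eq_class_C k Omega u w : open Omega -> (forall x, Omega x -> u x = w x) ->
  class_C k Omega u -> class_C k Omega w.
Proof.
move=> Oo; have cont u1 w1 : (forall x, Omega x -> u1 x = w1 x) ->
    (forall x, Omega x -> {for x, continuous u1}) -> forall x, Omega x -> {for x, continuous w1}.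
  move=> uw uc x Ox; apply/continuous_boxP => e e0.
  have /continuous_boxP/(_ e e0)[d d0 ud] := uc x Ox.
  have /nbhs_boxP[s s0 xs] : nbhs x Omega by exact: open_nbhs_nbhs.
  exists (Num.min d s); first by rewrite lt_min d0.
  move=> y xy; rewrite -!uw //; first by apply: ud; apply: box_le xy; rewrite ge_min lexx.
  by apply: xs; apply: box_le xy; rewrite ge_min lexx orbT.
elim: k u w => [|k IH] u w uw; first exact: cont.
have near x : Omega x -> \forall y \near x, u y = w y.
  by move=> Ox; apply: filterS (open_nbhs_nbhs (conj Oo Ox)) => y; exact: uw.
move=> [uc ud uk]; split; first exact: cont uc.
  by move=> i x Ox; apply: near_eq_derivable (ud i x Ox); exact: near.
move=> i; apply: IH (uk i) => x Ox; apply: near_eq_derive; exact: near.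
Qed.

Lemma class_C_ulim (U : set_system nat) (UU : UltraFilter U)
    (Uoo : forall A : set nat, (\forall n \near \oo, A n) -> U A) k Omega f :
  open Omega -> cellwise_seq f -> lbdk k.+1 Omega f -> class_C k Omega (ulim U f).
Proof.
move=> Oo; elim: k f => [|k IH] f fc F.
  by move=> x Ox; apply: (ulim_continuous UU Uoo Oo fc F).
have F1 : lbdk 1 Omega f.
  by have /lbdkSP[F0 dF] := F; apply/lbdkSP; split=> // i; split=> //; exact: lbdk_lbd (dF i).
have F2 : lbdk 2 Omega f.
  have /lbdkSP[F0 dF] := F; apply/lbdkSP; split=> // i.
  have /lbdkSP[d0 dd] := dF i; apply/lbdkSP; split=> // j; split=> //; exact: lbdk_lbd (dd j).
have D x i : Omega x -> is_derive x (ax i) (ulim U f) (ulim U (dq i f) x).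
  by move=> Ox; exact: (ulim_is_derive UU Uoo i Oo fc F2 Ox).
split.
- by move=> x Ox; apply: (ulim_continuous UU Uoo Oo fc F1).
- by move=> i x Ox; exact: (@ex_derive _ _ _ _ _ _ _ (D x i Ox)).
- move=> i; apply: (@eq_class_C k Omega (ulim U (dq i f))) => //.
    by move=> x Ox; rewrite /partial (@derive_val _ _ _ _ _ _ _ (D x i Ox)).
  apply: IH; first exact: cellwise_dq.
  by have /lbdkSP[] := F.
Qed.

(** Omega lies in a slab, on which (t + h) (b + 1 - t), with t the distance to the supporting
hyperplane, is a barrier; the shifts by the mesh h keep it nonnegative at the neighbours outside
Omega. *)
Lemma lattice_slab h Omega (v : 'rV[R]_N -> R) (F b : R) nu q :
  0 < h -> h <= 1 -> 0 <= F -> sqnorm nu = 1 ->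
  (forall x, Omega x -> 0 < dot nu (x - q) <= b) ->
  (forall x, v x <= 1) -> (forall x, ~ Omega (gridp h x) -> v x = 0) ->
  (forall x, Omega x -> gridp h x = x -> - (h ^+ 2 * F) <= dlap h v x) ->
  forall x, Omega x -> gridp h x = x ->
    v x <= (F + 1) * (b + 1) * (dot nu (x - q) + h).
Proof.
move=> h0 h1 F0 nu1 nub v1 vO vF x Ox xg.
pose t y := dot nu y - dot nu q.
have tE y : dot nu (y - q) = t y by rewrite dotBr.
pose B y := (F + 1) * ((dot nu y + (h - dot nu q)) * (b + 1 + dot nu q - dot nu y)).
have BE y : B y = (F + 1) * ((t y + h) * (b + 1 - t y)) by rewrite /B /t; ring.
have dB y : dlap h B y = - (2 * (F + 1) * h ^+ 2).
  by rewrite dlapZ dlap_quadratic nu1; ring.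
have tnbr y z : lattice_nbr h y z -> t y - h <= t z <= t y + h.
  move=> [i yz]; have ni : `|nu 0 i| <= 1 by apply: normr_coord_sqnorm; rewrite // nu1 expr1n.
  have hn : `|h * nu 0 i| <= h by rewrite normrM gtr0_norm // ler_piMr // ltW.
  move: hn; rewrite ler_norml /t => /andP[n1 n2].
  by case: yz => ->; rewrite ?dotBr ?dotDr dotZr dot_ax; apply/andP; split; lra.
pose A y := Omega y /\ gridp h y = y.
have wA : forall y, A y -> v y - B y <= 0.
  apply: (@discrete_max_principle _ _ h A (fun y => v y - B y) 1 (h ^+ 2)).
  - by rewrite exprn_gt0.
  - move=> y [Oy _]; rewrite lerBlDr (le_trans (v1 y)) // lerDl BE.
    by have /andP[] := nub y Oy; rewrite tE => t1 t2; rewrite !mulr_ge0 //; lra.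
  - move=> y [Oy yg] _; rewrite dlapB dB; have := vF y Oy yg.
    have := sqr_ge0 h; have := mulr_ge0 (sqr_ge0 h) F0; lra.
  - move=> y z [Oy yg] _ yz nA.
    have zg : gridp h z = z by case: yz => i [] ->; rewrite ?gridp_shift1 ?gridp_shiftN1 ?yg.
    have nO : ~ Omega (gridp h z) by rewrite zg => Oz; apply: nA.
    rewrite (vO z nO) sub0r oppr_le0 BE.
    have /andP[] := nub y Oy; rewrite tE => t1 t2; have /andP[t3 t4] := tnbr _ _ yz.
    by rewrite !mulr_ge0 //; lra.
have := wA x (conj Ox xg); rewrite subr_le0 BE => /le_trans; apply.
have /andP[] := nub x Ox; rewrite tE => t1 t2.
rewrite -mulrA; apply: ler_wpM2l; first by lra.
by rewrite mulrC; apply: ler_wpM2r; lra.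
Qed.

(** The lattice ground states, normalised to have maximum 1, satisfy uniform interior estimates
and a linear bound near the boundary. The limit solves the equation, is continuous up to the
boundary, and is not zero because the points where the maximum is attained cannot approach the
boundary. *)
Theorem exists_ground_state Omega V p r (v1 v2 : R) : (0 < N)%N -> open Omega ->
  Omega `<=` box 0 1 -> supported Omega -> 0 < r ->
  (forall x, sqnorm (x - p) < r ^+ 2 -> Omega x) ->
  0 < v1 -> (forall x, Omega x -> v1 <= V x <= v2) ->
  (forall x, Omega x -> {for x, continuous V}) ->
  lbdk 2 Omega (fun n x => V (gridp (mesh n) x)) ->
  exists u (mu : R),
    [/\ continuous u, forall x, ~ Omega x -> u x = 0, class_C 2 Omega u,
        (forall x, Omega x -> 0 <= u x) /\ (exists x, Omega x /\ 0 < u x) &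
        (forall x, Omega x -> \sum_(i < N) partial i (partial i u) x = - (mu * V x * u x)) /\
        0 <= mu <= (4 * N%:R ^+ 2 + 8 * N%:R) / (r ^+ 2 * v1)].
Proof.
move=> N0 Oo Ob Os r0 pO v10 vV Vc Vl.
set C := (4 * N%:R ^+ 2 + 8 * N%:R) / (r ^+ 2 * v1).
have C0 : 0 <= C.
  by rewrite divr_ge0 ?addr_ge0 ?mulr_ge0 ?sqr_ge0 // ltW.
have v20 : 0 <= v2.
  have Op : Omega p by apply: pO; rewrite subrr sqnorm0 exprn_gt0.
  by have /andP[h1 h2] := vV _ Op; rewrite (le_trans (ltW v10)) // (le_trans h1).
have [U [UU Uoo']] := ultraFilterLemma (@eventually_filter).
have Uoo (A : set nat) : (\forall n \near \oo, A n) -> U A by exact: Uoo'.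
have FU : ProperFilter U := @ultra_proper _ _ UU.
have US (A B : set nat) : A `<=` B -> U A -> U B by exact: filterS.
have UI (A B : set nat) : U A -> U B -> U (A `&` B) by exact: filterI.
have UT : U setT by exact: filterT.
pose good n (v : 'rV[R]_N -> R) (mu : R) :=
  [/\ forall x, 0 <= v x <= 1, forall x, ~ Omega (gridp (mesh n) x) -> v x = 0,
      exists x, [/\ Omega x, gridp (mesh n) x = x & v x = 1] &
      forall x, Omega (gridp (mesh n) x) ->
        - dlap (mesh n) v x = mu * mesh n ^+ 2 * V (gridp (mesh n) x) * v x].
(* the zero function stands in for the finitely many meshes too coarse to see the ball *)
have ex n : exists vm : ('rV[R]_N -> R) * R,
    [/\ cellwise (mesh n) vm.1, 0 <= vm.2 <= C &
        mesh n <= r / (3 * N%:R) -> good n vm.1 vm.2].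
  have [hr|hr] := leP (mesh n) (r / (3 * N%:R)); last first.
    by exists (fun=> 0, 0); split=> //=; rewrite ?lexx.
  have v1V x : Omega x -> v1 <= V x by move=> /vV/andP[].
  have [v [mu [vc v01 vmax veq mub]]] := lattice_ground_state N0 (ltn0Sn n) Ob r0 hr pO v10 v1V.
  exists (v, mu); split=> // _; split=> // x; have [] := v01 x => //.
have [vm vmP] := choice ex.
pose v n := (vm n).1; pose mu n := (vm n).2.
have vc : cellwise_seq v by move=> n; have [] := vmP n.
have muC n : 0 <= mu n <= C by have [] := vmP n.
have vgood : \forall n \near \oo, good n (v n) (mu n).
  have H := @near_mesh R (r / (3 * N%:R)).
  have h3 : 0 < r / (3 * N%:R) by rewrite divr_gt0 // mulr_gt0 // ltr0n.
  near=> n; have [_ _] := vmP n; apply; near: n; exact: H.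
have vlbd : lbd Omega v.
  move=> x Ox; exists 1, 1; split=> //; apply: filterS vgood => n [v01 _ _ _] y _.
  by have /andP[h1 h2] := v01 y; rewrite ger0_norm.
have Onbr x : Omega x -> exists2 s, 0 < s & forall y, box x s y -> Omega y.
  move=> Ox; have /nbhs_boxP[s s0 xs] : nbhs x Omega by exact: open_nbhs_nbhs.
  by exists s.
have vlap x : Omega x -> exists2 s, 0 < s & \forall n \near \oo, forall y, box x s y ->
    fmul (fmul (fun n _ => - mu n) (fun n x => V (gridp (mesh n) x))) v n y = lapn v n y.
  move=> Ox; have [s s0 xs] := Onbr x Ox; exists (s / 2); rewrite ?divr_gt0 //.
  have hs := near_mesh (divr_gt0 s0 (ltr0n R 2)).
  apply: filterS2 vgood hs => n [_ _ _ veq] hs y xy.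
  have Oy : Omega (gridp (mesh n) y).
    apply: xs; rewrite [s]splitr; apply: (box_trans xy).
    by apply: (box_le hs); exact: gridp_box (mesh_gt0 n).
  have := veq y Oy => /eqP; rewrite eqr_oppLR => /eqP E.
  by rewrite /lapn E /fmul; field; rewrite gt_eqF // mesh_gt0.
have cst_mu k : lbdk k Omega (fun n _ => - mu n).
  apply: (@lbdk_cst _ _ _ _ _ C) => n; have /andP[m0 mC] := muC n.
  by rewrite normrN ger0_norm.
(* the equation expresses the Laplacian of v by v itself, so that regularity climbs one difference
at a time *)
have lapk k : (k <= 2)%N -> lbdk k Omega v -> lbdk k Omega (lapn v).
  move=> k2 vk; apply: (lbdk_near vlap); apply: lbdkM => //; apply: lbdkM => //.
  by case: k k2 vk => [|[|[|//]]] _ _; [exact: lbdkS (lbdkS Vl)|exact: lbdkS Vl|exact: Vl].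
have V0 : lbdk 0 Omega v by [].
have V1 : lbdk 1 Omega v by apply: lbdk_elliptic => //; exact: lapk.
have V2 : lbdk 2 Omega v by apply: lbdk_elliptic => //; exact: lapk.
have V3 : lbdk 3 Omega v by apply: lbdk_elliptic => //; exact: lapk.
pose u0 := ulim U v.
pose u x := if `[<Omega x>] then u0 x else 0.
have uE x : Omega x -> u0 x = u x by move=> Ox; rewrite /u asboolT.
have uN x : ~ Omega x -> u x = 0 by move=> Ox; rewrite /u asboolF.
have cu0 : class_C 2 Omega u0 by exact: class_C_ulim.
have cu : class_C 2 Omega u by exact: eq_class_C Oo uE cu0.
have u_cvg x : Omega x -> v n x @[n --> U] --> u x.
  by move=> Ox; rewrite -uE //; exact: ulim_cvg vlbd Ox.
have u_ge0 x : Omega x -> 0 <= u x.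
  move=> Ox; apply: (ler_cvg_to (cvg_cst 0) (u_cvg x Ox)); apply: Uoo.
  by apply: filterS vgood => n [v01 _ _ _]; have /andP[] := v01 x.
pose F := C * v2; pose b : R := N%:R * 2.
have F0 : 0 <= F by rewrite mulr_ge0.
have b0 : 0 <= b by rewrite mulr_ge0.
pose K := (F + 1) * (b + 1).
have K0 : 0 < K by rewrite mulr_gt0 // ltr_wpDl.
have cb : closure Omega `<=` box 0 1 by exact: closure_box.
(* the linear bound at the boundary, uniform over the supporting hyperplanes *)
have slab : \forall n \near \oo, forall nu q, sqnorm nu = 1 -> closure Omega q ->
    (forall x, Omega x -> 0 < dot nu (x - q)) ->
    forall x, Omega x -> gridp (mesh n) x = x -> v n x <= K * (dot nu (x - q) + mesh n).
  have h1 := @near_mesh R 1 ltr01.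
  apply: filterS2 vgood h1 => n [v01 vO _ veq] h1 nu q nu1 qO nuO x Ox xg.
  apply: (@lattice_slab (mesh n) Omega (v n) F b nu q (mesh_gt0 n) h1 F0 nu1) => //.
  - move=> y Oy; rewrite nuO //= (le_trans (ler_norm _)) // dot_box // => i; rewrite !mxE.
    have := Ob _ Oy i; have := cb _ qO i; rewrite !mxE !subr0 => a1 a2.
    by rewrite (le_trans (ler_normB _ _)) // addrC (_ : 2 = 1 + 1) // lerD.
  - by move=> y; have /andP[] := v01 y.
  - move=> y Oy yg; have Oy' : Omega (gridp (mesh n) y) by rewrite yg.
    rewrite lerNl veq // yg (_ : mu n * _ * _ * _ = mesh n ^+ 2 * (mu n * V y * v n y)); last by ring.
    rewrite ler_wpM2l ?sqr_ge0 //.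
    have /andP[m0 mC] := muC n; have /andP[a1 a2] := vV y Oy; have /andP[a3 a4] := v01 y.
    rewrite -[leRHS]mulr1; apply: ler_pM => //; first by rewrite mulr_ge0 // (le_trans (ltW v10)).
    by apply: ler_pM => //; rewrite (le_trans (ltW v10)).
have u_slab nu q x : sqnorm nu = 1 -> closure Omega q ->
    (forall x, Omega x -> 0 < dot nu (x - q)) -> Omega x -> u x <= K * dot nu (x - q).
  move=> nu1 qO nuO Ox; have [s s0 xs] := Onbr x Ox.
  have Rr : K * (dot nu (x - q) + (N%:R + 1) * mesh n) @[n --> U] -->
      K * (dot nu (x - q) + (N%:R + 1) * 0).
    apply: cvgMr; apply: cvgD; first exact: cvg_cst.
    by apply: cvgMr; exact: cvg_mesh_ultra.
  rewrite -[dot nu _]addr0 -[X in _ + X](mulr0 (N%:R + 1)).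
  apply: (ler_cvg_to (u_cvg x Ox) Rr); apply: Uoo.
  have hs := near_mesh s0.
  apply: filterS2 slab hs => n slab hs.
  have gb := gridp_box x (mesh_gt0 n).
  have Og : Omega (gridp (mesh n) x) by apply: xs; exact: box_le gb.
  rewrite -vc (le_trans (slab nu q nu1 qO nuO _ Og (gridp_idem _ (mesh_gt0 n)))) //.
  rewrite ler_wpM2l ?(ltW K0) // mulrDl mul1r addrA lerD2r -lerBlDl -dotBr.
  rewrite (le_trans (ler_norm _)) // dot_box // => i.
  by have := gb i; rewrite !mxE; congr (`|_| <= _); ring.
have u_cont : continuous u.
  move=> x; have [Ox|nOx] := pselect (Omega x); first by have [cu1 _ _] := cu; exact: cu1.
  apply/continuous_boxP => e e0.
  have [cOx|ncOx] := pselect (closure Omega x); last first.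
    have /nbhs_boxP[s s0 xs] : nbhs x (~` closure Omega).
      by apply: open_nbhs_nbhs; split=> //; rewrite openC; exact: closed_closure.
    exists s => // y /xs ny; rewrite (uN x) // (uN y) ?subrr ?normr0 ?ltW // => Oy.
    by apply: ny; exact: subset_closure.
  have [nu [nu1 nuO]] := Os x cOx nOx.
  have KN : 0 < K * N%:R by rewrite mulr_gt0 // ltr0n.
  exists (e / (K * N%:R)); first by rewrite divr_gt0.
  move=> y xy; rewrite (uN x) // subr0.
  have [Oy|nOy] := pselect (Omega y); last by rewrite uN // normr0 ltW.
  rewrite ger0_norm ?u_ge0 // (le_trans (u_slab nu x y nu1 cOx nuO Oy)) //.
  apply: (@le_trans _ _ (K * (N%:R * (e / (K * N%:R))))); last first.
    rewrite (_ : K * _ = e) //; field; rewrite (gt_eqF K0) andbT.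
    by rewrite gt_eqF // ltr0n.
  rewrite ler_wpM2l ?(ltW K0) // (le_trans (ler_norm _)) // dot_box // => i.
  by have := xy i; rewrite !mxE.
(* maximum points of the lattice solutions accumulate at an interior point *)
have exX n : exists x, good n (v n) (mu n) -> [/\ Omega x, gridp (mesh n) x = x & v n x = 1].
  have [g|ng] := pselect (good n (v n) (mu n)); last by exists 0.
  by have [_ _ [x xP] _] := g; exists x.
have [X XP] := choice exX.
have XO : \forall n \near \oo, [/\ Omega (X n), gridp (mesh n) (X n) = X n & v n (X n) = 1].
  by apply: filterS vgood => n; exact: XP.
have exl i : exists l : R, X n 0 i @[n --> U] --> l.
  apply: (ultra_bounded_cvg UU Uoo (C := 1)); apply: filterS XO => n [Ox _ _].
  by have := Ob _ Ox i; rewrite mxE subr0.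
have [l lP] := choice exl.
pose xs : 'rV[R]_N := \row_i l i.
have Xxs e : 0 < e -> U [set n | box xs e (X n)].
  move=> e0; have := @filter_forall _ _ (fun i => [set n | `|X n 0 i - xs 0 i| <= e]) U _.
  apply=> i; have /cvgrPdist_le/(_ e e0) := lP i; apply: filterS => n /=.
  by rewrite mxE distrC.
have cxs : closure Omega xs.
  move=> B /nbhs_boxP[e e0 eB].
  have [n [[On _ _] xn]] := filter_ex (UI _ _ (Uoo _ XO) (Xxs e e0)).
  by exists (X n); split=> //; exact: eB.
have Oxs : Omega xs.
  apply: contrapT => nO; have [nu [nu1 nuO]] := Os xs cxs nO.
  pose e := (4 * K * N%:R)^-1.
  have e0 : 0 < e by rewrite invr_gt0 mulr_gt0 ?ltr0n // mulr_gt0.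
  pose d := (4 * K)^-1.
  have d0 : 0 < d by rewrite invr_gt0 mulr_gt0.
  have [n [[[On gn vn] xn] [sl hn]]] :=
    filter_ex (UI _ _ (UI _ _ (Uoo _ XO) (Xxs e e0)) (UI _ _ (Uoo _ slab) (Uoo _ (near_mesh d0)))).
  have := sl nu xs nu1 cxs nuO _ On gn; rewrite vn.
  have : dot nu (X n - xs) <= N%:R * e.
    rewrite (le_trans (ler_norm _)) // dot_box // => i.
    by have := xn i; rewrite !mxE.
  have -> : N%:R * e = d by rewrite /e /d; field; rewrite !gt_eqF ?ltr0n.
  move=> h1 h2; have h3 : K * (dot nu (X n - xs) + mesh n) <= K * (d + d).
    by rewrite ler_wpM2l ?(ltW K0) // lerD.
  have : K * (d + d) = 1 / 2 by rewrite /d; field; rewrite gt_eqF.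
  by move: h2 h3; clear; lra.
have u_pos : 1 / 2 <= u xs.
  have /lbdkSP[_ dv] := V1.
  have [r1 [C1 [r10 C10 fC]]] := equi_lipschitz vc Oxs (fun i => lbdk_lbd (dv i)).
  pose e := Num.min r1 (4 * (C1 + 1))^-1.
  have d0 : 0 < (4 * (C1 + 1))^-1 by rewrite invr_gt0 mulr_gt0 // ltr_wpDl.
  have e0 : 0 < e by rewrite lt_min r10.
  suff H : U [set n | 1 / 2 <= v n xs].
    by apply: (ler_cvg_to (cvg_cst (1 / 2 : R)) (u_cvg xs Oxs)).
  have F1 := UI _ _ (UI _ _ (Uoo _ XO) (Xxs e e0)) (UI _ _ (Uoo _ fC) (Uoo _ (near_mesh d0))).
  apply: (US _ _ _ F1); move=> n [[[On gn vn] xn] [fC' hn]].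
  have xr : box xs r1 (X n) by apply: box_le xn; rewrite ge_min lexx.
  have := fC' xs (X n) e (box_refl _ (ltW r10)) xr xn; rewrite vn ler_norml => /andP[_].
  have h1 : C1 * (e + mesh n) <= (C1 + 1) * ((4 * (C1 + 1))^-1 + (4 * (C1 + 1))^-1).
    apply: ler_pM => //; first by rewrite addr_ge0 // ltW // mesh_gt0.
      by rewrite lerDl.
    by rewrite lerD // /e ge_min lexx orbT.
  have : (C1 + 1) * ((4 * (C1 + 1))^-1 + (4 * (C1 + 1))^-1) = 1 / 2.
    by field; rewrite gt_eqF // ltr_wpDl.
  by move: h1; clear; rewrite /=; lra.
have [m mlim] : exists m : R, mu n @[n --> U] --> m.
  apply: (ultra_bounded_cvg UU Uoo (C := C)); near=> n.
  by have /andP[m0 mC] := muC n; rewrite ger0_norm.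
exists u, m; split=> //.
  by split=> //; exists xs; split=> //; rewrite (lt_le_trans _ u_pos) // divr_gt0.
split; last first.
  apply/andP; split.
    by apply: (ler_cvg_to (cvg_cst (0 : R)) mlim); apply: (US _ _ _ UT) => n _; have /andP[] := muC n.
  by apply: (ler_cvg_to mlim (cvg_cst C)); apply: (US _ _ _ UT) => n _; have /andP[] := muC n.
move=> x Ox.
have D i : is_derive x (ax i) u0 (ulim U (dq i v) x).
  exact: (ulim_is_derive UU Uoo i Oo vc V2 Ox).
have nearO : \forall y \near x, Omega y by exact: open_nbhs_nbhs.
have DD i : partial i (partial i u) x = ulim U (dq i (dq i v)) x.
  have E y : Omega y -> partial i u y = ulim U (dq i v) y.
    move=> Oy; have D1 : is_derive y (ax i) u0 (ulim U (dq i v) y).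
      exact: (ulim_is_derive UU Uoo i Oo vc V2 Oy).
    have D2 : is_derive y (ax i) u (ulim U (dq i v) y).
      apply: near_eq_is_derive D1; apply: filterS (open_nbhs_nbhs (conj Oo Oy)) => z; exact: uE.
    by rewrite /partial (@derive_val _ _ _ _ _ _ _ D2).
  have D1 : is_derive x (ax i) (ulim U (dq i v)) (ulim U (dq i (dq i v)) x).
    by apply: (ulim_is_derive UU Uoo i Oo (cellwise_dq i vc) _ Ox); have /lbdkSP[_] := V3.
  have D2 : is_derive x (ax i) (partial i u) (ulim U (dq i (dq i v)) x).
    by apply: near_eq_is_derive D1; apply: filterS nearO => z Oz; rewrite E.
  by rewrite /partial (@derive_val _ _ _ _ _ _ _ D2).
(* the second differences in the Laplacian are based one mesh before x, which equicontinuity makes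
negligible *)
have lim1 : lapn v n x @[n --> U] --> \sum_(i < N) partial i (partial i u) x.
  under eq_fun do rewrite lapn_dq.
  apply: cvg_sumr => i _; rewrite DD.
  have /lbdkSP[_ /(_ i)/lbdkSP[_ /(_ i)/lbdkSP[ddi0 ddi1]]] := V3.
  have [r1 [C1 [r10 C10 fC]]] := equi_lipschitz (cellwise_dq i (cellwise_dq i vc)) Ox (fun j => lbdk_lbd (ddi1 j)).
  have L0 : dq i (dq i v) n x @[n --> U] --> ulim U (dq i (dq i v)) x by exact: ulim_cvg ddi0 Ox.
  rewrite -[X in _ --> X](subr0) -[X in _ --> X]/(_ - 0).
  have L1 : (dq i (dq i v) n x - dq i (dq i v) n (x - mesh n *: ax i)) @[n --> U] --> (0 : R).
    apply/cvgrPdist_le => e e0.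
    have d0 : 0 < Num.min r1 (e / (2 * (C1 + 1))).
      by rewrite lt_min r10 divr_gt0 // mulr_gt0 // ltr_wpDl.
    have F1 := UI _ _ (Uoo _ fC) (Uoo _ (near_mesh d0)).
    apply: (US _ _ _ F1); move=> n [fC']; rewrite /= le_min => /andP[hr he].
    have bx : box x (mesh n) (x - mesh n *: ax i).
      rewrite -[- (mesh n *: _)]scaleNr -[X in box _ X]add0r; apply: box_shift; first exact: box_refl.
      by rewrite normrN ger0_norm // ltW // mesh_gt0.
    have := fC' x _ _ (box_refl _ (ltW r10)) (box_le hr bx) bx.
    rewrite sub0r normrN [X in X <= _ -> _]distrC => /le_trans; apply.
    apply: (@le_trans _ _ ((C1 + 1) * (2 * (e / (2 * (C1 + 1)))))); last first.
      by rewrite [X in X <= _](_ : _ = e) //; field; rewrite gt_eqF // ltr_wpDl.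
    rewrite [X in _ <= _ * X]mulr_natl mulr2n; apply: ler_pM; rewrite ?lerDl ?lerD //.
    by rewrite addr_ge0 // ltW // mesh_gt0.
  rewrite (_ : (fun n => dq i (dq i v) n (x - mesh n *: ax i)) = (fun n =>
      dq i (dq i v) n x - (dq i (dq i v) n x - dq i (dq i v) n (x - mesh n *: ax i)))).
    by apply: cvgB.
  by apply/funext => n; ring.
have lim2 : lapn v n x @[n --> U] --> - (m * V x * u x).
  have L1 : V (gridp (mesh n) x) @[n --> U] --> V x.
    apply/cvgrPdist_le => e e0; have /continuous_boxP/(_ e e0)[d d0 Vd] := Vc x Ox.
    have F1 := Uoo _ (near_mesh d0); apply: (US _ _ _ F1); move=> n /= hn.
    rewrite distrC; apply: Vd; apply: (box_le hn); exact: gridp_box (mesh_gt0 n).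
  have L2 : - (mu n * V (gridp (mesh n) x) * v n x) @[n --> U] --> - (m * V x * u x).
    by apply: cvgN; apply: cvgM; [apply: cvgM|exact: u_cvg].
  apply: cvg_trans L2; have [s s0 sP] := vlap x Ox.
  suff H : U [set n | - (mu n * V (gridp (mesh n) x) * v n x) = lapn v n x] by apply: near_eq_cvg.
  apply: (US _ _ _ (Uoo _ sP)); move=> n /= <-; last exact: box_refl (ltW s0).
  by rewrite /fmul; ring.
by rewrite -(cvg_lim (@norm_hausdorff _ _) lim1) (cvg_lim (@norm_hausdorff _ _) lim2).
Unshelve. all: by end_near. Qed.

End Existence.

(** * Second derivatives along lines *)

Section SecondDerivative.
Context {R : realType}.
Implicit Types (g h : R -> R) (a b t : R).

(** A relation, so that sums, reflections and comparisons can be treated without computing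
derivatives as total functions. *)
Definition d2 g a : Prop := exists g1,
  (\forall t \near (0 : R), is_derive (t : R) (1 : R) g (g1 t)) /\ is_derive (0 : R) (1 : R) g1 a.

Lemma is_derive_val (V : normedModType R) (x v : V) (f : V -> R) a b :
  a = b -> is_derive x v f a -> is_derive x v f b.
Proof. by move=> ->. Qed.

Lemma d2D g h a b : d2 g a -> d2 h b -> d2 (fun t => g t + h t) (a + b).
Proof.
move=> [g1 [dg dg1]] [h1 [dh dh1]]; exists (fun t => g1 t + h1 t); split.
  by apply: filterS2 dg dh => t dg dh; exact: is_deriveD.
exact: is_deriveD.
Qed.

Lemma d2Z g k a : d2 g a -> d2 (fun t => k * g t) (k * a).
Proof.
move=> [g1 [dg dg1]]; exists (fun t => k * g1 t); split.
  by apply: filterS dg => t dg; exact: is_deriveZ.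
exact: is_deriveZ.
Qed.

Lemma is_derive_opp g t a : is_derive (- t) 1 g a -> is_derive t 1 (fun s => g (- s)) (- a).
Proof.
move=> dg; apply: (@is_derive_val _ _ _ _ (a * -1)); first by rewrite mulrN1.
Qed.

Lemma d2N g a : d2 g a -> d2 (fun t => g (- t)) a.
Proof.
move=> [g1 [dg dg1]]; exists (fun t => - g1 (- t)); split.
  have : \forall t \near (0 : R), is_derive (- t : R) (1 : R) g (g1 (- t)).
    have c0 : (- t : R) @[t --> (0 : R)] --> (0 : R) by rewrite -[X in _ --> X]oppr0; apply: cvgN.
    by have := c0 _ dg.
  move=> dg'; apply: filterS dg' => t; exact: is_derive_opp.
rewrite -[a]opprK; apply: is_deriveN.
by apply: is_derive_opp; rewrite oppr0.
Qed.

Lemma is_derive_quad a b (k t : R) : is_derive t 1 (fun t => a + b * t + k * t ^+ 2) (b + 2 * k * t).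
Proof.
have h1 : is_derive t 1 (fun s : R => s) 1 by exact: is_derive_id.
have h2 : is_derive t 1 (fun s : R => s ^+ 2) (2 * t).
  by have := is_deriveX 2 h1; apply: is_derive_val; rewrite /= expr1 /GRing.scale /= mulr1.
have h3 : is_derive t 1 (fun s => b * s) (b * 1) by exact: is_deriveZ.
have h4 : is_derive t 1 (fun s => k * s ^+ 2) (k * (2 * t)) by exact: is_deriveZ.
have h5 : is_derive t 1 (fun s => a + b * s) (0 + b * 1) by apply: is_deriveD.
have h6 := is_deriveD h5 h4; move: h6; apply: is_derive_val; ring.
Qed.

Lemma d2_quad a b k : d2 (fun t => a + b * t + k * t ^+ 2) (2 * k).
Proof.
exists (fun t => b + 2 * k * t + 0 * t ^+ 2); split.
  by near=> t; rewrite mul0r addr0; exact: is_derive_quad.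
by have := is_derive_quad b (2 * k) 0 0; apply: is_derive_val; ring.
Unshelve. all: by end_near. Qed.

Lemma is_derive_invX (q : R -> R) n t b : q t != 0 -> is_derive t 1 q b ->
  is_derive t 1 (fun s => (q s)^-1 ^+ n) (- (n%:R * b * (q t)^-1 ^+ n.+1)).
Proof.
move=> q0 dq; have h1 := is_deriveV q0 dq.
have -> : (fun s => (q s)^-1 ^+ n) = (fun s => (q s)^-1) ^+ n.
  by apply/funext => s; rewrite exprfctE.
have := is_deriveX n h1; apply: is_derive_val; rewrite /GRing.scale /=.
case: n => [|n]; first by rewrite !mul0r oppr0.
by rewrite /= -exprVn !exprS; ring.
Qed.

(** The function is |y - c|^(-2n) restricted to a line, with s0 the squared distance at time 0. *)
Lemma d2_radial s0 b n : 0 < s0 ->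
  d2 (fun t => (s0 + b * t + 1 * t ^+ 2)^-1 ^+ n)
     (n%:R * n.+1%:R * b ^+ 2 * s0^-1 ^+ n.+2 - 2 * n%:R * s0^-1 ^+ n.+1).
Proof.
move=> s00; pose q t := s0 + b * t + 1 * t ^+ 2.
have dq t : is_derive t 1 q (b + 2 * 1 * t) by exact: is_derive_quad.
have q0E : q 0 = s0 by rewrite /q mulr0 expr0n mulr0 !addr0.
have q0 : \forall t \near (0 : R), q t != 0.
  have c : q t @[t --> (0 : R)] --> q 0.
    by apply: differentiable_continuous; apply/derivable1_diffP; exact: (@ex_derive _ _ _ _ _ _ _ (dq 0)).
  rewrite q0E in c; near=> t; rewrite gt_eqF //; near: t; exact: (cvgr_gt _ c _ s00).
exists (fun t => (- 1 * n%:R) * ((b + 2 * 1 * t + 0 * t ^+ 2) * (q t)^-1 ^+ n.+1)); split.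
  apply: filterS q0 => t qt; have := is_derive_invX n qt (dq t).
  by apply: is_derive_val; ring.
have h1 : is_derive (0 : R) 1 (fun t => b + 2 * 1 * t + 0 * t ^+ 2) 2.
  by have := is_derive_quad b (2 * 1) 0 0; apply: is_derive_val; ring.
have q00 : q 0 != 0 by rewrite q0E gt_eqF.
have h2 := is_derive_invX n.+1 q00 (dq 0).
have h3 := is_deriveM h1 h2.
have h4 := is_deriveZ (-1 * n%:R) h3; move: h4; apply: is_derive_val.
rewrite /GRing.scale /= q0E -!natr1 !exprS; ring.
Unshelve. all: by end_near. Qed.

(** Otherwise the first derivative, which vanishes at 0, is positive just after. *)
Lemma d2_max g a : d2 g a -> (\forall t \near (0 : R), g t <= g 0) -> a <= 0.
Proof.
move=> [g1 [dg dg1]] gmax; rewrite leNgt; apply/negP => a0.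
have /nbhs_ballP[e /= e0 eP] : \forall t \near (0 : R), is_derive (t : R) (1 : R) g (g1 t) /\ g t <= g 0.
  by apply: filterS2 dg gmax.
have inb t : `|t| < e -> is_derive t 1 g (g1 t) /\ g t <= g 0.
  by move=> te; apply: eP; rewrite /ball /= sub0r normrN.
have itv t : t \in `](- e), e[ -> is_derive t 1 g (g1 t) /\ g t <= g 0.
  by rewrite in_itv /= => te; apply: inb; rewrite ltr_norml.
have g10 : g1 0 = 0.
  have d0 : is_derive (0 : R) 1 g 0.
    apply: (@derive1_at_max _ g (- e) e 0).
    - by lra.
    - by move=> t /itv[dt _]; exact: (@ex_derive _ _ _ _ _ _ _ dt).
    - by rewrite in_itv /= oppr_lt0 e0.
    - by move=> t /itv[].
  have [d1 _] := inb 0 (ltac:(by rewrite normr0)).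
  by rewrite -(@derive_val _ _ _ _ _ _ _ d1) (@derive_val _ _ _ _ _ _ _ d0).
have g1pos : exists2 d, 0 < d & forall t, 0 < t -> t < d -> 0 < g1 t.
  have cv : h^-1 *: ((g1 \o shift 0) (h *: 1) - g1 0) @[h --> 0^'] --> a.
    have := @ex_derive _ _ _ _ _ _ _ dg1; rewrite /derivable => H.
    by have := @derive_val _ _ _ _ _ _ _ dg1; rewrite /derive => <-.
    have Hp : \forall h \near 0^', 0 < h^-1 *: ((g1 \o shift 0) (h *: 1) - g1 0).
    exact: (cvgr_gt _ cv 0 a0).
  have /nbhs_ballP[d /= d0 dP] : \forall h \near (0 : R), h != 0 ->
    0 < h^-1 *: ((g1 \o shift 0) (h *: 1) - g1 0) := Hp.
  exists d => // t t0 td; have := dP t; rewrite /ball /= sub0r normrN gtr0_norm //.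
  move=> /(_ td (lt0r_neq0 t0)); rewrite g10 subr0 addr0 /GRing.scale /= mulr1.
  by rewrite pmulr_rgt0 // invr_gt0.
have [d d0 g1t] := g1pos; pose t := Num.min d e / 2.
have m0 : 0 < Num.min d e by rewrite lt_min d0.
have t0 : 0 < t by rewrite divr_gt0.
have tm : t < Num.min d e by rewrite ltr_pdivrMr // ltr_pMr // ltr1n.
move: tm; rewrite lt_min => /andP[td te].
have [||c ct E] := @MVT _ g g1 0 t t0.
- move=> s; rewrite in_itv /= => /andP[s0 st].
  have sb : `|s| < e by rewrite gtr0_norm // (lt_trans st).
  by have [] := inb s sb.
- apply: derivable_within_continuous => s; rewrite in_itv /= => /andP[s0 st].
  have [ds _] := inb s (ltac:(by rewrite ger0_norm // (le_lt_trans st))).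
  exact: (@ex_derive _ _ _ _ _ _ _ ds).
rewrite subr0 in E; have [_] := inb t (ltac:(by rewrite gtr0_norm)).
rewrite -subr_le0 E leNgt mulr_gt0 //.
by move: ct; rewrite in_itv /= => /andP[c0 ct]; apply: g1t => //; exact: lt_trans td.
Qed.

End SecondDerivative.

(** * The pointwise Laplacian and the interior gradient estimate *)

Section Laplacian.
Context {R : realType} {N : nat}.
Implicit Types (x y z c p q nu : 'rV[R]_N) (r s t a b C : R) (i j : 'I_N)
  (u w : 'rV[R]_N -> R) (Omega : set 'rV[R]_N).

(** Only the second derivatives along the axes enter: this is enough for the maximum principle,
and is stable under all the constructions used for barriers. *)
Definition has_lap u x a : Prop := exists2 d : 'I_N -> R,
  forall i, d2 (fun t => u (x + t *: ax i)) (d i) & a = \sum_(i < N) d i.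

Lemma has_lapD u w x a b : has_lap u x a -> has_lap w x b ->
  has_lap (fun y => u y + w y) x (a + b).
Proof.
move=> [d du ->] [e ew ->]; exists (fun i => d i + e i); last by rewrite big_split.
by move=> i; exact: d2D.
Qed.

Lemma has_lapZ k u x a : has_lap u x a -> has_lap (fun y => k * u y) x (k * a).
Proof.
move=> [d du ->]; exists (fun i => k * d i); last by rewrite mulr_sumr.
by move=> i; exact: d2Z.
Qed.

Lemma has_lapN u x a : has_lap u x a -> has_lap (fun y => - u y) x (- a).
Proof.
move=> /(has_lapZ (-1)); rewrite mulN1r.
by under eq_fun do rewrite mulN1r.
Qed.

Lemma has_lapB u w x a b : has_lap u x a -> has_lap w x b ->
  has_lap (fun y => u y - w y) x (a - b).
Proof. by move=> ua /has_lapN; exact: has_lapD. Qed.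

Lemma has_lap_cst k x : has_lap (fun=> k) x 0.
Proof.
exists (fun=> 2 * 0) => [i|]; last by rewrite mulr0 big1.
have := @d2_quad R k 0 0; congr (d2 _ _).
by apply/funext => t; rewrite !mul0r !addr0.
Qed.

Lemma has_lap_sqnorm c x : has_lap (fun y => sqnorm (y - c)) x (2 * N%:R).
Proof.
exists (fun=> 2 * 1); last by rewrite sumr_const card_ord -[RHS]mulr_natr mulr1.
move=> i; have := d2_quad (sqnorm (x - c)) (2 * (x - c) 0 i) 1; congr (d2 _ _).
by apply/funext => t; rewrite [in RHS]addrAC sqnorm_shift; ring.
Qed.

Lemma has_lap_slab nu k l x :
  has_lap (fun y => (dot nu y + k) * (l - dot nu y)) x (- (2 * sqnorm nu)).
Proof.
exists (fun i => 2 * - nu 0 i ^+ 2); last first.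
  by rewrite -mulr_sumr sumrN mulrN.
move=> i; have := d2_quad ((dot nu x + k) * (l - dot nu x))
  (nu 0 i * (l - dot nu x) - (dot nu x + k) * nu 0 i) (- nu 0 i ^+ 2); congr (d2 _ _).
by apply/funext => t; rewrite dotDr dotZr dot_ax; ring.
Qed.

Lemma has_lap_flip u i c x a : has_lap u (flip i c x) a ->
  has_lap (fun y => u (flip i c y)) x a.
Proof.
move=> [d du ->]; exists d => // j; have := du j.
under [X in _ -> d2 X _]eq_fun do rewrite flip_shift.
have [ji|ji] := eqVneq j i; last by rewrite expr0; under [X in _ -> d2 X _]eq_fun do rewrite mul1r.
rewrite expr1; under [X in _ -> d2 X _]eq_fun do rewrite mulN1r.
exact: (@d2N _ (fun t => u (flip i c x + t *: ax j))).
Qed.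

Lemma has_lap_radial n c x : 0 < sqnorm (x - c) ->
  has_lap (fun y => (sqnorm (y - c))^-1 ^+ n) x
    (2 * n%:R * (2 * n.+1%:R - N%:R) * (sqnorm (x - c))^-1 ^+ n.+1).
Proof.
move=> s0; set s := sqnorm (x - c).
exists (fun i => n%:R * n.+1%:R * (2 * (x - c) 0 i) ^+ 2 * s^-1 ^+ n.+2 - 2 * n%:R * s^-1 ^+ n.+1).
  move=> i; have := d2_radial (2 * (x - c) 0 i) n s0; congr (d2 _ _).
  by apply/funext => t; rewrite [in RHS]addrAC sqnorm_shift; congr (_^-1 ^+ _); ring.
have -> : \sum_(i < N) (n%:R * n.+1%:R * (2 * (x - c) 0 i) ^+ 2 * s^-1 ^+ n.+2 - 2 * n%:R * s^-1 ^+ n.+1) =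
   n%:R * n.+1%:R * 4 * s^-1 ^+ n.+2 * s - N%:R * (2 * n%:R * s^-1 ^+ n.+1).
  rewrite sumrB sumr_const card_ord; congr (_ - _); last by rewrite [RHS]mulr_natl.
  by rewrite [in RHS]/s /sqnorm mulr_sumr; apply: eq_bigr => i _; ring.
by rewrite -!natr1 !exprS; field; rewrite gt_eqF.
Qed.

Lemma has_lap_max u x a r : 0 < r -> (forall y, box x r y -> u y <= u x) -> has_lap u x a -> a <= 0.
Proof.
move=> r0 xm [d du ->]; apply: sumr_le0 => i _; apply: d2_max (du i) _.
apply/nbhs_ballP; exists r => //= t; rewrite /ball /= sub0r normrN scale0r addr0 => tr.
apply: xm; rewrite -[r]add0r; apply: box_shift; first exact: box_refl.
exact: ltW.
Qed.

Lemma is_derive_line u x t i l : is_derive (x + t *: ax i) (ax i) u l ->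
  is_derive t 1 (fun s => u (x + s *: ax i)) l.
Proof.
move=> du; have E : (fun h : R => h^-1 *: (((fun s => u (x + s *: ax i)) \o shift t) (h *: 1) - u (x + t *: ax i))) =
   (fun h => h^-1 *: ((u \o shift (x + t *: ax i)) (h *: ax i) - u (x + t *: ax i))).
  apply/funext => h /=; congr (_ *: (u _ - _)).
  by rewrite [h *: 1]mulr1 scalerDl addrCA.
apply: DeriveDef.
  by rewrite /derivable E; exact: (@ex_derive _ _ _ _ _ _ _ du).
by rewrite /derive E; exact: (@derive_val _ _ _ _ _ _ _ du).
Qed.

Lemma class_C2_has_lap Omega u x : open Omega -> class_C 2 Omega u -> Omega x ->
  has_lap u x (\sum_(i < N) partial i (partial i u) x).
Proof.
move=> Oo [_ ud /= up] Ox; exists (fun i => partial i (partial i u) x) => // i.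
exists (fun t => partial i u (x + t *: ax i)); split; last first.
  apply: is_derive_line; rewrite scale0r addr0; apply: derivableP.
  by have [_ pd _] := up i; exact: pd.
have /nbhs_boxP[r r0 xr] : nbhs x Omega by exact: open_nbhs_nbhs.
apply/nbhs_ballP; exists r => //= t; rewrite /ball /= sub0r normrN => tr.
apply: is_derive_line; apply: derivableP; apply: ud; apply: xr.
rewrite -[r]add0r; apply: box_shift; first exact: box_refl.
exact: ltW.
Qed.

Lemma box_closed c r : closed (box c r).
Proof.
move=> x xc i; apply/ler_addgt0Pr => e e0.
have [|y [yc xy]] := xc (box x e); first by apply/nbhs_boxP; exists e.
have := yc i; have := box_sym xy i => h1 h2.
by rewrite -(subrK (y 0 i) (x 0 i)) -addrA (le_trans (ler_normD _ _)) // [r + e]addrC lerD.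
Qed.

Lemma contD u w : continuous u -> continuous w -> continuous (fun y => u y + w y).
Proof. by move=> uc wc x; apply: (@cvgD _ _ _ _ (nbhs_filter x)); [exact: uc|exact: wc]. Qed.

Lemma contB u w : continuous u -> continuous w -> continuous (fun y => u y - w y).
Proof. by move=> uc wc x; apply: (@cvgB _ _ _ _ (nbhs_filter x)); [exact: uc|exact: wc]. Qed.

Lemma contM u w : continuous u -> continuous w -> continuous (fun y => u y * w y).
Proof. by move=> uc wc x; apply: (@cvgM _ _ _ (nbhs_filter x)); [exact: uc|exact: wc]. Qed.

Lemma cont_cst k : continuous (fun _ : 'rV[R]_N => k : R).
Proof. exact: cst_continuous. Qed.

Lemma contZ k u : continuous u -> continuous (fun y => k * u y).
Proof. by move=> uc; apply: contM => //; exact: cont_cst. Qed.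

Lemma contN u : continuous u -> continuous (fun y => - u y).
Proof.
move=> uc; under eq_fun do rewrite -sub0r; apply: contB => //; exact: cont_cst.
Qed.

Lemma cont_coordB c i : continuous (fun y : 'rV[R]_N => y 0 i - c 0 i).
Proof. by apply: contB; [move=> x; exact: coord_continuous|exact: cont_cst]. Qed.

Lemma continuous_sqnormB c : continuous (fun y : 'rV[R]_N => sqnorm (y - c)).
Proof.
have -> : (fun y : 'rV[R]_N => sqnorm (y - c)) =
    (fun y => \sum_(i < N) ((y 0 i - c 0 i) * (y 0 i - c 0 i))).
  by apply/funext => y; apply: eq_bigr => i _; rewrite !mxE expr2.
move=> x; apply: (cvg_sumr (nbhs_filter x)) => i _.
by apply: contM; exact: cont_coordB.
Qed.

Lemma flip_dist i c x y d : box x d y -> box (flip i c x) d (flip i c y).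
Proof.
move=> xy j; rewrite !flipE; case: eqP => [->|_]; last by rewrite !mulr0 !subr0.
by have := xy i; rewrite -[X in X <= _ -> _]normrN !mulr1; congr (`|_| <= _); ring.
Qed.

Lemma cont_flip u i c : continuous u -> continuous (fun y => u (flip i c y)).
Proof.
move=> uc x; apply/continuous_boxP => e e0.
have /continuous_boxP/(_ e e0)[d d0 ud] := uc (flip i c x).
by exists d => // y xy; apply: ud; exact: flip_dist.
Qed.

(** The estimate of [discrete_gradient_le] for the Laplacian itself; here the antisymmetric part
vanishes on the mid-plane, which becomes part of the boundary of the half cube. *)
Lemma gradient_le u i c r (M F t : R) : continuous u ->
  0 < r -> 0 < M -> 0 <= F -> 0 <= t <= r ->
  (forall x, box c r x -> `|u x| <= M) ->
  (forall x, box c r x -> exists2 a, has_lap u x a & `|a| <= F) ->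
  u (c + t *: ax i) - u (c - t *: ax i) <= t * (4 * N.+2%:R * M / r + 2 * r * F).
Proof.
move=> uc r0 M0 F0 /andP[t0 tr] uM uF.
pose phi y := u y - u (flip i c y).
pose G := N.+1%:R * (2 * M) / r ^+ 2 + F.
have G0 : 0 <= G by rewrite addr_ge0 // divr_ge0 ?sqr_ge0 // !mulr_ge0 // ltW.
pose k := 2 * M / r ^+ 2.
have k0 : 0 < k by rewrite divr_gt0 ?mulr_gt0 ?exprn_gt0.
pose B y := k * sqnorm (y - c) + G * ((dot (ax i) y + - c 0 i) * (2 * r + c 0 i - dot (ax i) y)).
have dE y : dot (ax i) y = y 0 i by rewrite dotC dot_ax.
have phiM y : box c r y -> `|phi y| <= 2 * M.
  move=> yc; rewrite (le_trans (ler_normB _ _)) // mulr2n mulrDl mul1r lerD ?uM //.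
  exact: flip_box.
have dB y : has_lap B y (- (2 * k + 2 * F)).
  have := has_lapD (has_lapZ k (has_lap_sqnorm c y))
    (has_lapZ G (has_lap_slab (ax i) (- c 0 i) (2 * r + c 0 i) y)).
  congr (has_lap _ _ _); rewrite sqnorm_ax /G /k -natr1.
  by field; rewrite gt_eqF.
have B_ge y : 0 <= y 0 i - c 0 i -> y 0 i - c 0 i <= 2 * r -> k * sqnorm (y - c) <= B y.
  by move=> y0 yr; rewrite lerDl mulr_ge0 // dE mulr_ge0 //; lra.
have Bs y : 0 <= k * sqnorm (y - c) by rewrite mulr_ge0 ?sqnorm_ge0 // ltW.
have wc : continuous (fun y => phi y - B y).
  apply: contB; first by apply: contB => //; exact: cont_flip.
  apply: contD; first by apply: contZ; exact: continuous_sqnormB.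
  apply: contZ; apply: contM; first by apply: contD; [exact: continuous_dot|exact: cont_cst].
  by apply: contB; [exact: cont_cst|exact: continuous_dot].
pose A := box c r `&` [set y | 0 <= y 0 i - c 0 i].
have Acl : closed A.
  apply: closedI; first exact: box_closed.
  apply: (closed_comp (f := fun y : 'rV[R]_N => y 0 i - c 0 i) (D := [set z | 0 <= z])).
    by move=> y _; exact: cont_coordB.
  exact: closed_ge.
have cA : A (c + t *: ax i).
  split; first by rewrite -[r]add0r; apply: box_shift; [exact: box_refl|rewrite ger0_norm].
  by rewrite /= shiftE eqxx mulr1 addrC addKr.
have [y [yc y0] ymax] := EVT_box wc Acl (ex_intro _ _ cA) (@subIsetl _ _ _).
have yr j : `|y 0 j - c 0 j| <= r by exact: yc.
have yi2 : y 0 i - c 0 i <= 2 * r by rewrite (le_trans (ler_norm _)) // (le_trans (yr i)) //; lra.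
have wy : phi y - B y <= 0.
  rewrite leNgt; apply/negP => wy.
  have ti : 0 < y 0 i - c 0 i.
    rewrite lt_def y0 andbT; apply/eqP => yi0; move: wy.
    have -> : phi y = 0.
      by rewrite /phi /flip yi0 mulr0 scale0r subr0 subrr.
    by rewrite sub0r oppr_gt0 ltNge (le_trans _ (B_ge _ _ _)) // yi0.
  have ylt j : `|y 0 j - c 0 j| < r.
    rewrite lt_neqAle yr andbT; apply/eqP => yj; move: wy.
    rewrite subr_gt0 ltNge (le_trans (ler_norm _)) // (le_trans (phiM y yc)) //.
    apply: le_trans (B_ge y y0 yi2); have := coord_sqnorm (y - c) j; rewrite !mxE.
    rewrite -[X in X <= _]real_normK ?num_real // yj => rs.
    have -> : 2 * M = k * r ^+ 2 by rewrite /k divfK // gt_eqF // exprn_gt0.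
    by rewrite ler_wpM2l // ltW.
  have [e e0 ye] : exists2 e, 0 < e & forall z, box y e z -> A z.
    pose m := \big[Num.min/ (y 0 i - c 0 i)]_(j < N) (r - `|y 0 j - c 0 j|).
    have m0 : 0 < m by apply/bigmin_gtP; split=> // j _; rewrite subr_gt0.
    exists m => // z zy; split=> [j|].
      have mj : m <= r - `|y 0 j - c 0 j| by exact: bigmin_le.
      rewrite -(subrK (y 0 j) (z 0 j)) -addrA (le_trans (ler_normD _ _)) //.
      by rewrite -lerBrDr (le_trans (zy j)).
    have mi : m <= y 0 i - c 0 i by exact: bigmin_le_id.
    have := zy i; rewrite ler_norml => /andP[zi _]; rewrite /=; lra.
  have [a1 l1 a1F] := uF y yc; have [a2 l2 a2F] := uF _ (flip_box i yc).
  have L := has_lapB (has_lapB l1 (has_lap_flip l2)) (dB y).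
  have := has_lap_max e0 (fun z zy => ymax z (ye z zy)) L.
  by move: a1F a2F; rewrite !ler_norml; lra.
have := le_trans (ymax _ cA) wy; rewrite subr_le0 /phi.
have -> : flip i c (c + t *: ax i) = c - t *: ax i.
  apply/rowP => j; rewrite flipE -[- (_ *: ax i)]scaleNr !shiftE eqxx mulr1.
  by move: (_ == _)%:R => b; ring.
move=> /le_trans; apply.
have -> : B (c + t *: ax i) = k * t ^+ 2 + G * (t * (2 * r - t)).
  by rewrite /B dE addrAC subrr add0r sqnormZ sqnorm_ax shiftE eqxx !mulr1; ring.
have -> : t * (4 * N.+2%:R * M / r + 2 * r * F) = t * (k * r * 2) + G * (t * (2 * r)).
  by rewrite /G /k -natr1; field; rewrite gt_eqF.
apply: lerD.
  rewrite expr2 mulrCA ler_wpM2l // -mulrA ler_wpM2l ?(ltW k0) //; lra.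
by rewrite !ler_wpM2l //; lra.
Qed.

Lemma gradient u i c r (M F t : R) : continuous u ->
  0 < r -> 0 < M -> 0 <= F -> 0 <= t <= r ->
  (forall x, box c r x -> `|u x| <= M) ->
  (forall x, box c r x -> exists2 a, has_lap u x a & `|a| <= F) ->
  `|u (c + t *: ax i) - u (c - t *: ax i)| <= t * (4 * N.+2%:R * M / r + 2 * r * F).
Proof.
move=> uc r0 M0 F0 tr uM uF; rewrite ler_norml; apply/andP; split; last exact: gradient_le.
have := @gradient_le (fun x => - u x) i c r M F t _ r0 M0 F0 tr.
rewrite lerNl opprB opprK addrC; apply.
- exact: contN.
- by move=> x xc; rewrite normrN uM.
- by move=> x xc; have [a ua aF] := uF x xc; exists (- a); [exact: has_lapN|rewrite normrN].
Qed.

End Laplacian.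

(** * Harnack's inequality *)

Section Harnack.
Context {R : realType} {N : nat}.
Implicit Types (x y z c p q nu : 'rV[R]_N) (r s t a b A C L rho : R) (i j : 'I_N)
  (u w : 'rV[R]_N -> R) (Omega : set 'rV[R]_N).

Lemma contX u n : continuous u -> continuous (fun y => u y ^+ n).
Proof.
move=> uc; elim: n => [|n IH]; first by under eq_fun do rewrite expr0; exact: cont_cst.
by under eq_fun do rewrite exprS; exact: contM.
Qed.

(** The form taken by an elliptic equation with bounded coefficient, for which Harnack's
inequality is proved. *)
Definition elliptic_at L u y : Prop :=
  0 <= u y /\ exists2 a, has_lap u y a & `|a| <= L * u y.

Definition local_harnack A : Prop := forall u xh rho L,
  continuous u -> 0 < rho -> 0 <= L -> L * rho ^+ 2 <= 1 ->
  (forall y, box xh ((2 * N%:R + 1) * rho) y -> elliptic_at L u y) ->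
  forall y, box xh (rho / 2) y -> u y <= A * u xh.

(** The function |y - c|^(-4N) - S^(-2N) vanishes on the outer sphere of the shell, and its
Laplacian is large enough to absorb the term L u: a lower bound on a small ball propagates
outwards at a polynomial rate. *)
Lemma shell_lower_bound u c s0 S L k : (0 < N)%N -> continuous u ->
  0 < s0 -> 0 < S -> 0 <= k -> 0 <= L -> L * S <= 4 * N%:R ^+ 2 ->
  (forall y, sqnorm (y - c) <= S -> 0 <= u y /\ exists2 a, has_lap u y a & a <= L * u y) ->
  (forall y, sqnorm (y - c) <= s0 -> k <= u y) ->
  forall y, s0 <= sqnorm (y - c) <= S ->
  k * s0 ^+ (2 * N) * ((sqnorm (y - c))^-1 ^+ (2 * N) - S^-1 ^+ (2 * N)) <= u y.
Proof.
move=> N0 uc s00 S0 k0 L0 LS uS us0 y0 /andP[y0s y0S].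
set n := (2 * N)%N; set K := k * s0 ^+ n.
have K0 : 0 <= K by rewrite mulr_ge0 // exprn_ge0 // ltW.
have [K00|Kn0] := eqVneq K 0; first by rewrite K00 mul0r; have [] := uS _ y0S.
have Kp : 0 < K by rewrite lt_def Kn0.
(* the barrier, made continuous at the centre by truncation of the radius *)
pose sq y := sqnorm (y - c).
pose bar y := K * ((Num.max s0 (sq y))^-1 ^+ n - S^-1 ^+ n).
have sqc : continuous sq by exact: continuous_sqnormB.
have mc : continuous (fun y => Num.max s0 (sq y)).
  by move=> y; apply: continuous_max; [exact: cst_continuous|exact: sqc].
have barc : continuous bar.
  apply: contZ; apply: contB; last exact: cont_cst.
  have invc : continuous (fun y => (Num.max s0 (sq y))^-1).
    move=> y; apply: (@cvgV _ _ _ (nbhs_filter y)); last exact: mc.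
    by rewrite gt_eqF // lt_max s00.
  exact: contX.
pose A := [set y | s0 <= sq y <= S].
have Acl : closed A.
  rewrite (_ : A = [set y | s0 <= sq y] `&` [set y | sq y <= S]); last first.
    by apply/seteqP; split=> y /=; [move=> /andP[a b]; split|move=> [a b]; apply/andP].
  apply: closedI.
    by apply: (closed_comp (f := sq) (D := [set z | s0 <= z])); [move=> y _; exact: sqc|exact: closed_ge].
  by apply: (closed_comp (f := sq) (D := [set z | z <= S])); [move=> y _; exact: sqc|exact: closed_le].
have Ab : A `<=` box c (S + 1).
  move=> y /andP[_ yS] i; have := @normr_coord_sqnorm _ _ (y - c) i (S + 1).
  rewrite !mxE; apply; first by rewrite addr_ge0 // ltW.
  by rewrite (le_trans yS) //; nra.
have Ay0 : A y0 by rewrite /A /= y0s y0S.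
have [y /andP[ys yS] ymax] := EVT_box (contB barc uc) Acl (ex_intro _ _ Ay0) Ab.
have max_sq z : s0 <= sq z -> Num.max s0 (sq z) = sq z by move=> zs; apply/max_idPr.
suff wy : bar y - u y <= 0.
  have := le_trans (ymax _ Ay0) wy; rewrite subr_le0 /bar max_sq //.
rewrite leNgt; apply/negP => wy.
have [uy0 [a la aL]] := uS y yS.
have sy0 : 0 < sq y by exact: lt_le_trans ys.
have ys' : s0 < sq y.
  rewrite lt_neqAle ys andbT; apply/eqP => ysE; move: wy.
  rewrite subr_gt0 ltNge (le_trans _ (us0 y _)) -/(sq y) -?ysE //.
  rewrite /bar max_sq // -ysE /K mulrBr -!mulrA -exprMn divff ?gt_eqF // expr1n mulr1.
  rewrite gerBl mulrA mulr_ge0 ?exprn_ge0 ?invr_ge0 ?(ltW S0) //.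
have yS' : sq y < S.
  rewrite lt_neqAle yS andbT; apply/eqP => ySE; move: wy.
  by rewrite /bar max_sq // ySE subrr mulr0 sub0r oppr_gt0 ltNge uy0.
have [e e0 eA] : exists2 e, 0 < e & forall z, box y e z -> s0 < sq z < S.
  have h1 : \forall z \near y, s0 < sq z by exact: (cvgr_gt _ (sqc y) _ ys').
  have h2 : \forall z \near y, sq z < S by exact: (cvgr_lt _ (sqc y) _ yS').
  have /nbhs_boxP[e e0 eP] := @filterI _ _ (nbhs_filter y) _ _ h1 h2.
  by exists e => // z /eP[/= -> ->].
have L1 := has_lapZ K (has_lapB (has_lap_radial n sy0) (has_lap_cst (S^-1 ^+ n) y)).
have L2 := has_lapB L1 la.
have loc z : box y e z -> K * ((sqnorm (z - c))^-1 ^+ n - S^-1 ^+ n) - u z <=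
    K * ((sqnorm (y - c))^-1 ^+ n - S^-1 ^+ n) - u y.
  move=> zy; have /andP[z1 z2] := eA z zy.
  have := ymax z; rewrite /A /= (ltW z1) (ltW z2) => /(_ isT).
  by rewrite /bar !max_sq // ltW.
have := has_lap_max e0 loc L2; apply/negP; rewrite -ltNge subr0 subr_gt0.
rewrite (le_lt_trans aL) // -/(sq y).
set T := (sq y)^-1 ^+ n; have T0 : 0 < T by rewrite exprn_gt0 // invr_gt0.
have uT : u y <= K * T.
  move: wy; rewrite subr_gt0 /bar max_sq // -/T => /ltW/le_trans; apply.
  by rewrite ler_wpM2l // gerBl exprn_ge0 // invr_ge0 ltW.
apply: (@le_lt_trans _ _ (L * (K * T))); first by rewrite ler_wpM2l.
have N1 : 1 <= N%:R :> R by rewrite ler1n.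
have -> : K * (2 * n%:R * (2 * n.+1%:R - N%:R) * (sq y)^-1 ^+ n.+1) =
    (12 * N%:R ^+ 2 + 8 * N%:R) * (K * T) / sq y.
  by rewrite exprS -/T -natr1 /n natrM; field; rewrite gt_eqF.
have KT : 0 < K * T by exact: mulr_gt0.
rewrite ltr_pdivlMr // mulrAC ltr_pM2r //.
apply: (@le_lt_trans _ _ (L * S)); first by rewrite ler_wpM2l.
rewrite (le_lt_trans LS) //; nra.
Qed.

Lemma continuous_normB c : continuous (fun y : 'rV[R]_N => `|y - c|).
Proof.
move=> x; apply/continuous_boxP => e e0; exists e => // y /(box_norm _ _ (ltW e0)) yx.
by rewrite (le_trans (ler_dist_dist _ _)) // opprB addrA subrK.
Qed.

(** Take a maximum point x0 of u(x) (rho - |x - xh|)^(4N). On the cube of half the remaining width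
d about x0, u is at most 2^(4N) u(x0), so by the gradient estimate it stays above u(x0) / 2 on a
ball whose radius is a fixed fraction dl of d. The shell barrier carries this bound to the centre
xh with the loss (d / rho)^(4N), which is exactly what the weight pays for. *)
Lemma harnack_local : (0 < N)%N -> exists2 A : R, 0 < A & local_harnack A.
Proof.
move=> N0; pose n := (2 * N)%N; pose m := (2 * n)%N.
have NR : 1 <= N%:R :> R by rewrite ler1n.
pose M4 : R := 2 ^+ m.
have M41 : 1 <= M4 by rewrite exprn_ege1 // ler1n.
(* the inverse of the fraction dl, read off from the gradient estimate summed over N axes *)
pose D : R := 2 * N%:R * (16 * N%:R + 33) * M4.
have D8 : 8 <= D.
  have : 2 * 1 * (16 * 1 + 33) * 1 <= D.
    by rewrite /D !ler_pM // ?mulr_ge0 ?addr_ge0 ?ler_wpM2l // lerD2r ler_wpM2l.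
  by apply: le_trans; lra.
have D0 : 0 < D by exact: lt_le_trans D8.
pose dl := D^-1.
have dl0 : 0 < dl by rewrite invr_gt0.
have dl8 : dl <= 8^-1 by rewrite /dl lef_pV2 ?posrE.
exists (2 * (4 * N%:R / dl) ^+ m).
  by rewrite mulr_gt0 // exprn_gt0 // divr_gt0 // mulr_gt0 // ltr0n.
move=> u xh rho L uc rho0 L0 Lr uP y yxh.
have sub1 : box xh rho `<=` box xh ((2 * N%:R + 1) * rho).
  by apply: box_le; rewrite ler_peMl ?(ltW rho0) //; lra.
have u0 z : box xh rho z -> 0 <= u z by move=> /sub1/uP[].
pose F z := u z * (rho - `|z - xh|) ^+ m.
have Fc : continuous F.
  by apply: contM => //; apply: contX; apply: contB; [exact: cont_cst|exact: continuous_normB].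
have [x0 x0b x0max] := EVT_box Fc (@box_closed _ _ xh rho) (ex_intro _ _ (box_refl xh (ltW rho0))) (@subset_refl _ _).
set w := u x0 in x0max; pose d := rho - `|x0 - xh|.
have d0 : 0 <= d by rewrite subr_ge0; apply/box_norm => //; exact: ltW.
have key : u y * (rho / 2) ^+ m <= w * d ^+ m.
  have yb : box xh rho y by apply: box_le yxh; lra.
  apply: le_trans (x0max y yb); rewrite /F ler_wpM2l ?u0 //.
  apply: lerXn2r; rewrite ?nnegrE ?divr_ge0 ?(ltW rho0) //.
    by rewrite subr_ge0; apply/box_norm => //; exact: ltW.
  by have /(box_norm _ _ (divr_ge0 (ltW rho0) (ler0n R 2))) := yxh; lra.
have rm : 0 < (rho / 2) ^+ m by rewrite exprn_gt0 // divr_gt0.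
have A0 : 0 <= (2 * (4 * N%:R / dl) ^+ m) * u xh.
  by rewrite mulr_ge0 ?u0 ?mulr_ge0 ?exprn_ge0 ?divr_ge0 ?mulr_ge0 ?(ltW dl0) //; exact: box_refl (ltW rho0).
have w0' : 0 <= w by exact: u0.
have [wd0|wd0] := leP (w * d ^+ m) 0.
  by rewrite (le_trans _ A0) // -(pmulr_lle0 _ rm) (le_trans key).
have w0 : 0 < w.
  by rewrite lt_def w0' andbT; apply: contraTneq wd0 => ->; rewrite mul0r ltxx.
have dp : 0 < d.
  rewrite lt_def d0 andbT; apply: contraTneq wd0 => ->.
  rewrite expr0n (_ : (m == 0)%N = false) ?mulr0 ?ltxx //.
  by rewrite /m /n !muln_eq0 /= eqn0Ngt N0.
have dr : d <= rho by rewrite gerBl.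
have near_x0 e z : 0 <= e -> box x0 e z -> `|z - xh| <= rho - d + e.
  move=> e0 /(box_norm _ _ e0) ze; rewrite -(subrK x0 z) -addrA (le_trans (ler_normD _ _)) //.
  by rewrite /d opprB addrC; lra.
have half z : box x0 (d / 2) z -> box xh rho z /\ u z <= M4 * w.
  move=> zb; have d20 : 0 <= d / 2 by lra.
  have zn := near_x0 _ z d20 zb.
  have zr : box xh rho z by apply/box_norm; [exact: ltW|lra].
  split=> //; have d2m : 0 < (d / 2) ^+ m by rewrite exprn_gt0 // divr_gt0.
  rewrite -(ler_pM2r d2m).
  have -> : M4 * w * (d / 2) ^+ m = w * d ^+ m.
    by rewrite expr_div_n /M4; field; rewrite expf_neq0.
  apply: le_trans (x0max z zr); rewrite /F ler_wpM2l ?u0 //.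
  by apply: lerXn2r; rewrite ?nnegrE //; move: zn dp; clear; lra.
have dld : dl * d <= d / 8 by rewrite mulrC ler_wpM2l.
have dld0 : 0 < dl * d by rewrite mulr_gt0.
have lower z : box x0 (dl * d) z -> w / 2 <= u z.
  move=> zb; suff : `|u z - u x0| <= w / 2 by rewrite ler_norml -/w; move: w0; clear; lra.
  have -> : w / 2 = N%:R * (dl * (16 * N%:R + 33) * (M4 * w)).
    by rewrite /dl /D; field; rewrite !gt_eqF //; move: NR M41; clear; lra.
  apply: (@axis_path _ _ u x0 (dl * d) _ (dl * d)) => //; last exact: box_refl (ltW dld0).
  move=> z1 i s z1b z1sb sb.
  pose c := z1 + (s / 2) *: ax i; pose t := `|s| / 2.
  have tb : 0 <= t <= d / 8 by rewrite divr_ge0 //= /t; move: sb dld dp; clear; lra.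
  have cb z2 : box c (d / 8) z2 -> box x0 (d / 2) z2.
    move=> z2b; apply: (@box_le _ _ _ (dl * d + dl * d / 2 + d / 8)); first by move: dld dp; clear; lra.
    apply: box_trans z2b; apply: box_shift => //.
    by rewrite normrM (@ger0_norm _ (2^-1)) //; move: sb; clear; lra.
  have Mp : 0 < M4 * w by rewrite mulr_gt0 // (lt_le_trans ltr01).
  have LM : 0 <= L * (M4 * w) by rewrite mulr_ge0 // ltW.
  have := @gradient _ _ u i c (d / 8) (M4 * w) (L * (M4 * w)) t uc _ Mp LM tb.
  have -> : `|u (c + t *: ax i) - u (c - t *: ax i)| = `|u (z1 + s *: ax i) - u z1|.
    have [s0|s0] := leP 0 s; rewrite /t ?(ger0_norm s0) ?(ltr0_norm s0) /c.
      by rewrite -addrA -scalerDl -splitr addrK.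
    by rewrite mulNr !scaleNr opprK addrK -addrA -scalerDl -splitr distrC.
  move=> H; apply: le_trans (H _ _ _) _.
  - by rewrite divr_gt0.
  - by move=> z2 /cb/half[z2b z2w]; rewrite ger0_norm ?u0.
  - move=> z2 /cb/half[z2b z2w]; have [_ [a la aL]] := uP _ (sub1 _ z2b).
    by exists a => //; rewrite (le_trans aL) // ler_wpM2l.
  have Ld : L * d ^+ 2 <= 1.
    by rewrite (le_trans _ Lr) // ler_wpM2l // lerXn2r ?nnegrE // ltW.
  rewrite [X in X <= _](_ : _ = (t / d) * ((32 * N.+2%:R + L * d ^+ 2 / 4) * (M4 * w))); last first.
    by field; rewrite gt_eqF.
  have td0 : 0 <= t / d by rewrite divr_ge0 //; case/andP: tb.
  have td : t / d <= dl / 2 by rewrite ler_pdivrMr // /t; move: sb; clear; lra.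
  have N2 : N.+2%:R = N%:R + 2 :> R by rewrite -addn2 natrD.
  have Ld0 : 0 <= L * d ^+ 2 by rewrite mulr_ge0 ?sqr_ge0.
  apply: (@le_trans _ _ (dl / 2 * ((32 * N.+2%:R + 1 / 4) * (M4 * w)))).
    apply: ler_pM => //; first by rewrite mulr_ge0 ?(ltW Mp) // N2; move: Ld0 NR; clear; lra.
    by rewrite ler_wpM2r ?(ltW Mp) //; move: Ld; clear; lra.
  rewrite mulrA ler_wpM2r ?(ltW Mp) // -[X in X <= _]mulrA ler_wpM2l ?(ltW dl0) // N2; move: NR; clear; lra.
have shell : (w / 2) * (dl * d) ^+ m <= u xh * (2 * N%:R * rho) ^+ m.
  pose S : R := (2 * N%:R * rho) ^+ 2; pose s0 : R := (dl * d) ^+ 2.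
  have S0 : 0 < S by rewrite exprn_gt0 // !mulr_gt0 // ltr0n.
  have s00 : 0 < s0 by rewrite exprn_gt0.
  have e1 : (dl * d) ^+ m = s0 ^+ n by rewrite /m exprM.
  have e2 : (2 * N%:R * rho) ^+ m = S ^+ n by rewrite /m exprM.
  have s0S : s0 <= S.
    rewrite lerXn2r ?nnegrE ?(ltW dld0) ?mulr_ge0 ?(ltW rho0) //.
    apply: (@le_trans _ _ rho); first by move: dld dr d0; clear; lra.
    by rewrite ler_peMl ?(ltW rho0) //; move: NR; clear; lra.
  have uxh : 0 <= u xh by apply: u0; exact: box_refl (ltW rho0).
  have in_small z : sqnorm (z - x0) <= s0 -> w / 2 <= u z.
    move=> zs; apply: lower => i.
    by have := @normr_coord_sqnorm _ _ (z - x0) i (dl * d) (ltW dld0) zs; rewrite !mxE.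
  rewrite e1 e2; have [xs|xs] := leP (sqnorm (xh - x0)) s0.
    apply: (@le_trans _ _ (w / 2 * S ^+ n)).
      by rewrite ler_wpM2l ?divr_ge0 // lerXn2r ?nnegrE ?(ltW s00) ?(ltW S0).
    by apply: ler_wpM2r; [rewrite exprn_ge0 ?(ltW S0)|apply: in_small].
  have xS4 : sqnorm (xh - x0) <= S / 4.
    have h1 := sqnorm_box (box_sym x0b); rewrite (le_trans h1) // /S.
    rewrite [X in _ <= X](_ : _ = N%:R * (N%:R * rho ^+ 2)); last by field.
    by rewrite ler_wpM2l // ler_peMl ?sqr_ge0.
  have shellb : w / 2 * s0 ^+ n * ((sqnorm (xh - x0))^-1 ^+ n - S^-1 ^+ n) <= u xh.
    apply: (@shell_lower_bound u x0 s0 S L (w / 2) N0 uc s00 S0 _ L0 _ _ in_small xh).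
    - by rewrite divr_ge0.
    - have -> : L * S = 4 * N%:R ^+ 2 * (L * rho ^+ 2) by rewrite /S; ring.
      by rewrite ler_piMr // mulr_ge0 ?sqr_ge0.
    - move=> z zS; have zb : box xh ((2 * N%:R + 1) * rho) z.
        have -> : (2 * N%:R + 1) * rho = rho + 2 * N%:R * rho by ring.
        apply: (box_trans x0b) => i.
        have := @normr_coord_sqnorm _ _ (z - x0) i (2 * N%:R * rho) _ zS.
        by rewrite !mxE; apply; rewrite !mulr_ge0 // ltW.
      have [z0 [a la aL]] := uP z zb; split=> //; exists a => //.
      by rewrite (le_trans _ aL) // ler_norm.
    - by rewrite (ltW xs) /= (le_trans xS4) // ler_pdivrMr // ler_peMr ?(ltW S0) // ler1n.
  have Sn0 : 0 < S ^+ n by rewrite exprn_gt0.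
  rewrite -(ler_pdivrMr _ _ Sn0); apply: le_trans shellb.
  have ws0 : 0 <= w / 2 * s0 ^+ n.
    by rewrite (mulr_ge0 (divr_ge0 w0' (ler0n R 2)) (exprn_ge0 n (ltW s00))).
  rewrite -exprVn (ler_wpM2l ws0) //.
  have Sx : 4 * S^-1 <= (sqnorm (xh - x0))^-1.
    have -> : 4 * S^-1 = (S / 4)^-1 by field; rewrite gt_eqF.
    by rewrite lef_pV2 ?posrE ?divr_gt0 // (lt_trans s00).
  have Sn : (4 * S^-1) ^+ n <= (sqnorm (xh - x0))^-1 ^+ n.
    by rewrite lerXn2r ?nnegrE ?mulr_ge0 ?invr_ge0 ?(ltW S0) // (le_trans (ltW s00)) // ltW.
  rewrite lerBrDr (le_trans _ Sn) // exprMn.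
  have S1 : 0 <= S^-1 ^+ n by rewrite exprn_ge0 // invr_ge0 ltW.
  have n4 : 2 <= 4 ^+ n :> R.
    rewrite /n mulnC exprM; apply: (@le_trans _ _ (4 ^+ N)); last first.
      by rewrite expr2 ler_peMl ?exprn_ge0 // exprn_ege1 // ler1n.
    by apply: (@le_trans _ _ (4 ^+ 1)); [rewrite expr1 ler_nat|rewrite ler_weXn2l ?ler1n].
  by move: (ler_wpM2r S1 n4); clear; lra.
rewrite -(ler_pM2r rm) (le_trans key) //.
have dlm : 0 < dl ^+ m by rewrite exprn_gt0.
rewrite -(ler_pM2r dlm).
have -> : w * d ^+ m * dl ^+ m = 2 * ((w / 2) * (dl * d) ^+ m).
  by rewrite exprMn; field.
have -> : 2 * (4 * N%:R / dl) ^+ m * u xh * (rho / 2) ^+ m * dl ^+ m =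
    2 * (u xh * (2 * N%:R * rho) ^+ m).
  have -> : 2 * N%:R * rho = (4 * N%:R / dl) * (rho / 2) * dl by field; rewrite gt_eqF.
  by rewrite !exprMn; ring.
by rewrite ler_wpM2l.
Qed.

(** Equidistant points on the segment are chained; convexity of K keeps them away from the
complement. *)
Lemma harnack_chain Omega (K : set 'rV[R]_N) A u L eps x y n :
  local_harnack A -> 0 <= A ->
  continuous u -> 0 < eps -> 0 <= L -> L * eps ^+ 2 <= 1 ->
  (forall y, Omega y -> elliptic_at L u y) ->
  (forall z, K z -> box z eps `<=` Omega) ->
  (forall z z' t, K z -> K z' -> 0 <= t <= 1 -> K (z + t *: (z' - z))) ->
  K x -> K y -> (0 < n)%N -> box x (n%:R * (eps / (2 * N%:R + 1) / 2)) y ->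
  u y <= A ^+ n * u x.
Proof.
move=> loc A0 uc eps0 L0 Le uP Kb Kc Kx Ky n0 xy.
set rho := eps / (2 * N%:R + 1) in xy.
have N1 : 0 < 2 * N%:R + 1 :> R by rewrite ltr_wpDl // mulr_ge0.
have rho0 : 0 < rho by rewrite divr_gt0.
have Lr : L * rho ^+ 2 <= 1.
  apply: le_trans Le; rewrite ler_wpM2l // lerXn2r ?nnegrE ?(ltW rho0) ?(ltW eps0) //.
  by rewrite ler_pdivrMr // ler_peMr ?(ltW eps0) // lerDr mulr_ge0.
pose p k := x + (k%:R / n%:R) *: (y - x).
have nn : n%:R != 0 :> R by rewrite pnatr_eq0 -lt0n.
have nR : 0 < n%:R :> R by rewrite ltr0n.
have Kp k : (k <= n)%N -> K (p k).
  by move=> kn; apply: Kc => //; rewrite divr_ge0 //= ler_pdivrMr // mul1r ler_nat.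
have pk k : (k <= n)%N -> u (p k) <= A ^+ k * u x.
  elim: k => [_|k IH kn]; first by rewrite /p mul0r scale0r addr0 expr0 mul1r.
  rewrite exprS -mulrA; apply: le_trans (ler_wpM2l A0 (IH (ltnW kn))).
  apply: (loc u (p k) rho L) => // [z zb|i].
    apply: uP; apply: (Kb _ (Kp k (ltnW kn))); apply: box_le zb.
    by rewrite /rho mulrC divfK // gt_eqF.
  have -> : p k.+1 0 i - p k 0 i = (y 0 i - x 0 i) / n%:R.
    by rewrite !mxE -natr1; field.
  rewrite normrM (gtr0_norm (x := n%:R^-1)) ?invr_gt0 // ler_pdivrMr // mulrC.
  exact: xy.
suff -> : y = p n by exact: pk.
by rewrite /p divff // scale1r addrC subrK.
Qed.

End Harnack.

(** * The maximum principle near the boundary of a convex domain *)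

Section Comparison.
Context {R : realType} {N : nat}.
Implicit Types (x y z c p q nu : 'rV[R]_N) (r s t a b C eps : R) (i j : 'I_N)
  (u w eta V : 'rV[R]_N -> R) (Omega : set 'rV[R]_N).

Lemma box_segment x z s t e : `|s - t| * (`|z - x| + 1) <= e ->
  box (x + t *: (z - x)) e (x + s *: (z - x)).
Proof.
move=> ste; have e0 : 0 <= e by rewrite (le_trans _ ste) // mulr_ge0 // addr_ge0.
apply/box_norm => //; rewrite opprD addrACA subrr add0r -scalerBl normrZ (le_trans _ ste) //.
by rewrite ler_wpM2l // lerDl.
Qed.

(** Both membership in the closure and not in the set come from the infimum of the parameters at
which the segment is outside. *)
Lemma exit_point Omega x z : open Omega -> Omega x -> ~ Omega z ->
  exists2 s, 0 <= s <= 1 & closure Omega (x + s *: (z - x)) /\ ~ Omega (x + s *: (z - x)).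
Proof.
move=> Oo Ox Ow; pose ga s := x + s *: (z - x); set d := `|z - x| + 1.
have d0 : 0 < d by rewrite ltr_wpDl.
pose E : set R := [set s | 0 <= s <= 1 /\ ~ Omega (ga s)].
have E1 : E 1 by split; [rewrite ler01 lexx|rewrite /ga scale1r addrC subrK].
have Elb : lbound E 0 by move=> s [/andP[]].
have Ei : has_inf E by split; [exists 1|exists 0].
have s00 : 0 <= inf E by apply: lb_le_inf => //; exists 1.
have s01 : inf E <= 1 by apply: ge_inf => //; exists 0.
have nO : ~ Omega (ga (inf E)).
  move=> Oi; have /nbhs_boxP[e e0 eO] : nbhs (ga (inf E)) Omega by exact: open_nbhs_nbhs.
  have [s [s1 sO] sE] := inf_adherent (divr_gt0 e0 d0) Ei.
  have sI : inf E <= s by apply: (ge_inf (ex_intro _ _ Elb)).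
  apply: sO; apply: eO; apply: box_segment; rewrite -ler_pdivlMr // ger0_norm ?subr_ge0 //.
  by rewrite lerBlDl ltW.
exists (inf E); [by rewrite s00|split=> // B /nbhs_boxP[e e0 eB]].
have sp : 0 < inf E.
  by rewrite lt_def s00 andbT; apply/eqP => sE; apply: nO; rewrite /ga sE scale0r addr0.
pose s := Num.max 0 (inf E - e / d).
have sl : s < inf E by rewrite /s gt_max sp gtrBl divr_gt0.
exists (ga s); split.
  apply: contrapT => sO; have : E s by split=> //; rewrite le_max lexx /= (le_trans (ltW sl)).
  by move=> /(ge_inf (ex_intro _ _ Elb)); rewrite leNgt sl.
apply: eB; apply: box_segment; rewrite -ler_pdivlMr // ltr0_norm ?subr_lt0 // opprB.
by rewrite lerBlDl -lerBlDr le_max lexx orbT.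
Qed.

(** At the point where a segment leaves the set, the supporting linear form would be positive at
both ends and zero in between. *)
Lemma supported_convex Omega x y t : open Omega -> supported Omega -> Omega x -> Omega y ->
  0 <= t <= 1 -> Omega (x + t *: (y - x)).
Proof.
move=> Oo Os Ox Oy /andP[t0 t1]; apply: contrapT => Ow.
have [s /andP[s0 s1] [cp np]] := exit_point Oo Ox Ow.
have [nu [_ nuO]] := Os _ cp np; have := nuO _ Ox; have := nuO _ Oy.
set v := y - x; have -> : x + s *: (x + t *: v - x) = x + (s * t) *: v.
  by rewrite [x + t *: v]addrC addrK scalerA.
have -> : x - (x + (s * t) *: v) = (- (s * t)) *: v by apply/rowP => i; rewrite !mxE; ring.
have -> : y - (x + (s * t) *: v) = (1 - s * t) *: v by apply/rowP => i; rewrite !mxE; ring.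
rewrite !dotZr; have st0 : 0 <= s * t by exact: mulr_ge0.
have st1 : s * t <= 1 by exact: mulr_ile1.
have [d0|d0] := leP (dot nu v) 0; nra.
Qed.

(** The points at sup distance at least eps from the complement; the non-strict inequality makes
this set closed, so that maxima over it exist. *)
Definition inner Omega eps : set 'rV[R]_N := [set x | forall q, ~ Omega q -> eps <= `|q - x|].

Lemma inner_sub Omega eps : 0 < eps -> inner Omega eps `<=` Omega.
Proof.
by move=> e0 x xK; apply: contrapT => /xK; rewrite subrr normr0 leNgt e0.
Qed.

Lemma inner_box Omega eps e : 0 <= e < eps -> forall x, inner Omega eps x -> box x e `<=` Omega.
Proof.
move=> /andP[e0 ee] x xK y yx; apply: contrapT => /xK; apply/negP; rewrite -ltNge.
by rewrite (le_lt_trans _ ee) //; apply/box_norm.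
Qed.

Lemma box_inner Omega r eps x : eps <= r -> box x r `<=` Omega -> inner Omega eps x.
Proof.
move=> er xr q Oq; rewrite leNgt; apply/negP => qe; apply/Oq/xr/box_norm.
  by rewrite (le_trans (normr_ge0 (q - x))) // (le_trans (ltW qe)).
by rewrite (le_trans (ltW qe)).
Qed.

Lemma inner_closed Omega eps : closed (inner Omega eps).
Proof.
move=> x xK q Oq; apply/ler_addgt0Pr => e e0.
have [|y [yK xy]] := xK (box x e); first by apply/nbhs_boxP; exists e.
apply: le_trans (yK q Oq) _; have -> : q - y = (q - x) + (x - y) by rewrite addrA subrK.
rewrite (le_trans (ler_normD _ _)) // lerD //.
by apply/box_norm; [exact: ltW|exact: box_sym].
Qed.

(** A box around a point of the segment is a convex combination of the boxes at its ends. *)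
Lemma inner_convex Omega eps x y t : open Omega -> supported Omega ->
  inner Omega eps x -> inner Omega eps y -> 0 <= t <= 1 -> inner Omega eps (x + t *: (y - x)).
Proof.
move=> Oo Os xK yK t01 q Oq; set w := x + _ in Oq *; rewrite leNgt; apply/negP => qe.
have tr z : inner Omega eps z -> Omega (z + (q - w)).
  by move=> zK; apply: contrapT => /zK; rewrite addrC addKr leNgt qe.
apply: Oq; have := supported_convex Oo Os (tr _ xK) (tr _ yK) t01.
congr Omega; have -> : y + (q - w) - (x + (q - w)) = y - x.
  by apply/rowP => i; rewrite !mxE; ring.
by rewrite addrAC -/w addrC subrK.
Qed.

(** A point x1 outside of the inner set is closer than eps to a boundary point, hence lies in a
slab of width e = N eps along the boundary. The concave quadratic barrier on the slab of width 2 e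
equals the maximum M of eta on the far side, and at x1 it is at most 7 M / 8 + g e^2 / 2 because
Lm e^2 <= 1 / 2; so M <= 4 g e^2. *)
Lemma strip_max Omega p0 r0 eps eta (Lm g : R) : (0 < N)%N -> open Omega ->
  Omega `<=` box p0 r0 -> supported Omega ->
  0 < eps -> 0 <= Lm -> Lm * (N%:R * eps) ^+ 2 <= 2^-1 -> 0 <= g -> continuous eta ->
  (forall x, ~ Omega x -> eta x <= 0) -> (forall x, inner Omega eps x -> eta x <= 0) ->
  (forall x, Omega x -> 0 < eta x -> exists2 a, has_lap eta x a & - (Lm * eta x) - g <= a) ->
  forall x, eta x <= 4 * g * (N%:R * eps) ^+ 2.
Proof.
move=> N0 Oo Ob Os eps0 Lm0 Le g0 ec e_out e_in e_lap x0.
set e := N%:R * eps in Le *; have ep : 0 < e by rewrite mulr_gt0 // ltr0n.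
have e2 : 0 < e ^+ 2 by rewrite exprn_gt0.
rewrite leNgt; apply/negP => x0g.
have ge2 : 0 <= 4 * g * e ^+ 2 by rewrite !mulr_ge0 // ltW.
have Ox0 : Omega x0.
  by apply: contrapT => /e_out; rewrite leNgt (le_lt_trans ge2).
have r00 : 0 <= r0 by rewrite (le_trans (normr_ge0 _) (Ob _ Ox0 (Ordinal N0))).
have clb := closure_box r00 Ob.
have [x1 x1c x1max] := EVT_box ec (@closed_closure _ Omega)
  (ex_intro _ _ (subset_closure Ox0)) clb.
set M := eta x1 in x1max.
have Mg : 4 * g * e ^+ 2 < M by apply: lt_le_trans x0g _; exact: x1max (subset_closure Ox0).
have M0 : 0 < M by exact: le_lt_trans Mg.
have Ox1 : Omega x1 by apply: contrapT => /e_out; rewrite leNgt M0.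
have [q Oq qx1] : exists2 q, ~ Omega q & `|q - x1| < eps.
  apply: contrapT => H; have : inner Omega eps x1.
    by move=> q Oq; rewrite leNgt; apply/negP => qe; apply: H; exists q.
  by move=> /e_in; rewrite leNgt M0.
have [s /andP[s0 s1] [cp np]] := exit_point Oo Ox1 Oq.
set p := x1 + s *: (q - x1) in cp np.
have [nu [nu1 nuO]] := Os _ cp np.
pose t x := dot nu (x - p).
have tO x : Omega x -> 0 < t x by exact: nuO.
have tx1 : t x1 <= e.
  rewrite /t (le_trans (ler_norm _)) // dot_box // => i.
  have -> : (x1 - p) 0 i = - (s * (q - x1) 0 i) by rewrite !mxE; ring.
  rewrite normrN normrM ger0_norm //.
  have := (normr_mxP (q - x1) (ltW eps0)).2 (ltW qx1) i => h.
  by rewrite -[eps]mul1r ler_pM.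
(* any bound larger than Lm M + g for minus the Laplacian of eta makes the comparison strict *)
pose C := Lm * M + g + M / (4 * e ^+ 2).
have M4 : 0 < M / (4 * e ^+ 2) by rewrite (divr_gt0 M0) // (mulr_gt0 _ e2).
have C0 : 0 < C by rewrite ltr_wpDl // addr_ge0 // mulr_ge0 // ltW.
have tc : continuous t.
  by under [t]eq_fun do rewrite /t dotBr; apply: contB; [exact: continuous_dot|exact: cont_cst].
pose B x := M / (2 * e) * t x + C / 2 * (t x * (2 * e - t x)).
have BE : B = (fun x => C / 2 * ((dot nu x + - dot nu p) * (2 * e + M / (e * C) + dot nu p - dot nu x))).
  by apply/funext => x; rewrite /B /t dotBr; field; rewrite !gt_eqF.
have Bc : continuous B.
  apply: contD; first exact: contZ.
  by apply: contZ; apply: contM => //; apply: contB => //; exact: cont_cst.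
have dB x : has_lap B x (- C).
  have := has_lapZ (C / 2) (has_lap_slab nu (- dot nu p) (2 * e + M / (e * C) + dot nu p) x).
  by rewrite nu1 -BE; congr (has_lap _ _ _); field.
pose A := closure Omega `&` ([set x | 0 <= t x] `&` [set x | t x <= 2 * e]).
have Acl : closed A.
  apply: closedI; first exact: closed_closure.
  apply: closedI.
    by apply: (closed_comp (f := t) (D := [set z | 0 <= z])); [move=> y _; exact: tc|exact: closed_ge].
  by apply: (closed_comp (f := t) (D := [set z | z <= 2 * e])); [move=> y _; exact: tc|exact: closed_le].
have Ax1 : A x1.
  by split; [exact: x1c|split=> /=; [exact/ltW/tO|rewrite (le_trans tx1) // ler_peMl ?ltW // ltr1n]].
have [y [yc [yt0 yt2]] ymax] := EVT_box (contB ec Bc) Acl (ex_intro _ _ Ax1)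
  (subset_trans (@subIsetl _ _ _) clb).
rewrite /= in yt0 yt2.
have a0 : 0 <= M / (2 * e) by rewrite (divr_ge0 (ltW M0)) // (mulr_ge0 _ (ltW ep)).
have By0 : 0 <= B y.
  have s0' : 0 <= 2 * e - t y by rewrite subr_ge0.
  exact: (addr_ge0 (mulr_ge0 a0 yt0) (mulr_ge0 (divr_ge0 (ltW C0) _) (mulr_ge0 yt0 s0'))).
have : eta x1 <= B x1.
  rewrite -subr_le0 (le_trans (ymax _ Ax1)) // leNgt; apply/negP => yp.
  have ey : 0 < eta y by apply: le_lt_trans By0 _; rewrite -subr_gt0.
  have Oy : Omega y by apply: contrapT => /e_out; rewrite leNgt ey.
  have yM : eta y <= M by exact: x1max.
  have yt : t y < 2 * e.
    rewrite lt_neqAle yt2 andbT; apply/eqP => ytE; move: yp.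
    rewrite /B ytE subrr !mulr0 addr0 divfK ?(gt_eqF (mulr_gt0 _ ep)) //.
    by rewrite subr_gt0 ltNge yM.
  have [d d0 dA] : exists2 d, 0 < d & forall z, box y d z -> A z.
    have h1 : \forall z \near y, Omega z by exact: open_nbhs_nbhs.
    have h2 : \forall z \near y, t z < 2 * e by exact: (cvgr_lt _ (tc y) _ yt).
    have /nbhs_boxP[d d0 dP] := @filterI _ _ (nbhs_filter y) _ _ h1 h2.
    exists d => // z /dP[Oz tz]; split; first exact: subset_closure.
    by split=> /=; apply: ltW => //; exact: tO.
  have [a la aL] := e_lap y Oy ey.
  have := has_lap_max d0 (fun z zy => ymax z (dA z zy)) (has_lapB la (dB y)).
  have LM : Lm * eta y <= Lm * M by rewrite ler_wpM2l.
  by move: aL; rewrite /C; lra.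
apply/negP; rewrite -ltNge -/M.
have t1 : 0 < t x1 by exact: tO.
apply: (@le_lt_trans _ _ (M / (2 * e) * e + C / 2 * (e * (2 * e - e)))).
  apply: lerD; first by rewrite ler_wpM2l.
  rewrite ler_wpM2l ?divr_ge0 ?(ltW C0) //; nra.
have -> : M / (2 * e) * e + C / 2 * (e * (2 * e - e)) =
    M / 2 + (M * (Lm * e ^+ 2) + g * e ^+ 2 + M / 4) / 2.
  by rewrite /C; field; rewrite gt_eqF.
have : M * (Lm * e ^+ 2) <= M * 2^-1 by rewrite ler_wpM2l // ltW.
by move: Mg; lra.
Qed.

End Comparison.

(** * Positive eigenfunctions *)

Section Gap.
Context {R : realType} {N : nat}.
Implicit Types (x y z c p q nu : 'rV[R]_N) (r s t a b C eps rho L Lm lam g k : R) (i j : 'I_N)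
  (u w eta V : 'rV[R]_N -> R) (Omega : set 'rV[R]_N).

(** The width eps is small enough for the maximum principle of [strip_max] with the coefficient
Lm. *)
Definition thin Omega eps Lm : Prop :=
  [/\ open Omega, (exists c r, Omega `<=` box c r), supported Omega,
      (0 < N)%N & [/\ 0 < eps, 0 <= Lm & Lm * (N%:R * eps) ^+ 2 <= 2^-1]].

Lemma thin_max Omega eps Lm g eta : thin Omega eps Lm -> 0 <= g -> continuous eta ->
  (forall x, ~ Omega x -> eta x <= 0) -> (forall x, inner Omega eps x -> eta x <= 0) ->
  (forall x, Omega x -> 0 < eta x -> exists2 a, has_lap eta x a & - (Lm * eta x) - g <= a) ->
  forall x, eta x <= 4 * g * (N%:R * eps) ^+ 2.
Proof.
move=> [Oo [c [r Ob]] Os N0 [eps0 Lm0 Le]] g0.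
exact: (strip_max N0 Oo Ob Os eps0 Lm0 Le g0).
Qed.

(** Solutions are extended by zero to the whole space, where they are continuous: suprema over the
domain are then maxima. *)
Definition solves Omega V lam u : Prop :=
  [/\ continuous u, forall x, ~ Omega x -> u x = 0
    & forall x, Omega x -> has_lap u x (- (lam * V x * u x))].

Lemma solvesZ Omega V lam u k : solves Omega V lam u -> solves Omega V lam (fun x => k * u x).
Proof.
move=> [uc uo ul]; split; [exact: contZ|by move=> x /uo ->; rewrite mulr0|].
by move=> x /ul/(has_lapZ k); congr (has_lap _ _ _); ring.
Qed.

Lemma solvesN Omega V lam u : solves Omega V lam u -> solves Omega V lam (fun x => - u x).
Proof. by move=> /(solvesZ (-1)); under eq_fun do rewrite mulN1r. Qed.

Lemma solves_le0 Omega V eps Lm lam u : thin Omega eps Lm -> solves Omega V lam u ->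
  (forall x, Omega x -> lam * V x <= Lm) -> (forall x, inner Omega eps x -> u x <= 0) ->
  forall x, u x <= 0.
Proof.
move=> Ot [uc uo ul] VL uK x.
have := @thin_max Omega eps Lm 0 u Ot (lexx 0) uc; rewrite mulr0 mul0r; apply=> //.
  by move=> y /uo ->.
move=> y Oy uy; exists (- (lam * V y * u y)); first exact: ul.
by rewrite subr0 lerN2 ler_wpM2r ?VL // ltW.
Qed.

Lemma max_on_inner Omega eps Lm u x0 : thin Omega eps Lm -> continuous u -> inner Omega eps x0 ->
  exists2 x, inner Omega eps x & forall y, inner Omega eps y -> u y <= u x.
Proof.
move=> [Oo [c [r Ob]] _ _ [eps0 _ _]] uc Kx.
by apply: (EVT_box uc (@inner_closed _ _ Omega eps) (ex_intro _ _ Kx)) => y /(inner_sub eps0)/Ob; exact.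
Qed.

(** The truncation of u0 from below by its minimum over the inner set makes the quotient
continuous everywhere. *)
Lemma ratio_max Omega eps Lm u0 u x0 : thin Omega eps Lm -> continuous u0 -> continuous u ->
  (forall x, Omega x -> 0 < u0 x) -> inner Omega eps x0 ->
  exists2 x, inner Omega eps x & forall y, inner Omega eps y -> u y <= u x / u0 x * u0 y.
Proof.
move=> Ot u0c uc u00 Kx0; have [_ _ _ _ [eps0 _ _]] := Ot.
have [z Kz zmin] := max_on_inner Ot (contN u0c) Kx0.
have uz : 0 < u0 z by apply: u00; exact: inner_sub Kz.
pose v x := Num.max (u0 z) (u0 x).
have v0 x : 0 < v x by rewrite lt_max uz.
have vK x : inner Omega eps x -> v x = u0 x.
  by move=> Kx; apply/max_idPr; rewrite -lerN2 zmin.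
have vc : continuous v by move=> x; apply: continuous_max; [exact: cst_continuous|exact: u0c].
have vVc : continuous (fun x => (v x)^-1).
  by move=> x; apply: (@cvgV _ _ _ (nbhs_filter x)); [rewrite gt_eqF|exact: vc].
have [x Kx xmax] := max_on_inner Ot (contM uc vVc) Kx0.
exists x => // y Ky; have := xmax y Ky; rewrite !vK // ler_pdivrMr //.
by apply: u00; exact: inner_sub Ky.
Qed.

Lemma touching u x a : (forall y, u y <= 0) -> u x = 0 -> has_lap u x a -> a <= 0.
Proof. by move=> u0 ux; apply: (has_lap_max ltr01) => y _; rewrite ux. Qed.

(** Otherwise the smallest multiple of u0 above u on the inner set is above u everywhere, by the
maximum principle near the boundary; at the point where the two touch, the equations contradict
each other because the eigenvalue of u is smaller. *)
Lemma subprincipal_le0 Omega V eps Lm lam0 lam u0 u x0 : thin Omega eps Lm ->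
  inner Omega eps x0 -> solves Omega V lam0 u0 -> (forall x, Omega x -> 0 < u0 x) ->
  (forall x, Omega x -> 0 < V x) -> (forall x, Omega x -> lam0 * V x <= Lm) ->
  solves Omega V lam u -> lam < lam0 -> forall x, u x <= 0.
Proof.
move=> Ot Kx0 s0 u00 V0 VL s lamlt; have [_ _ _ _ [eps0 Lm0 _]] := Ot; have [Oo _ _ _ _] := Ot.
have [u0c u0o u0l] := s0; have [uc uo ul] := s.
have VL' x : Omega x -> lam * V x <= Lm.
  by move=> Ox; rewrite (le_trans _ (VL x Ox)) // ler_wpM2r // ltW // V0.
have [z Kz zmax] := ratio_max Ot u0c uc u00 Kx0.
have Oz := inner_sub eps0 Kz.
set t := u z / u0 z in zmax.
have [t0|t0] := leP t 0.
  apply: (solves_le0 Ot s VL') => x Kx; rewrite (le_trans (zmax x Kx)) //.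
  by rewrite mulr_le0_ge0 // ltW // u00 //; exact: inner_sub Kx.
pose eta x := u x - t * u0 x.
have etal x : Omega x -> has_lap eta x (- (lam * V x * u x) - t * (- (lam0 * V x * u0 x))).
  by move=> Ox; apply: has_lapB; [exact: ul|apply: has_lapZ; exact: u0l].
have le0 x : eta x <= 0.
  have := @thin_max Omega eps Lm 0 eta Ot (lexx 0); rewrite mulr0 mul0r; apply.
  - by apply: contB => //; exact: contZ.
  - by move=> y Oy; rewrite /eta uo // u0o // mulr0 subrr.
  - by move=> y Ky; rewrite subr_le0 zmax.
  move=> y Oy ey; exists (- (lam * V y * u y) - t * (- (lam0 * V y * u0 y))); first exact: etal.
  have h1 : lam * V y * eta y <= Lm * eta y by rewrite ler_wpM2r ?VL' // ltW.
  have h2 : 0 <= (lam0 - lam) * (V y * (t * u0 y)).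
    by rewrite mulr_ge0 ?subr_ge0 ?(ltW lamlt) // mulr_ge0 ?(ltW (V0 _ Oy)) // mulr_ge0 ?(ltW t0) ?(ltW (u00 _ Oy)).
  by move: h1 h2; rewrite /eta; lra.
have ez : eta z = 0 by rewrite /eta /t divfK ?subrr // gt_eqF // u00.
have := touching le0 ez (etal z Oz).
have -> : u z = t * u0 z by apply/eqP; rewrite -subr_eq0 -/(eta z) ez.
have : 0 < (lam0 - lam) * (V z * (t * u0 z)).
  by rewrite mulr_gt0 ?subr_gt0 // mulr_gt0 ?V0 // mulr_gt0 ?u00.
by move=> h1 h2; exfalso; move: h1 h2; lra.
Qed.

(** A positive eigenfunction belongs to the smallest eigenvalue. *)
Lemma principal_min Omega V eps Lm lam0 lam u0 u x0 : thin Omega eps Lm ->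
  inner Omega eps x0 -> solves Omega V lam0 u0 -> (forall x, Omega x -> 0 < u0 x) ->
  (forall x, Omega x -> 0 < V x) -> (forall x, Omega x -> lam0 * V x <= Lm) ->
  solves Omega V lam u -> lam < lam0 -> forall x, u x = 0.
Proof.
move=> Ot Kx0 s0 u00 V0 VL s lamlt x; apply/le_anti/andP; split.
  exact: (subprincipal_le0 Ot Kx0 s0 u00 V0 VL s lamlt).
by rewrite -oppr_le0; apply: (subprincipal_le0 Ot Kx0 s0 u00 V0 VL (solvesN s) lamlt).
Qed.

(** The constant is taken at least 1 in order to be raised to any larger power; the number n of
steps depends only on the quotient of the size of the domain by rho. *)
Lemma harnack_inner : (0 < N)%N -> exists2 A : R, 1 <= A & forall Omega u L eps rho x y n,
  open Omega -> supported Omega -> continuous u ->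
  0 < rho -> rho < eps -> 0 <= L -> L * rho ^+ 2 <= 1 ->
  (forall y, Omega y -> elliptic_at L u y) ->
  inner Omega eps x -> inner Omega eps y -> (0 < n)%N ->
  box x (n%:R * (rho / (2 * N%:R + 1) / 2)) y -> u y <= A ^+ n * u x.
Proof.
move=> N0; have [A A0 loc] := @harnack_local R N N0.
have loc' : @local_harnack R N (A + 1).
  move=> u xh rho L uc r0 L0 Lr uP y yx; apply: le_trans (loc u xh rho L uc r0 L0 Lr uP y yx) _.
  have r1 : 0 <= (2 * N%:R + 1) * rho by rewrite mulr_ge0 ?(ltW r0) // addr_ge0 // mulr_ge0.
  have [u0 _] := uP xh (box_refl _ r1).
  by rewrite ler_wpM2r // lerDl.
exists (A + 1); first by rewrite lerDr ltW.
move=> Omega u L eps rho x y n Oo Os uc r0 re L0 Lr uP Kx Ky n0 xy.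
apply: (harnack_chain loc' _ uc r0 L0 Lr uP _ _ Kx Ky n0 xy).
- by rewrite addr_ge0 // ltW.
- by move=> z; apply: inner_box; rewrite (ltW r0) re.
- by move=> z z' t Kz Kz'; exact: inner_convex.
Qed.

Lemma inner_exists Omega x : open Omega -> Omega x -> exists2 e, 0 < e & inner Omega e x.
Proof.
move=> Oo Ox; have /nbhs_boxP[e e0 xe] : nbhs x Omega by exact: open_nbhs_nbhs.
by exists e => //; exact: box_inner xe.
Qed.

Lemma inner_le Omega e eps : e <= eps -> inner Omega eps `<=` inner Omega e.
Proof. by move=> le x xK q /xK; exact: le_trans. Qed.

(** Strong maximum principle: by Harnack's inequality on an inner set containing two given points,
the values at these points vanish together. *)
Lemma nonneg_positive Omega L u x : (0 < N)%N -> open Omega -> supported Omega -> continuous u ->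
  0 <= L -> (forall y, Omega y -> elliptic_at L u y) ->
  Omega x -> 0 < u x -> forall y, Omega y -> 0 < u y.
Proof.
move=> N0 Oo Os uc L0 uP Ox ux y Oy; have [A A1 har] := harnack_inner N0.
have [e e0 Kx] := inner_exists Oo Ox; have [e' e'0 Ky] := inner_exists Oo Oy.
have L10 : 0 < L + 1 by rewrite ltr_wpDl.
pose eps := Num.min e e'; pose rho := Num.min (eps / 2) (L + 1)^-1.
have eps0 : 0 < eps by rewrite lt_min e0.
have rho0 : 0 < rho by rewrite lt_min divr_gt0 //= invr_gt0.
have re : rho < eps by rewrite gt_min ltr_pdivrMr // ltr_pMr // ltr1n.
have Kx' : inner Omega eps x by apply: inner_le Kx; rewrite ge_min lexx.
have Ky' : inner Omega eps y by apply: inner_le Ky; rewrite ge_min lexx orbT.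
have Lr : L * rho ^+ 2 <= 1.
  have r1 : rho <= (L + 1)^-1 by rewrite ge_min lexx orbT.
  have r2 : rho * (L + 1) <= 1 by rewrite -ler_pdivlMr // mul1r.
  have r3 : rho <= 1 by rewrite (le_trans r1) // invf_le1 // lerDr.
  by rewrite expr2; nra.
pose st := rho / (2 * N%:R + 1) / 2.
have st0 : 0 < st by rewrite !divr_gt0 // ltr_wpDl // mulr_ge0.
pose n := (Num.bound (`|y - x| / st)).+1.
have xy : box x (n%:R * st) y.
  apply/box_norm; first by rewrite mulr_ge0 // ltW.
  rewrite -ler_pdivrMr // ltW // (@lt_le_trans _ _ _ _ _ (archi_boundP (divr_ge0 (normr_ge0 _) (ltW st0)))) //.
  by rewrite ler_nat.
have yx : box y (n%:R * st) x by exact: box_sym.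
have := har Omega u L eps rho y x n Oo Os uc rho0 re L0 Lr uP Ky' Kx' isT yx.
rewrite ltNge; apply: contraTN => uy0; rewrite -ltNge (le_lt_trans _ ux) //.
by rewrite mulr_ge0_le0 // exprn_ge0 // (le_trans ler01).
Qed.

End Gap.

(** * Uniform simplicity of the principal eigenvalue *)

Section GapCore.
Context {R : realType} {N : nat}.
Implicit Types (x y z c p q nu : 'rV[R]_N) (r s t a b B C eps rho L Lm lam g k v : R) (i j : 'I_N)
  (u w eta V : 'rV[R]_N -> R) (Omega : set 'rV[R]_N).

(** The constant C is what the maximum principle near the boundary loses when the two equations
differ by the gap; all the estimates are in terms of C and of the Harnack constant B on the inner
set. *)
Lemma simplicity_normalised Omega V eps Lm L B v lam0 lam1 u0 u1 xm xs (C := 4 * ((lam1 - lam0) * v) * (N%:R * eps) ^+ 2) :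
  thin Omega eps Lm -> 1 <= B ->
  (forall u, continuous u ->
    (forall y, Omega y -> elliptic_at L u y) ->
    forall x y, inner Omega eps x -> inner Omega eps y -> u y <= B * u x) ->
  Lm + (4 * (N%:R * eps) ^+ 2)^-1 <= L ->
  (forall x, Omega x -> 0 < V x <= v) -> (forall x, Omega x -> lam1 * V x <= Lm) ->
  0 <= lam0 <= lam1 -> 6 * B ^+ 2 * C < 1 ->
  solves Omega V lam0 u0 -> (forall x, Omega x -> 0 < u0 x <= 1) -> u0 xm = 1 ->
  solves Omega V lam1 u1 -> inner Omega eps xs -> u1 xs = u0 xs ->
  (forall x, inner Omega eps x -> u1 x <= u0 x) ->
  forall x, u1 x = u0 x.
Proof.
move=> Ot B1 har LL VP VL /andP[lam00 lam01] CB s0 u0P um s1 Ks us uK.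
have [Oo _ _ N0 [eps0 Lm0 Le]] := Ot.
have [u0c u0o u0l] := s0; have [u1c u1o u1l] := s1.
set ga := lam1 - lam0 in C CB.
have ga0 : 0 <= ga by rewrite subr_ge0.
have V0 x : Omega x -> 0 < V x by move=> /VP/andP[].
have VL0 x : Omega x -> lam0 * V x <= Lm.
  by move=> Ox; rewrite (le_trans _ (VL x Ox)) // ler_wpM2r // ltW // V0.
have lV1 x : Omega x -> 0 <= lam1 * V x.
  by move=> Ox; exact: (mulr_ge0 (le_trans lam00 lam01) (ltW (V0 _ Ox))).
have lV0 x : Omega x -> 0 <= lam0 * V x.
  by move=> Ox; exact: (mulr_ge0 lam00 (ltW (V0 _ Ox))).
have gV x : Omega x -> 0 <= ga * V x <= ga * v.
  by move=> Ox; have /andP[Vx0 Vxv] := VP x Ox; rewrite mulr_ge0 ?ler_wpM2l // ltW.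
have u0p x : Omega x -> 0 < u0 x by move=> /u0P/andP[].
have ne2 : 0 < (N%:R * eps) ^+ 2 by rewrite exprn_gt0 // mulr_gt0 // ltr0n.
have gv0 : 0 <= ga * v by have /andP[] := gV _ (inner_sub eps0 Ks); exact: le_trans.
have C0 : 0 <= C by exact: (mulr_ge0 (mulr_ge0 _ gv0) (ltW ne2)).
have B0 : 0 < B by rewrite (lt_le_trans ltr01).
have u10 x : u1 x <= u0 x + C.
  rewrite -lerBlDl; apply: (@thin_max _ _ Omega eps Lm (ga * v) (fun x => u1 x - u0 x) Ot gv0 _ _ _ _ x).
  - exact: contB.
  - by move=> y Oy; rewrite u0o // u1o // subrr.
  - by move=> y Ky; rewrite subr_le0 uK.
  move=> y Oy ey; exists (- (lam1 * V y * u1 y) - - (lam0 * V y * u0 y)).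
    by apply: has_lapB; [exact: u1l|exact: u0l].
  have h1 : lam1 * V y * (u1 y - u0 y) <= Lm * (u1 y - u0 y) by rewrite ler_wpM2r ?VL // ltW.
  have h2 : ga * V y * u0 y <= ga * v.
    have /andP[g1 g2] := gV y Oy; have /andP[a1 a2] := u0P y Oy.
    by rewrite (le_trans _ g2) // ler_piMr.
  by move: h1 h2; rewrite /ga; clear; lra.
(* the constant added makes the difference at least C, so that the error in its equation, of size
C, is a bounded multiple of the function itself *)
pose uh x := u0 x - u1 x + 2 * C.
have uhC x : C <= uh x by have := u10 x; rewrite /uh; lra.
have uhP y : Omega y -> elliptic_at L uh y.
  move=> Oy; split; first exact: le_trans (uhC y).
  exists (- (lam0 * V y * u0 y) - - (lam1 * V y * u1 y) + 0).
    apply: has_lapD; last exact: has_lap_cst.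
    by apply: has_lapB; [exact: u0l|exact: u1l].
  have -> : - (lam0 * V y * u0 y) - - (lam1 * V y * u1 y) + 0 =
    lam1 * V y * (u1 y - u0 y) + ga * V y * u0 y by rewrite /ga; ring.
  have h1 : `|lam1 * V y * (u1 y - u0 y)| <= Lm * uh y.
    rewrite normrM (ger0_norm (lV1 y Oy)) ler_pM ?lV1 ?VL //.
    rewrite ler_norml; have := u10 y; have := uhC y; rewrite /uh; lra.
  have h2 : `|ga * V y * u0 y| <= (4 * (N%:R * eps) ^+ 2)^-1 * uh y.
    have /andP[g1 g2] := gV y Oy; have /andP[a1 a2] := u0P y Oy.
    rewrite ger0_norm ?(mulr_ge0 g1 (ltW a1)) //.
    apply: (@le_trans _ _ ((4 * (N%:R * eps) ^+ 2)^-1 * C)).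
      have -> : (4 * (N%:R * eps) ^+ 2)^-1 * C = ga * v.
        by rewrite /C; move: (gt_eqF ne2); move: ((N%:R * eps) ^+ 2) => e2 e20; field; rewrite e20.
      by rewrite (le_trans _ g2) // ler_piMr.
    by rewrite ler_wpM2l // invr_ge0 mulr_ge0 // ltW.
  rewrite (le_trans (ler_normD _ _)) // (le_trans (lerD h1 h2)) // -mulrDl.
  by rewrite ler_wpM2r // (le_trans C0).
have uhc : continuous uh by apply: contD; [exact: contB|exact: cont_cst].
have uhK y : inner Omega eps y -> uh y <= 2 * B * C.
  move=> Ky; apply: le_trans (har uh uhc uhP xs y Ks Ky) _.
  by rewrite /uh us subrr add0r mulrCA mulrA.
(* the maximum principle near the boundary, applied to u0 minus its maximum over the inner set,
shows that this maximum is at least 1 / 3 *)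
have [xk Kk kmax] := max_on_inner Ot u0c Ks.
have Ok := inner_sub eps0 Kk.
have k3 : 1 <= 3 * u0 xk.
  have kp := u0p _ Ok; have Lk : 0 <= Lm * u0 xk by rewrite mulr_ge0 // ltW.
  have := @thin_max _ _ Omega eps Lm (Lm * u0 xk) (fun x => u0 x - u0 xk) Ot Lk _ _ _ _ xm.
  have -> : 4 * (Lm * u0 xk) * (N%:R * eps) ^+ 2 = 4 * u0 xk * (Lm * (N%:R * eps) ^+ 2) by ring.
  move=> H; have : u0 xm - u0 xk <= 4 * u0 xk * (Lm * (N%:R * eps) ^+ 2).
    apply: H.
    - by apply: contB => //; exact: cont_cst.
    - by move=> x /u0o ->; rewrite sub0r oppr_le0 ltW.
    - by move=> x Kx; rewrite subr_le0 kmax.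
    move=> x Ox ex; exists (- (lam0 * V x * u0 x) - 0).
      by apply: has_lapB; [exact: u0l|exact: has_lap_cst].
    have : lam0 * V x * u0 x <= Lm * u0 x by rewrite ler_wpM2r ?VL0 // ltW // u0p.
    by lra.
  have : 4 * u0 xk * (Lm * (N%:R * eps) ^+ 2) <= 4 * u0 xk * 2^-1.
    by rewrite ler_wpM2l // mulr_ge0 // ltW.
  by rewrite um; lra.
have u0P' y : Omega y -> elliptic_at L u0 y.
  move=> Oy; split; first exact/ltW/u0p.
  exists (- (lam0 * V y * u0 y)); first exact: u0l.
  rewrite normrN ger0_norm; last exact: (mulr_ge0 (lV0 _ Oy) (ltW (u0p _ Oy))).
  apply: (ler_wpM2r (ltW (u0p _ Oy))); rewrite (le_trans (VL0 _ Oy)) // (le_trans _ LL) //.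
  by rewrite lerDl invr_ge0 mulr_ge0 // ltW.
have u0K y : inner Omega eps y -> 1 <= 3 * B * u0 y.
  move=> Ky; apply: le_trans k3 _; rewrite -mulrA ler_pM2l //.
  exact: (har u0 u0c u0P' y xk Ky Kk).
have u1K y : inner Omega eps y -> 0 < u1 y.
  move=> Ky; have h1 := u0K y Ky; have h2 := uhK y Ky.
  have h3 : 0 < 3 * B by rewrite mulr_gt0.
  rewrite -(pmulr_rgt0 _ h3).
  have h4 : 3 * B * uh y <= 3 * B * (2 * B * C) by rewrite ler_wpM2l // ltW.
  have h5 : 3 * B * (2 * B * C) = 6 * B ^+ 2 * C by ring.
  have -> : 3 * B * u1 y = 3 * B * u0 y - 3 * B * uh y + 3 * B * (2 * C) by rewrite /uh; ring.
  have : 0 <= 3 * B * (2 * C) by exact: (mulr_ge0 (ltW h3) (mulr_ge0 _ C0)).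
  by move: CB; lra.
have u1_ge0 x : 0 <= u1 x.
  rewrite -oppr_le0; apply: (solves_le0 Ot (solvesN s1) VL) => y Ky.
  by rewrite oppr_le0 ltW // u1K.
(* without gap the difference u0 - u1 is itself nonnegative with a zero *)
have [ga00|gap] := eqVneq ga 0.
  have CE : C = 0 by rewrite /C ga00 mul0r mulr0 mul0r.
  have lamE : lam1 = lam0 by apply/eqP; rewrite -subr_eq0 -/ga ga00.
  move=> x; apply/le_anti/andP; split; first by have := u10 x; rewrite CE addr0.
  have sd : solves Omega V lam1 (fun x => u0 x - u1 x).
    split; [exact: contB|by move=> y Oy; rewrite u0o // u1o // subrr|].
    move=> y Oy; have := has_lapB (u0l y Oy) (u1l y Oy); rewrite lamE.
    by congr (has_lap _ _ _); ring.
  rewrite -subr_le0; apply: (solves_le0 Ot sd VL) => y Ky.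
  by have := uhK y Ky; rewrite /uh CE !mulr0 addr0.
have gapos : 0 < ga by rewrite lt_def gap.
(* with a gap the largest multiple of u0 below u1 would touch it in the interior *)
have [z Kz zmax] := ratio_max Ot u0c (contN u1c) u0p Ks.
have Oz := inner_sub eps0 Kz.
pose a := u1 z / u0 z; pose eta x := a * u0 x - u1 x.
have etal x : Omega x -> has_lap eta x (a * - (lam0 * V x * u0 x) - - (lam1 * V x * u1 x)).
  by move=> Ox; apply: has_lapB; [apply: has_lapZ; exact: u0l|exact: u1l].
have le0 x : eta x <= 0.
  have := @thin_max _ _ Omega eps Lm 0 eta Ot (lexx 0); rewrite mulr0 mul0r; apply.
  - by apply: contB => //; exact: contZ.
  - by move=> y Oy; rewrite /eta u0o // u1o // mulr0 subrr.
  - by move=> y Ky; have := zmax y Ky; rewrite /eta /a mulNr mulNr; lra.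
  move=> y Oy ey; exists (a * - (lam0 * V y * u0 y) - - (lam1 * V y * u1 y)); first exact: etal.
  have h1 : lam0 * V y * eta y <= Lm * eta y by rewrite ler_wpM2r ?VL0 // ltW.
  have h2 : 0 <= ga * V y * u1 y by have /andP[g1 _] := gV y Oy; rewrite mulr_ge0.
  by move: h1 h2; rewrite /eta /ga; clear; lra.
have ez : eta z = 0 by rewrite /eta /a divfK ?subrr // gt_eqF // u0p.
have := touching le0 ez (etal z Oz).
have h : 0 < ga * V z * u1 z by rewrite mulr_gt0 ?u1K // mulr_gt0 ?V0.
have -> : a * - (lam0 * V z * u0 z) - - (lam1 * V z * u1 z) = ga * V z * u1 z - lam0 * V z * eta z.
  by rewrite /eta /ga; ring.
by rewrite ez mulr0 subr0 leNgt h.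
Qed.

(** Lengths are measured in units of the inner radius r: the quantities e, h, n and B below depend
on v, L0 and N only. *)
Lemma uniform_simplicity (v L0 : R) : (0 < N)%N -> 1 <= v -> 0 <= L0 -> exists2 c, 0 < c &
  forall Omega V r p lam0 lam1 u0 u1,
  open Omega -> supported Omega -> 0 < r -> box p r `<=` Omega -> Omega `<=` box p (v * r) ->
  (forall x, Omega x -> 0 < V x /\ r ^+ 2 * V x <= v) ->
  0 <= lam0 <= L0 -> lam0 <= lam1 <= lam0 + c ->
  solves Omega V lam0 u0 -> (forall x, Omega x -> 0 < u0 x) ->
  solves Omega V lam1 u1 -> exists b, forall x, u1 x = b * u0 x.
Proof.
move=> N0 v1 L00; have [A A1 har] := @harnack_inner R N N0.
have v0 : 0 < v by exact: lt_le_trans v1.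
have NR : 0 < N%:R :> R by rewrite ltr0n.
have [L1 L1E L10] : exists2 t : R, t = (L0 + 1) * v & 0 < t.
  by exists ((L0 + 1) * v) => //; rewrite mulr_gt0 // ltr_wpDl.
have N20 : 0 < 2 * L1 * N%:R ^+ 2 by rewrite !mulr_gt0.
have [e eE] : exists t : R, t = (2 * L1 * N%:R ^+ 2 + 1)^-1 by eexists.
have ed : 1 <= 2 * L1 * N%:R ^+ 2 + 1 by rewrite lerDr ltW.
have e0 : 0 < e by rewrite eE invr_gt0 (lt_le_trans ltr01).
have e1 : e <= 1 by rewrite eE invf_le1 // (lt_le_trans ltr01).
have Le : L1 * (N%:R * e) ^+ 2 <= 2^-1.
  have h : e * (2 * L1 * N%:R ^+ 2 + 1) = 1 by rewrite eE mulVf // gt_eqF // (lt_le_trans ltr01).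
  have -> : L1 * (N%:R * e) ^+ 2 = e * (L1 * N%:R ^+ 2 * e) by ring.
  have h2 : L1 * N%:R ^+ 2 * e <= 2^-1 by move: e0 h; lra.
  apply: le_trans h2; rewrite ler_piMl //.
  by rewrite mulr_ge0 ?(ltW e0) //; move: N20; lra.
pose L2 := L1 + (4 * (N%:R * e) ^+ 2)^-1.
have Ne2 : 0 < (N%:R * e) ^+ 2 by rewrite exprn_gt0 // mulr_gt0.
have L20 : 0 < L2 by rewrite (addr_gt0 L10) // invr_gt0 (mulr_gt0 _ Ne2).
pose h := Num.min (e / 2) (L2 + 1)^-1.
have h0 : 0 < h by rewrite lt_min divr_gt0 //= invr_gt0 ltr_wpDl // ltW.
have he : h < e by rewrite gt_min ltr_pdivrMr // ltr_pMr // ltr1n.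
have L2h : L2 * h ^+ 2 <= 1.
  have L21 : 0 < L2 + 1 by rewrite ltr_wpDl // ltW.
  have r1 : h <= (L2 + 1)^-1 by rewrite ge_min lexx orbT.
  have r2 : h * (L2 + 1) <= 1 by rewrite -ler_pdivlMr // mul1r.
  have r3 : h <= 1 by rewrite (le_trans (ltW he)).
  by rewrite expr2; nra.
(* the number of Harnack steps of length st r which cross a domain of diameter 2 v r *)
pose st := h / (2 * N%:R + 1) / 2.
have st0 : 0 < st by rewrite !divr_gt0 // ltr_wpDl // mulr_ge0.
pose n := (Num.bound (2 * v / st)).+1.
have nst : 2 * v <= n%:R * st.
  rewrite -ler_pdivrMr // ltW // (lt_le_trans (archi_boundP _)) //.
    by rewrite divr_ge0 ?(ltW st0) // mulr_ge0 // ltW.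
  by rewrite ler_nat.
pose B := A ^+ n.
have B1 : 1 <= B by exact: exprn_ege1.
pose D := 6 * B ^+ 2 * (4 * v * (N%:R * e) ^+ 2).
have B0 : 0 < B by exact: lt_le_trans B1.
have D0 : 0 < D.
  have b1 : 0 < 6 * B ^+ 2 by rewrite mulr_gt0 // exprn_gt0.
  have b2 : 0 < 4 * v * (N%:R * e) ^+ 2 by exact: (mulr_gt0 (mulr_gt0 _ v0) Ne2).
  exact: mulr_gt0.
exists (D + 1)^-1; first by rewrite invr_gt0 ltr_wpDl // ltW.
move=> Omega V r p lam0 lam1 u0 u1 Oo Os r0 pO Op VP /andP[lam00 lam0L] /andP[lam01 lam1c] s0 u0p s1.
set c := (D + 1)^-1 in lam1c.
have D1 : 0 < D + 1 by rewrite ltr_wpDl // ltW.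
have c0 : 0 < c by rewrite invr_gt0.
have c1 : c <= 1 by rewrite invf_le1 // lerDr ltW.
have cD : c * D < 1.
  have : c * (D + 1) = 1 by rewrite mulVf // gt_eqF.
  by move: c0; clear; lra.
have lam1L : lam1 <= L0 + 1 by rewrite (le_trans lam1c) // lerD.
have r2 : 0 < r ^+ 2 by rewrite exprn_gt0.
have [u0c u0o u0l] := s0; have [u1c u1o u1l] := s1.
pose Lm := L1 / r ^+ 2; pose eps := e * r.
have eps0 : 0 < eps by rewrite mulr_gt0.
have NeE : (N%:R * eps) ^+ 2 = (N%:R * e) ^+ 2 * r ^+ 2 by rewrite /eps; ring.
have Ot : thin Omega eps Lm.
  split=> //; first by exists p, (v * r).
  split=> //; first by rewrite divr_ge0 // ltW.
  by rewrite NeE /Lm mulrCA divfK ?(gt_eqF r2) // mulrC.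
have VL x : Omega x -> lam1 * V x <= Lm.
  move=> /VP[Vx0 Vx]; rewrite /Lm ler_pdivlMr // -mulrA [V x * _]mulrC L1E.
  by apply: ler_pM => //; [exact: le_trans lam01|rewrite mulr_ge0 // ltW].
have Kp : inner Omega eps p by apply: box_inner pO; rewrite /eps ler_piMl // ltW.
have harB u : continuous u ->
    (forall y, Omega y -> elliptic_at (L2 / r ^+ 2) u y) ->
    forall x y, inner Omega eps x -> inner Omega eps y -> u y <= B * u x.
  move=> uc uP x y Kx Ky; apply: (har Omega u (L2 / r ^+ 2) eps (h * r) x y n) => //.
  - by rewrite mulr_gt0.
  - by rewrite /eps ltr_pM2r.
  - by rewrite divr_ge0 // ltW.
  - by rewrite exprMn mulrCA divfK ?gt_eqF // mulrC.
  have -> : n%:R * (h * r / (2 * N%:R + 1) / 2) = n%:R * st * r.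
    by rewrite /st; field; rewrite gt_eqF // ltr_wpDl // mulr_ge0 // ltW.
  apply: (@box_le _ _ _ (v * r + v * r)).
    by move: (ler_wpM2r (ltW r0) nst); clear; lra.
  apply: (@box_trans _ _ _ _ _ p); last exact: (Op _ (inner_sub eps0 Ky)).
  exact/box_sym/Op/(inner_sub eps0 Kx).
have [xm Om u0max] : exists2 xm, Omega xm & forall x, u0 x <= u0 xm.
  have r00 : 0 <= v * r by rewrite mulr_ge0 // ltW.
  have Op' : Omega p by apply: pO; apply: box_refl; exact: ltW.
  have [xm _ xmax] := EVT_box u0c (@closed_closure _ Omega) (ex_intro _ _ (subset_closure Op'))
    (closure_box r00 Op).
  have up : 0 < u0 xm by rewrite (lt_le_trans (u0p _ Op')) // xmax //; exact: subset_closure.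
  exists xm; first by apply: contrapT => /u0o E; move: up; rewrite E ltxx.
  move=> x; have [Ox|Ox] := pselect (Omega x); first by apply: xmax; exact: subset_closure.
  by rewrite u0o // ltW.
have um := u0p _ Om.
have core w : solves Omega V lam1 w -> (exists2 x, inner Omega eps x & 0 < w x) ->
    exists b, forall x, w x = b * u0 x.
  move=> sw [x1 K1 wx1]; have [wc _ _] := sw.
  have [xs Ks xsmax] := ratio_max Ot u0c wc u0p Kp.
  set b := w xs / u0 xs in xsmax.
  have b0 : 0 < b.
    rewrite ltNge; apply/negP => b0; have := xsmax x1 K1; rewrite leNgt => /negP; apply.
    by rewrite (le_lt_trans _ wx1) // mulr_le0_ge0 // ltW // u0p //; exact: inner_sub K1.
  have us := u0p _ (inner_sub eps0 Ks).
  have vE : v / r ^+ 2 * r ^+ 2 = v by rewrite divfK // gt_eqF.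
  have H := @simplicity_normalised Omega V eps Lm (L2 / r ^+ 2) B (v / r ^+ 2) lam0 lam1
    (fun x => (u0 xm)^-1 * u0 x) (fun x => (b * u0 xm)^-1 * w x) xm xs Ot B1 harB.
  exists b => x; suff : (b * u0 xm)^-1 * w x = (u0 xm)^-1 * u0 x.
    move=> E; have := congr1 (fun t => b * u0 xm * t) E.
    rewrite mulrA divff ?mul1r; last by rewrite mulf_neq0 // gt_eqF.
    by move=> ->; field; rewrite gt_eqF.
  apply: H => //.
  - have E : (4 * ((N%:R * e) ^+ 2 * r ^+ 2))^-1 = (4 * (N%:R * e) ^+ 2)^-1 / r ^+ 2.
      by rewrite mulrA invfM.
    by rewrite NeE E /Lm -mulrDl.
  - by move=> y /VP[y0 yv]; rewrite y0 ler_pdivlMr // mulrC.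
  - by rewrite lam00.
  - rewrite NeE.
    have -> : 6 * B ^+ 2 * (4 * ((lam1 - lam0) * (v / r ^+ 2)) * ((N%:R * e) ^+ 2 * r ^+ 2)) =
       (lam1 - lam0) * D.
      by rewrite /D; move: (gt_eqF r2); move: (r ^+ 2) => t t0; field; rewrite t0.
    by rewrite (le_lt_trans _ cD) // ler_wpM2r ?(ltW D0) // lerBlDl.
  - exact: solvesZ.
  - move=> y Oy; rewrite mulr_gt0 ?invr_gt0 ?u0p //=.
    by rewrite mulrC ler_pdivrMr // mul1r.
  - by rewrite mulVf // gt_eqF.
  - exact: solvesZ.
  - have wE : w xs = b * u0 xs by rewrite /b divfK // gt_eqF.
    by rewrite wE; field; rewrite (gt_eqF b0) (gt_eqF um).
  - move=> y Ky; rewrite invfM -mulrA [_^-1 * w y]mulrC mulrA mulrC.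
    rewrite ler_wpM2l ?invr_ge0 ?(ltW um) // ler_pdivrMl //.
    exact: xsmax.
have [pos|npos] := pselect (exists2 x, inner Omega eps x & 0 < u1 x); first exact: core.
have [neg|nneg] := pselect (exists2 x, inner Omega eps x & 0 < - u1 x).
  have [b bE] := core _ (solvesN s1) neg; exists (- b) => x.
  by rewrite mulNr -bE opprK.
exists 0 => x; rewrite mul0r; apply/le_anti/andP; split.
  by apply: (solves_le0 Ot s1 VL) => y Ky; rewrite leNgt; apply/negP => h1; apply: npos; exists y.
rewrite -oppr_le0; apply: (solves_le0 Ot (solvesN s1) VL) => y Ky.
by rewrite leNgt; apply/negP => h1; apply: nneg; exists y.
Qed.

End GapCore.

(** * Conformal change of the Laplacian *)

Section Conformal.
Context {R : realType} {N : nat}.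
Implicit Types (x y z c p q nu : 'rV[R]_N) (r s t a b B C eps rho L Lm lam g v : R) (i j : 'I_N) (k : nat)
  (u w eta V f : 'rV[R]_N -> R) (Omega : set 'rV[R]_N).

(** Partial derivatives are computed along lines, where one-variable calculus applies. *)
Lemma is_derive_of_line u x i b : is_derive (0 : R) 1 (fun s => u (x + s *: ax i)) b ->
  is_derive x (ax i) u b.
Proof.
move=> du; have E : (fun h : R => h^-1 *: (((fun s => u (x + s *: ax i)) \o shift 0) (h *: 1) - u (x + 0 *: ax i))) =
   (fun h => h^-1 *: ((u \o shift x) (h *: ax i) - u x)).
  by apply/funext => h /=; rewrite [h *: 1]mulr1 addr0 scale0r addr0 [x + _]addrC.
apply: DeriveDef.
  by have := @ex_derive _ _ _ _ _ _ _ du; rewrite /derivable E.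
by have := @derive_val _ _ _ _ _ _ _ du; rewrite /derive E.
Qed.

Lemma partialE u x i b : is_derive x (ax i) u b -> partial i u x = b.
Proof. by move=> du; exact: (@derive_val _ _ _ _ _ _ _ du). Qed.

Lemma class_C_derive k Omega u x i : class_C k.+1 Omega u -> Omega x ->
  is_derive x (ax i) u (partial i u x).
Proof. by move=> [_ ud _] Ox; apply: derivableP; exact: ud. Qed.

Lemma class_CS k Omega u : class_C k.+1 Omega u -> class_C k Omega u.
Proof.
elim: k u => [u [] //|k IH u [uc ud up]].
by split=> // i; exact: IH.
Qed.

Lemma class_C_partial k Omega u i : class_C k.+1 Omega u -> class_C k Omega (partial i u).
Proof. by move=> [_ _ up]; exact: up. Qed.

Lemma class_C_intro k Omega u (du : 'I_N -> 'rV[R]_N -> R) : open Omega ->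
  (forall x, Omega x -> {for x, continuous u}) ->
  (forall i x, Omega x -> is_derive x (ax i) u (du i x)) ->
  (forall i, class_C k Omega (du i)) -> class_C k.+1 Omega u.
Proof.
move=> Oo uc ud duC; split=> // [i x Ox|i].
  by have H := ud i x Ox; exact: (@ex_derive _ _ _ _ _ _ _ H).
by apply: (eq_class_C Oo _ (duC i)) => x Ox; apply/esym/partialE/ud.
Qed.

Lemma class_C_cst k Omega b : open Omega -> class_C k Omega (fun _ => b).
Proof.
move=> Oo; elim: k b => [b x _|k IH b]; first exact: cst_continuous.
have c x : Omega x -> {for x, continuous (fun _ : 'rV[R]_N => b)} by move=> _; exact: cst_continuous.
by apply: (class_C_intro Oo c (du := fun _ _ => 0)) => // i x _; exact: is_derive_cst.
Qed.

Lemma class_C_cont k Omega u x : class_C k Omega u -> Omega x -> {for x, continuous u}.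
Proof. by case: k => [|k] => [uc|[uc _ _]] Ox; exact: uc. Qed.

Lemma class_CD k Omega u w : open Omega -> class_C k Omega u -> class_C k Omega w ->
  class_C k Omega (fun x => u x + w x).
Proof.
move=> Oo; have cD k' u' w' : class_C k' Omega u' -> class_C k' Omega w' ->
    forall x, Omega x -> {for x, continuous (fun x => u' x + w' x)}.
  move=> uC wC x Ox; apply: (@cvgD _ _ _ _ (nbhs_filter x)).
    exact: (class_C_cont uC).
  exact: (class_C_cont wC).
elim: k u w => [u w uC wC|k IH u w uC wC]; first exact: (cD 0%N).
have [_ _ du] := uC; have [_ _ dw] := wC.
apply: (@class_C_intro k Omega _ (fun i x => partial i u x + partial i w x)) => //.
- exact: cD uC wC.
- by move=> i x Ox; apply: is_deriveD; [exact: class_C_derive uC Ox|exact: class_C_derive wC Ox].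
- by move=> i; exact: IH (du i) (dw i).
Qed.

Lemma class_CM_derive k Omega u w x i : class_C k.+1 Omega u -> class_C k.+1 Omega w -> Omega x ->
  is_derive x (ax i) (fun y => u y * w y) (partial i u x * w x + u x * partial i w x).
Proof.
move=> uC wC Ox; have := is_deriveM (class_C_derive i uC Ox) (class_C_derive i wC Ox).
by apply: is_derive_val; rewrite /GRing.scale /=; ring.
Qed.

Lemma class_CM k Omega u w : open Omega -> class_C k Omega u -> class_C k Omega w ->
  class_C k Omega (fun x => u x * w x).
Proof.
move=> Oo; have cM k' u' w' : class_C k' Omega u' -> class_C k' Omega w' ->
    forall x, Omega x -> {for x, continuous (fun x => u' x * w' x)}.
  move=> uC wC x Ox; apply: (@cvgM _ _ _ (nbhs_filter x)).
    exact: (class_C_cont uC).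
  exact: (class_C_cont wC).
elim: k u w => [u w uC wC|k IH u w uC wC]; first exact: (cM 0%N).
have [_ _ du] := uC; have [_ _ dw] := wC.
apply: (@class_C_intro k Omega _ (fun i x => partial i u x * w x + u x * partial i w x)) => //.
- exact: cM uC wC.
- by move=> i x Ox; exact: class_CM_derive uC wC Ox.
- by move=> i; apply: class_CD Oo (IH _ _ (du i) (class_CS wC)) (IH _ _ (class_CS uC) (dw i)).
Qed.

Lemma near_derive Omega u w x i b : open Omega -> Omega x -> (forall y, Omega y -> u y = w y) ->
  is_derive x (ax i) u b -> is_derive x (ax i) w b.
Proof.
move=> Oo Ox uw; apply: near_eq_is_derive.
by apply: filterS uw _; exact: open_nbhs_nbhs.
Qed.

Lemma partial2M Omega u w x i : open Omega -> class_C 2 Omega u -> class_C 2 Omega w -> Omega x ->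
  partial i (partial i (fun y => u y * w y)) x =
    partial i (partial i u) x * w x + 2 * (partial i u x * partial i w x) + u x * partial i (partial i w) x.
Proof.
move=> Oo uC wC Ox.
have du : class_C 1 Omega (partial i u) by exact: class_C_partial.
have dw : class_C 1 Omega (partial i w) by exact: class_C_partial.
apply: partialE.
apply: (@near_derive Omega (fun y => partial i u y * w y + u y * partial i w y) _ x) => //.
  by move=> y Oy; apply/esym/partialE; exact: class_CM_derive uC wC Oy.
have := is_deriveD (class_CM_derive i du (class_CS wC) Ox) (class_CM_derive i (class_CS uC) dw Ox).
apply: is_derive_val; move: (partial i (partial i u) x) (partial i (partial i w) x).
by move: (partial i u x) (partial i w x) => *; ring.
Qed.

Lemma derive_coord x i j : is_derive x (ax j) (fun y : 'rV[R]_N => y 0 i) (i == j)%:R.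
Proof.
apply: is_derive_of_line.
apply: (near_eq_is_derive (f := fun t => x 0 i + (i == j)%:R * t + 0 * t ^+ 2)).
  by apply: filterE => t; rewrite shiftE mul0r addr0 mulrC.
by have := is_derive_quad (x 0 i) (i == j)%:R 0 0; apply: is_derive_val; ring.
Qed.

Lemma class_C_coord k Omega i : open Omega -> class_C k Omega (fun x => x 0 i).
Proof.
move=> Oo; case: k => [x _|k]; first exact: coord_continuous.
apply: (@class_C_intro k Omega _ (fun j _ => (i == j)%:R)) => // [x _|j x _|j].
- exact: coord_continuous.
- exact: derive_coord.
- exact: class_C_cst.
Qed.

Notation cf := (@conformal_factor R N).
Notation ball1 := (@hyperbolic_space R N).

Lemma conformal_factor_gt0 x : ball1 x -> 0 < cf x.
Proof. by move=> x1; rewrite divr_gt0 // subr_gt0. Qed.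

Lemma open_ball1 : open ball1.
Proof.
have -> : ball1 = (fun x => sqnorm (x - 0)) @^-1` [set t | t < 1].
  by apply/seteqP; split=> x /=; rewrite subr0.
by apply: open_comp => [x _|]; [exact: continuous_sqnormB|exact: open_lt].
Qed.

Lemma derive_conformal_factor x i : ball1 x -> is_derive x (ax i) cf (cf x * (cf x * x 0 i)).
Proof.
move=> x1; apply: is_derive_of_line.
pose q t : R := (1 - sqnorm x) + (- (2 * x 0 i)) * t + (-1) * t ^+ 2.
have dq := is_derive_quad (1 - sqnorm x) (- (2 * x 0 i)) (-1) (0 : R).
have qE t : q t = 1 - sqnorm (x + t *: ax i) by rewrite /q sqnorm_shift; ring.
have q0E : q 0 = 1 - sqnorm x by rewrite qE scale0r addr0.
have q0 : q 0 != 0 by rewrite q0E subr_eq0 eq_sym lt_eqF.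
have := is_deriveZ 2 (is_derive_invX 1 q0 dq).
move=> H; apply: (near_eq_is_derive (f := (2 : R) \*: (fun s => (q s)^-1 ^+ 1))).
  by apply: filterE => s; rewrite /conformal_factor -qE.
move: H; apply: is_derive_val; rewrite /GRing.scale /= q0E /conformal_factor.
by field; rewrite subr_eq0 eq_sym lt_eqF.
Qed.

Lemma class_C_conformal_factor k Omega : open Omega -> Omega `<=` ball1 -> class_C k Omega cf.
Proof.
move=> Oo O1; have c x : Omega x -> {for x, continuous cf}.
  move=> Ox; apply: (@cvgM _ _ _ (nbhs_filter x)); first exact: cst_continuous.
  have n0 : 1 - sqnorm x != 0 by rewrite subr_eq0 eq_sym lt_eqF //; exact: O1.
  apply: (@cvgV _ _ _ (nbhs_filter x)) => //.
  apply: (@cvgB _ _ _ _ (nbhs_filter x)); first exact: cst_continuous.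
  have -> : (@sqnorm R N : _ -> R) = (fun y => sqnorm (y - 0)) by apply/funext => y; rewrite subr0.
  exact: continuous_sqnormB.
elim: k => [|k IH]; first by move=> x; exact: c.
apply: (@class_C_intro k Omega _ (fun i x => cf x * (cf x * x 0 i))) => //.
  by move=> i x /O1; exact: derive_conformal_factor.
by move=> i; do 2! apply: class_CM => //; exact: class_C_coord.
Qed.

(** Real powers, because the exponent (N - 2) / 2 is half an integer. *)
Definition conf_pow a x : R := expR (a * ln (cf x)).

Lemma conf_pow_gt0 a x : 0 < conf_pow a x.
Proof. exact: expR_gt0. Qed.

Lemma conf_powN a x : conf_pow (- a) x = (conf_pow a x)^-1.
Proof. by rewrite /conf_pow mulNr expRN. Qed.

Lemma derive_conf_pow a x i : ball1 x ->
  is_derive x (ax i) (conf_pow a) (a * (cf x * x 0 i) * conf_pow a x).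
Proof.
move=> x1; apply: is_derive_of_line; have c0 := conformal_factor_gt0 x1.
have h1 : is_derive (0 : R) 1 (fun s => cf (x + s *: ax i)) (cf x * (cf x * x 0 i)).
  by apply: is_derive_line; rewrite scale0r addr0; exact: derive_conformal_factor.
have c0' : 0 < cf (x + 0 *: ax i) by rewrite scale0r addr0.
have h2 := @is_derive1_comp R (@ln R) (fun s => cf (x + s *: ax i)) 0 _ _ (is_derive1_ln c0') h1.
have h3 := @is_derive1_comp R (@expR R) _ 0 _ _ (is_derive_expR _) (is_deriveZ a h2).
have cx : cf (x + 0 *: ax i) = cf x by rewrite scale0r addr0.
move: h3; apply: is_derive_val; rewrite /= cx /GRing.scale /= [LHS]mulrC; congr (_ * _ * _).
by rewrite mulrA mulVf ?gt_eqF // mul1r.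
Qed.

Lemma class_C_conf_pow k a Omega : open Omega -> Omega `<=` ball1 -> class_C k Omega (conf_pow a).
Proof.
move=> Oo O1; have c x : Omega x -> {for x, continuous (conf_pow a)}.
  move=> Ox; have c0 := conformal_factor_gt0 (O1 _ Ox).
  have h1 : {for x, continuous (fun y => ln (cf y))}.
    apply: (@continuous_comp _ _ _ cf (@ln R)); last exact: continuous_ln.
    exact: (class_C_cont (class_C_conformal_factor 0 Oo O1)).
  apply: (@continuous_comp _ _ _ (fun y => a * ln (cf y)) (@expR R)); last exact: continuous_expR.
  by apply: (@cvgM _ _ _ (nbhs_filter x)); [exact: cst_continuous|exact: h1].
elim: k => [|k IH]; first by move=> x; exact: c.
apply: (@class_C_intro k Omega _ (fun i x => a * (cf x * x 0 i) * conf_pow a x)) => //.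
  by move=> i x /O1; exact: derive_conf_pow.
move=> i; apply: class_CM => //; apply: class_CM => //; first exact: class_C_cst.
by apply: class_CM => //; [exact: class_C_conformal_factor|exact: class_C_coord].
Qed.

Lemma partial2_conf_pow a x i : ball1 x -> partial i (partial i (conf_pow a)) x =
  conf_pow a x * (a * (a + 1) * (cf x * x 0 i) ^+ 2 + a * cf x).
Proof.
move=> x1; apply: partialE.
apply: (@near_derive ball1 (fun y => a * (cf y * y 0 i) * conf_pow a y) _ x) => //.
- exact: open_ball1.
- by move=> y y1; apply/esym/partialE; exact: derive_conf_pow.
have di : is_derive x (ax i) (fun y : 'rV[R]_N => y 0 i) 1.
  by have := derive_coord x i i; rewrite eqxx.
have h1 : is_derive x (ax i) (fun y => a * (cf y * y 0 i)) (a * (cf x + x 0 i * (cf x * (cf x * x 0 i)))).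
  have := is_deriveZ a (is_deriveM (derive_conformal_factor i x1) di).
  by apply: is_derive_val; rewrite /GRing.scale /= mulr1.
have := is_deriveM h1 (derive_conf_pow a i x1).
apply: is_derive_val; rewrite /GRing.scale /=; ring.
Qed.

(** The power of the conformal factor by which multiplication removes the first order terms of the
hyperbolic Laplacian. *)
Definition weight : 'rV[R]_N -> R := conf_pow ((N%:R - 2) / 2).

Lemma weight_gt0 x : 0 < weight x.
Proof. exact: conf_pow_gt0. Qed.

(** The zeroth order term produced by [weight]. *)
Definition conformal_shift : R := N%:R * (N%:R - 2) / 4.

(** With m = (N - 2) / 2 the first order terms of both sides are 2 m rho x . grad u, and the
Laplacian of rho^m is m (m + 1) rho^2 rho^m. *)
Lemma conformal_laplacian Omega u x : (2 <= N)%N -> open Omega -> Omega `<=` ball1 ->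
  class_C 2 Omega u -> Omega x ->
  has_lap (fun y => weight y * u y) x
    (cf x ^+ 2 * weight x * (hlaplacian u x + conformal_shift * u x)).
Proof.
move=> N2 Oo O1 uC Ox; set m := (N%:R - 2) / 2 : R.
have wC := class_C_conf_pow 2 m Oo O1.
have := class_C2_has_lap Oo (class_CM Oo wC uC) Ox; congr (has_lap _ _ _).
have x1 := O1 _ Ox; have c0 := conformal_factor_gt0 x1.
have sE : sqnorm x = 1 - 2 / cf x.
  by rewrite /conformal_factor; field; rewrite subr_eq0 eq_sym lt_eqF // andbT.
have E i : partial i (partial i (fun y => weight y * u y)) x =
   weight x * (m * (m + 1) * cf x ^+ 2 * x 0 i ^+ 2 * u x + m * cf x * u x + 2 * m * cf x * (x 0 i * partial i u x) + partial i (partial i u) x).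
  rewrite /weight (partial2M _ Oo wC uC Ox) partial2_conf_pow // (partialE (derive_conf_pow m i x1)).
  by ring.
have H : hlaplacian u x = cf x ^- 2 * \sum_(i < N) (partial i (partial i u) x + 2 * m * cf x * (x 0 i * partial i u x)).
  rewrite /hlaplacian.
  have -> : \sum_(i < N) partial i (fun y => cf y ^+ (N - 2) * partial i u y) x =
     cf x ^+ (N - 2) * \sum_(i < N) (partial i (partial i u) x + 2 * m * cf x * (x 0 i * partial i u x)).
    rewrite mulr_sumr; apply: eq_bigr => i _; apply: partialE.
    have h1 : is_derive x (ax i) (fun y => cf y ^+ (N - 2)) ((N - 2)%:R * cf x ^+ (N - 2) * (cf x * x 0 i)).
      have -> : (fun y => cf y ^+ (N - 2)) = cf ^+ (N - 2) by apply/funext => y; rewrite exprfctE.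
      have := is_deriveX (N - 2) (derive_conformal_factor i x1).
      apply: is_derive_val; rewrite /GRing.scale /=.
      by case: (N - 2)%N => [|n]; rewrite /= ?exprS; ring.
    have := is_deriveM h1 (class_C_derive i (class_C_partial i uC) Ox).
    apply: is_derive_val; rewrite /GRing.scale /=.
    by have -> : 2 * m = (N - 2)%:R by [rewrite /m natrB //; field]; ring.
  have powE (t : R) n : 0 < t -> (2 <= n)%N -> t ^- n * t ^+ (n - 2) = t ^- 2.
    move=> t0 n2; rewrite -{1}(subnK n2) exprD invfM mulrAC mulVf ?mul1r //.
    by rewrite expf_neq0 // gt_eqF.
  by rewrite mulrA powE.
rewrite H (eq_bigr _ (fun i _ => E i)) -mulr_sumr.
have -> : cf x ^+ 2 * weight x * (cf x ^- 2 * \sum_(i < N) (partial i (partial i u) x + 2 * m * cf x * (x 0 i * partial i u x)) + conformal_shift * u x) =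
  weight x * (\sum_(i < N) (partial i (partial i u) x + 2 * m * cf x * (x 0 i * partial i u x)) + cf x ^+ 2 * (conformal_shift * u x)).
  by field; rewrite gt_eqF.
congr (_ * _).
rewrite (eq_bigr (fun i => (partial i (partial i u) x + 2 * m * cf x * (x 0 i * partial i u x)) +
   (m * (m + 1) * cf x ^+ 2 * u x * x 0 i ^+ 2 + m * cf x * u x))); last by move=> i _; ring.
rewrite big_split /=; congr (_ + _).
rewrite big_split /= -mulr_sumr -/(sqnorm x) sE sumr_const card_ord -mulr_natr /conformal_shift /m.
by field; rewrite gt_eqF.
Qed.

End Conformal.

(** * Hyperbolic and Euclidean eigenfunctions *)

Section Transfer.
Context {R : realType} {N : nat}.
Implicit Types (x y z c p q nu : 'rV[R]_N) (r s t a b B C eps rho L Lm lam mu g v : R) (i j : 'I_N) (k : nat)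
  (u w eta V : 'rV[R]_N -> R) (Omega : set 'rV[R]_N).
Notation cf := (@conformal_factor R N).
Notation ball1 := (@hyperbolic_space R N).

Lemma d2_near (g h : R -> R) a : (\forall t \near (0 : R), g t = h t) -> d2 g a -> d2 h a.
Proof.
move=> gh [g1 [dg dg1]]; exists g1; split => //.
by apply: filterS2 dg (near_join gh) => t dt gt; exact: near_eq_is_derive dt.
Qed.

Lemma has_lap_near Omega u w x a : open Omega -> Omega x -> (forall y, Omega y -> u y = w y) ->
  has_lap u x a -> has_lap w x a.
Proof.
move=> Oo Ox uw [d du ->]; exists d => // i; apply: d2_near (du i).
have /nbhs_boxP[e e0 xe] : nbhs x Omega by exact: open_nbhs_nbhs.
apply/nbhs_ballP; exists e => //= t; rewrite /ball /= sub0r normrN => te.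
apply: uw; apply: xe; rewrite -[e]add0r; apply: box_shift; first exact: box_refl.
exact: ltW.
Qed.

(** Both inequalities are the maximum principle for the constant function u - u. *)
Lemma has_lap_unique u x a b : has_lap u x a -> has_lap u x b -> a = b.
Proof.
have le a' b' : has_lap u x a' -> has_lap u x b' -> a' <= b'.
  move=> ua ub; rewrite -subr_le0; apply: (has_lap_max ltr01 _ (has_lapB ua ub)).
  by move=> y _; rewrite !subrr.
by move=> ua ub; apply/le_anti/andP; split; exact: le.
Qed.

(** A hyperbolic eigenfunction is constrained only on the closure of the domain, and is normalised
here outside. *)
Definition extend Omega u x : R := if `[< Omega x >] then weight x * u x else 0.

Lemma extendE Omega u x : Omega x -> extend Omega u x = weight x * u x.
Proof. by move=> Ox; rewrite /extend asboolT. Qed.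

Lemma extend_out Omega u x : ~ Omega x -> extend Omega u x = 0.
Proof. by move=> Ox; rewrite /extend asboolF. Qed.

Lemma weight_cont x : ball1 x -> {for x, continuous (@weight R N)}.
Proof.
by move=> x1; exact: (class_C_cont (class_C_conf_pow 0 _ (@open_ball1 R N) (@subset_refl _ _)) x1).
Qed.

(** Continuity at a boundary point combines the relative continuity of u on the closure with the
boundary condition. *)
Lemma solves_extend Omega lam u : (2 <= N)%N -> open Omega -> closure Omega `<=` ball1 ->
  dirichlet_solution Omega lam u ->
  solves Omega (fun x => cf x ^+ 2) (lam - @conformal_shift R N) (extend Omega u).
Proof.
move=> N2 Oo O1 [uC uc ul ub]; have O1' : Omega `<=` ball1 by move=> x /subset_closure/O1.
split; last 1 first.
- move=> x Ox; apply: (@has_lap_near Omega (fun y => weight y * u y)) => //.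
    by move=> y Oy; rewrite extendE.
  have := conformal_laplacian N2 Oo O1' uC Ox; congr (has_lap _ _ _).
  by rewrite extendE // -[hlaplacian u x]opprK ul //; ring.
- move=> x; have [Ox|Ox] := pselect (Omega x).
    have c1 : {for x, continuous (fun y => weight y * u y)}.
      apply: (@cvgM _ _ _ (nbhs_filter x)); first exact/weight_cont/O1'.
      exact: (class_C_cont uC).
    apply/continuous_boxP => e e0; have /continuous_boxP/(_ e e0)[d d0 dP] := c1.
    have /nbhs_boxP[d' d'0 xd] : nbhs x Omega by exact: open_nbhs_nbhs.
    exists (Num.min d d'); first by rewrite lt_min d0.
    move=> y xy; rewrite !extendE //; first apply: dP.
      by apply: box_le xy; rewrite ge_min lexx.
    by apply: xd; apply: box_le xy; rewrite ge_min lexx orbT.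
  have [Cx|Cx] := pselect (closure Omega x); last first.
    apply/continuous_boxP => e e0.
    have oC : nbhs x (~` closure Omega).
      by apply: open_nbhs_nbhs; split=> //; apply: closed_openC; exact: closed_closure.
    have /nbhs_boxP[d d0 dP] := oC; exists d => // y /dP yC.
    by rewrite !extend_out ?subrr ?normr0 ?ltW // => /subset_closure.
  have ux : u x = 0.
    apply: ub; split; first exact: O1.
    by split=> //; move/interior_subset.
  have /subspace_continuousP/(_ x (conj (O1 _ Cx) Cx)) uc' := uc.
  have wc' : weight y @[y --> within (ball1 `&` closure Omega) (nbhs x)] --> (weight x : R).
    by apply: cvg_within_filter; apply: weight_cont; exact: O1.
  have : weight y * u y @[y --> within (ball1 `&` closure Omega) (nbhs x)] --> weight x * u x.
    exact: (@cvgM _ _ _ (within_filter _ (nbhs_filter x)) _ _ _ _ wc' uc').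
  rewrite ux mulr0 => /cvgrPdist_le wu.
  apply/continuous_boxP => e e0; have := wu e e0; rewrite near_withinE => /nbhs_boxP[d d0 dP].
  exists d => // y /dP; rewrite [extend _ _ x]extend_out // subr0 sub0r normrN /= => H.
  have [Oy|Oy] := pselect (Omega y); last by rewrite extend_out // normr0 ltW.
  by rewrite extendE //; apply: H; split; [exact: O1'|exact: subset_closure].
- by move=> x; exact: extend_out.
Qed.

Lemma solution_dirichlet Omega mu w : (2 <= N)%N -> open Omega -> closure Omega `<=` ball1 ->
  solves Omega (fun x => cf x ^+ 2) mu w -> class_C 2 Omega w ->
  dirichlet_solution Omega (mu + @conformal_shift R N) (fun x => (weight x)^-1 * w x).
Proof.
move=> N2 Oo O1 [wc w0 wl] wC; have O1' : Omega `<=` ball1 by move=> x /subset_closure/O1.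
set u := fun x => _; have uE : u = (fun x => conf_pow (- ((N%:R - 2) / 2)) x * w x).
  by apply/funext => x; rewrite conf_powN.
have uC : class_C 2 Omega u by rewrite uE; exact: (class_CM Oo (class_C_conf_pow 2 _ Oo O1') wC).
have wE : (fun x => weight x * u x) = w.
  by apply/funext => x; rewrite mulrA divff ?mul1r // gt_eqF // weight_gt0.
split=> //.
- apply: continuous_in_subspaceT => x; rewrite inE => -[x1 _].
  rewrite uE; apply: (@cvgM _ _ _ (nbhs_filter x)); last exact: wc.
  exact: (class_C_cont (class_C_conf_pow 0 _ (@open_ball1 R N) (@subset_refl _ _)) x1).
- move=> x Ox; have := conformal_laplacian N2 Oo O1' uC Ox; rewrite wE => wl'.
  have := has_lap_unique wl' (wl x Ox).
  have -> : w x = weight x * u x by rewrite -[in LHS]wE.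
  have c0 : cf x != 0 by rewrite gt_eqF //; exact/conformal_factor_gt0/O1'.
  have s0 : weight x != 0 by rewrite gt_eqF // weight_gt0.
  have -> : - (mu * cf x ^+ 2 * (weight x * u x)) = cf x ^+ 2 * weight x * (- (mu * u x)) by ring.
  move/mulfI => /(_ (mulf_neq0 (expf_neq0 2 c0) s0)) H.
  have -> : hlaplacian u x = - (mu * u x) - @conformal_shift R N * u x by rewrite -H; ring.
  by ring.
- move=> x [_ [_ xi]]; rewrite /u w0 ?mulr0 // => Ox; apply: xi.
  by move/interior_id: Oo => ->.
Qed.

Lemma lbdk_gridp k Omega i : lbdk k Omega (fun n x => gridp (mesh n : R) x 0 i).
Proof.
have b : lbd Omega (fun n x => gridp (mesh n : R) x 0 i).
  move=> x _; exists 1, (`|x 0 i| + 2); split => //.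
  have m1 := @near_mesh R 1 ltr01; apply: filterS m1 => n m1 y xy.
  have h1 := gridp_box y (@mesh_gt0 R n) i; have h2 := xy i.
  have -> : gridp (mesh n) y 0 i = x 0 i + ((y 0 i - x 0 i) + (gridp (mesh n) y 0 i - y 0 i)) by ring.
  rewrite (le_trans (ler_normD _ _)) // lerD2l (le_trans (ler_normD _ _)) //.
  by rewrite -[2]/(1 + 1) lerD // (le_trans h1).
case: k => [|k]; first by split.
apply/lbdkSP; split=> // j.
have -> : dq j (fun n x => gridp (mesh n : R) x 0 i) = (fun _ _ => (i == j)%:R).
  apply/funext => n; apply/funext => x; have m0 := @mesh_gt0 R n.
  by rewrite /dq gridp_shift1 // shiftE addrC addKr mulrAC divff ?mul1r // gt_eqF.
by apply: (@lbdk_cst _ _ _ _ _ `|(i == j)%:R|) => n.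
Qed.

Lemma lbdk_sum k Omega (l : seq 'I_N) (f : 'I_N -> nat -> 'rV[R]_N -> R) :
  (forall i, lbdk k Omega (f i)) -> lbdk k Omega (fun n x => \sum_(i <- l) f i n x).
Proof.
move=> fk; elim: l => [|i l IH].
  under eq_fun do under eq_fun do rewrite big_nil.
  by apply: (@lbdk_cst _ _ _ _ _ 0) => n; rewrite normr0.
under eq_fun do under eq_fun do rewrite big_cons.
exact: lbdkD.
Qed.

(** The lattice version of smoothness for the coefficient rho^2: coordinates have constant
differences, and sums, products and inverses preserve the bounds. *)
Lemma lbdk_conformal_factor k Omega : open Omega -> Omega `<=` ball1 ->
  lbdk k Omega (fun n x => cf (gridp (mesh n) x) ^+ 2).
Proof.
move=> Oo O1; pose f n x := 1 + -1 * \sum_(i < N) fmul (fun n x => gridp (mesh n : R) x 0 i) (fun n x => gridp (mesh n : R) x 0 i) n x.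
have fE n x : f n x = 1 - sqnorm (gridp (mesh n) x).
  by rewrite /f mulN1r; congr (1 - _); apply: eq_bigr => i _; rewrite /fmul expr2.
have F : lbdk k Omega f.
  apply: lbdkD; first by apply: (@lbdk_cst _ _ _ _ _ `|1|) => n.
  apply: (@lbdkM _ _ _ _ (fun _ _ => -1)); first by apply: (@lbdk_cst _ _ _ _ _ `|-1|) => n.
  by apply: lbdk_sum => i; apply: lbdkM; exact: lbdk_gridp.
have FV : lbdk k Omega (fun n x => (f n x)^-1).
  apply: lbdkV F => x Ox; have x1 : 0 < 1 - sqnorm x by rewrite subr_gt0; exact: O1.
  have sc : continuous (fun y : 'rV[R]_N => sqnorm (y - 0)) by exact: continuous_sqnormB.
  have := sc x => /continuous_boxP/(_ _ (divr_gt0 x1 (ltr0n R 2)))[d d0 dP].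
  exists (d / 2), ((1 - sqnorm x) / 2); split; rewrite ?divr_gt0 //.
  have md := near_mesh (divr_gt0 d0 (ltr0n R 2)); apply: filterS md => n md y xy.
  have := dP (gridp (mesh n) y); rewrite !subr0 fE => H.
  have {}H : `|sqnorm (gridp (mesh n) y) - sqnorm x| <= (1 - sqnorm x) / 2.
    apply: H; rewrite [d]splitr; apply: box_trans xy _.
    by apply: box_le (gridp_box y (mesh_gt0 n)).
  by move: H; rewrite ler_norml; lra.
have := lbdkM (@lbdk_cst R N k Omega (fun _ => 4) `|4| (fun=> lexx _)) (lbdkM FV FV).
congr (lbdk _ _ _); apply/funext => n; apply/funext => x.
by rewrite /fmul /conformal_factor -fE expr2; ring.
Qed.

End Transfer.

(** * Horoballs and horoconvex domains *)

Section Geometry.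
Context {R : realType} {N : nat}.
Implicit Types (x y z c p q m nu xi : 'rV[R]_N) (r s t a b T D : R) (i j : 'I_N) (k : nat)
  (Omega : set 'rV[R]_N).
Notation ball1 := (@hyperbolic_space R N).
Notation del x := (1 - sqnorm x).

Lemma arcosh_le (z D : R) : 1 <= z -> arcosh z <= D -> z <= expR D.
Proof.
move=> z1; rewrite /arcosh => zD; have s0 := sqrtr_ge0 (z ^+ 2 - 1).
have p0 : 0 < z + Num.sqrt (z ^+ 2 - 1) by lra.
move: zD; rewrite -ler_expR lnK ?posrE //; apply: le_trans; lra.
Qed.

Lemma le_arcosh (s : R) : 1 <= s -> arcosh ((s + s^-1) / 2) <= ln s.
Proof.
move=> s1; have s0 : 0 < s by lra.
have si : s^-1 <= s by rewrite (le_trans _ s1) // invf_le1.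
rewrite /arcosh (_ : ((s + s^-1) / 2) ^+ 2 - 1 = ((s - s^-1) / 2) ^+ 2); last first.
  by field; rewrite gt_eqF.
rewrite sqrtr_sqr ger0_norm ?divr_ge0 ?subr_ge0 //.
by rewrite [X in ln X](_ : _ = s) //; field; rewrite gt_eqF.
Qed.

Lemma arcosh_mono (z z' : R) : 1 <= z -> z <= z' -> arcosh z <= arcosh z'.
Proof.
move=> z1 zz'; rewrite /arcosh ler_ln ?posrE; last 2 first.
- by have := sqrtr_ge0 (z ^+ 2 - 1); lra.
- by have := sqrtr_ge0 (z' ^+ 2 - 1); lra.
by apply: lerD => //; apply: ler_wsqrtr; rewrite lerD2r lerXn2r ?nnegrE //; lra.
Qed.

Lemma del_gt0 x : ball1 x -> 0 < del x.
Proof. by move=> x1; rewrite subr_gt0. Qed.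

Lemma del_le1 x : del x <= 1.
Proof. by rewrite gerBl sqnorm_ge0. Qed.

Lemma hdist_le x y D : ball1 x -> ball1 y -> hdist x y <= D ->
  sqnorm (x - y) <= expR D * (del x * del y).
Proof.
move=> x1 y1 /arcosh_le H; have dd : 0 < del x * del y by rewrite mulr_gt0 ?del_gt0.
have Q0 : 0 <= sqnorm (x - y) / (del x * del y) by rewrite divr_ge0 ?sqnorm_ge0 // ltW.
rewrite -ler_pdivrMr //; move: H; rewrite -mulrA => /(_ (ltac:(lra))); lra.
Qed.

(** The lower bound is the value at distance D / 2 of the squared chord: cosh (D / 2) = 1 + 2 Q.
*)
Lemma hdist_gt x y D : 0 < D -> ball1 x -> ball1 y -> D / 2 < hdist x y ->
  ((expR (D / 2) + (expR (D / 2))^-1) / 2 - 1) / 2 * (del x * del y) < sqnorm (x - y).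
Proof.
move=> D0 x1 y1 H; have dd : 0 < del x * del y by rewrite mulr_gt0 ?del_gt0.
have s1 : 1 <= expR (D / 2) by rewrite ltW // expR_gt1 divr_gt0.
rewrite -ltr_pdivlMr // ltNge; apply/negP => Q1; move: H; rewrite ltNge => /negP; apply.
rewrite -[leRHS]expRK; apply: le_trans (le_arcosh s1); rewrite /hdist -mulrA.
have Q0 : 0 <= sqnorm (x - y) / (del x * del y) by rewrite divr_ge0 ?sqnorm_ge0 // ltW.
by apply: arcosh_mono; lra.
Qed.

(** The difference of 1 - |x|^2 and 1 - |y|^2 is at most twice the Euclidean distance, whose
square is bounded by q times their product. *)
Lemma del_ratio x y (q : R) : ball1 x -> ball1 y -> 0 <= q ->
  sqnorm (x - y) <= q * (del x * del y) -> del x <= (4 * q + 2) * del y.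
Proof.
move=> x1 y1 q0 xy; have dx := del_gt0 x1; have dy := del_gt0 y1.
have E : del y - del x = dot (x - y) (x + y).
  by rewrite dotBl !dotDr !sqnorm_dot (dotC y x); ring.
have h1 := CauchySchwarz_dot (x - y) (x + y).
have h2 : sqnorm (x + y) <= 4.
  have := sqnorm_ge0 (x - y); rewrite sqnormB sqnormD; have := dx; have := dy; lra.
have h3 : (del y - del x) ^+ 2 <= 4 * q * (del x * del y).
  rewrite E (le_trans h1) // (le_trans (ler_wpM2l (sqnorm_ge0 _) h2)) //; lra.
move: (del x) (del y) dx dy h3 => a b a0 b0 h3.
have h4 : a * a <= a * ((4 * q + 2) * b) by have := sqr_ge0 b; rewrite !expr2 in h3 *; lra.
by rewrite -(ler_pM2l a0).
Qed.

(** Horoballs are the sublevel sets of |z - xi|^2 / (1 - |z|^2). *)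
Lemma horoballE xi r z : sqnorm xi = 1 ->
  horoball xi r z <-> sqnorm (z - xi) * (1 - r) < r * del z.
Proof.
move=> xi1; rewrite /horoball /= !sqnormB sqnormZ dotZr xi1.
by split; rewrite -subr_gt0 => H; rewrite -subr_gt0; move: H; congr (0 < _); ring.
Qed.

Lemma horoball_convex xi r x z s : 0 <= s <= 1 -> horoball xi r x -> horoball xi r z ->
  horoball xi r (x + s *: (z - x)).
Proof.
move=> /andP[s0 s1]; rewrite /horoball /=; set c := (1 - r) *: xi.
have -> : x + s *: (z - x) - c = (x - c) + s *: (z - x) by rewrite addrAC.
have -> : z - c = (x - c) + (z - x) by apply/rowP => i; rewrite !mxE; ring.
move: (x - c) (z - x) => X V; rewrite !sqnormD sqnormZ dotZr; have := sqnorm_ge0 V.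
move: (sqnorm X) (dot X V) (sqnorm V) (r ^+ 2) => X2 d v rr v0 h1 h2.
have ss : s ^+ 2 * v <= s * v by rewrite ler_wpM2r // expr2 ler_piMl.
have [e0|e0] := leP (2 * d + v) 0.
  have : s * (2 * d + v) <= 0 by rewrite mulr_ge0_le0.
  by lra.
have : s * (2 * d + v) <= 2 * d + v by rewrite ler_piMl // ltW.
by lra.
Qed.

(** In the hyperboloid model the sublevel function of [horoballE] is linear, and the midpoint is
the sum of the two points divided by its Lorentz norm 2 T. So the value at the midpoint is the
mean of the two values divided by T, with T = cosh of half the distance. *)
Lemma midpoint x y T : ball1 x -> ball1 y -> 0 < T ->
  T ^+ 2 = 1 + sqnorm (x - y) / (del x * del y) ->
  exists2 m, ball1 m & forall xi r, sqnorm xi = 1 -> 0 < r < 1 ->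
    horoball xi r x -> horoball xi r y -> sqnorm (m - xi) * (1 - r) * T < r * del m.
Proof.
move=> x1 y1 T0 TE; have dx := del_gt0 x1; have dy := del_gt0 y1.
pose a := (del x)^-1; pose b := (del y)^-1.
have a1 : 1 <= a by rewrite invf_ge1 // del_le1.
have b1 : 1 <= b by rewrite invf_ge1 // del_le1.
(* v and w are half of the space and time components of the sum of the two points *)
pose w := a + b - 1; have w1 : 1 <= w by rewrite /w; lra.
have wT : 0 < w + T by lra.
pose v := a *: x + b *: y.
have sx : a * sqnorm x = a - 1 by rewrite /a; field; rewrite gt_eqF.
have sy : b * sqnorm y = b - 1 by rewrite /b; field; rewrite gt_eqF.
have vE : sqnorm v = w ^+ 2 - T ^+ 2.
  rewrite TE invfM -/a -/b sqnormB /v sqnormD !sqnormZ dotZr dotZl /w.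
  have -> : a ^+ 2 * sqnorm x = a * (a - 1) by rewrite -sx; ring.
  have -> : b ^+ 2 * sqnorm y = b * (b - 1) by rewrite -sy; ring.
  have -> : (sqnorm x - 2 * dot x y + sqnorm y) * (a * b) =
    b * (a - 1) - 2 * (dot x y * a * b) + a * (b - 1) by rewrite -sx -sy; ring.
  by ring.
pose m := (w + T)^-1 *: v.
have mE : sqnorm m = (w - T) / (w + T).
  by rewrite sqnormZ vE; field; rewrite gt_eqF.
have dm : del m = 2 * T / (w + T) by rewrite mE; field; rewrite gt_eqF.
exists m; first by rewrite /hyperbolic_space /= -subr_gt0 dm divr_gt0 // mulr_gt0.
move=> xi r xi1 /andP[r0 r1] /(horoballE _ _ xi1) hx /(horoballE _ _ xi1) hy.
have mxi : sqnorm (m - xi) * (w + T) = a * sqnorm (x - xi) + b * sqnorm (y - xi).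
  rewrite !sqnormB mE xi1 /m dotZl /v dotDl !dotZl.
  have -> : a * (sqnorm x - 2 * dot x xi + 1) = 2 * a - 1 - 2 * (a * dot x xi).
    by rewrite mulrDr mulrBr sx; ring.
  have -> : b * (sqnorm y - 2 * dot y xi + 1) = 2 * b - 1 - 2 * (b * dot y xi).
    by rewrite mulrDr mulrBr sy; ring.
  move: (a * dot x xi) (b * dot y xi) => X Y.
  rewrite (_ : 2 * a - 1 - 2 * X + (2 * b - 1 - 2 * Y) = 2 * w - 2 * (X + Y)); last by rewrite /w; ring.
  by field; rewrite gt_eqF.
have hx' : a * sqnorm (x - xi) * (1 - r) < r.
  by rewrite -mulrA mulrC -ltr_pdivlMr ?invr_gt0 // invrK.
have hy' : b * sqnorm (y - xi) * (1 - r) < r.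
  by rewrite -mulrA mulrC -ltr_pdivlMr ?invr_gt0 // invrK.
rewrite dm mulrA ltr_pdivlMr //.
have -> : sqnorm (m - xi) * (1 - r) * T * (w + T) = (sqnorm (m - xi) * (w + T)) * (1 - r) * T by ring.
rewrite mxi mulrDl [r * _]mulrA ltr_pM2r //; lra.
Qed.

(** Moving from m by a fraction r0 of 1 - |m|^2 changes |z - xi|^2 and 1 - |z|^2 by factors close
to 1, because the distance from m to the unit sphere is at least (1 - |m|^2) / 2; the gain T of
the midpoint pays for it. *)
Lemma near_midpoint m z xi r T r0 : ball1 m -> sqnorm xi = 1 -> 0 < r < 1 ->
  sqnorm (m - xi) * (1 - r) * T < r * del m -> 0 < r0 <= 8^-1 ->
  1 + 5 * r0 <= T * (1 - 3 * r0) -> sqnorm (z - m) <= (r0 * del m) ^+ 2 -> horoball xi r z.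
Proof.
move=> m1 xi1 /andP[rp r1] mT /andP[r00 r08] Tr zm; apply/(horoballE _ _ xi1).
have d0 := del_gt0 m1; have d1 := del_le1 m.
have A0 := sqnorm_ge0 (m - xi).
have dA : del m ^+ 2 <= 4 * sqnorm (m - xi).
  have E : del m = - dot (m - xi) (m + xi).
    by rewrite dotBl !dotDr -!sqnorm_dot (dotC xi m) xi1; ring.
  rewrite E sqrrN (le_trans (CauchySchwarz_dot _ _)) // mulrC ler_wpM2r //.
  have := A0; rewrite sqnormB sqnormD xi1; move: d0; lra.
set A := sqnorm (m - xi) in mT A0 dA; set d := del m in mT d0 d1 dA zm.
have B0 := sqnorm_ge0 (z - m); set B := sqnorm (z - m) in zm B0.
have BA : B <= 4 * r0 ^+ 2 * A.
  rewrite (le_trans zm) // exprMn.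
  by have := ler_wpM2l (sqr_ge0 r0) dA; lra.
have zA : sqnorm (z - xi) <= A * (1 + 5 * r0).
  have -> : z - xi = (z - m) + (m - xi) by rewrite addrA subrK.
  have dAB : dot (z - m) (m - xi) <= 2 * r0 * A.
    have h : dot (z - m) (m - xi) ^+ 2 <= (2 * r0 * A) ^+ 2.
      rewrite (le_trans (CauchySchwarz_dot _ _)) // -/A -/B.
      have -> : (2 * r0 * A) ^+ 2 = (4 * r0 ^+ 2 * A) * A by ring.
      by rewrite ler_wpM2r.
    have p0 : 0 <= 2 * r0 * A by rewrite mulr_ge0 // mulr_ge0 // ltW.
    by rewrite (le_trans (ler_norm _)) // -(ler_pXn2r (ltn0Sn 1)) ?nnegrE // real_normK ?num_real.
  rewrite sqnormD -/A -/B.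
  have r2 : 4 * r0 ^+ 2 * A <= r0 * A / 2.
    have -> : 4 * r0 ^+ 2 * A = 4 * r0 * (r0 * A) by ring.
    have ra : 0 <= r0 * A by rewrite mulr_ge0 // ltW.
    have r4 : 4 * r0 <= 2^-1 by lra.
    by have := ler_wpM2r ra r4; lra.
  by lra.
have zd : d * (1 - 3 * r0) <= del z.
  have -> : sqnorm z = sqnorm m + 2 * dot m (z - m) + B.
    by rewrite -sqnormD addrC subrK.
  have h : dot m (z - m) ^+ 2 <= (r0 * d) ^+ 2.
    rewrite (le_trans (CauchySchwarz_dot _ _)) // (le_trans _ zm) // ler_piMl //.
    by move: d0; rewrite /d; lra.
  have p0 : 0 <= r0 * d by rewrite mulr_ge0 // ltW.
  have h' : dot m (z - m) <= r0 * d.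
    by rewrite (le_trans (ler_norm _)) // -(ler_pXn2r (ltn0Sn 1)) ?nnegrE // real_normK ?num_real.
  have Bd : B <= r0 * d.
    rewrite (le_trans zm) // expr2 ler_piMl //.
    by rewrite (le_trans (ler_wpM2r (ltW d0) r08)) // mulrC; move: d1; clear; lra.
  by rewrite /d in h' Bd p0 *; lra.
have q0 : 0 <= A * (1 - r) by rewrite mulr_ge0 // subr_ge0 ltW.
apply: (@le_lt_trans _ _ (A * (1 - r) * (1 + 5 * r0))).
  by rewrite mulrAC ler_wpM2r // subr_ge0 ltW.
apply: (@le_lt_trans _ _ (A * (1 - r) * (T * (1 - 3 * r0)))); first by rewrite ler_wpM2l.
apply: (@lt_le_trans _ _ (r * d * (1 - 3 * r0))).
  by rewrite mulrA ltr_pM2r //; lra.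
by rewrite -mulrA ler_wpM2l // ltW.
Qed.

(** If z were outside, a horoball touching at the point where a segment from x to z leaves the
domain would contain both ends, hence, being convex, that boundary point. *)
Lemma horoconvex_inter Omega x z : open Omega -> closure Omega `<=` ball1 -> horoconvex Omega ->
  Omega x -> (forall xi r, sqnorm xi = 1 -> 0 < r < 1 -> Omega `<=` horoball xi r -> horoball xi r z) ->
  Omega z.
Proof.
move=> Oo O1 Oh Ox zH; apply: contrapT => Oz.
have [s s01 [cp np]] := exit_point Oo Ox Oz; set p := x + _ in cp np.
have [|xi [r [xi1 r01 [p1 pr] Or]]] := Oh p.
  by split; [exact: O1|split=> // /interior_subset].
have := horoball_convex s01 (Or _ Ox) (zH xi r xi1 r01 Or); rewrite -/p /horoball /= pr.
by rewrite ltxx.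
Qed.

(** The supporting hyperplane is tangent to the horosphere, a Euclidean sphere. *)
Lemma horoconvex_supported Omega : open Omega -> closure Omega `<=` ball1 -> horoconvex Omega ->
  supported Omega.
Proof.
move=> Oo O1 Oh q cq nq.
have [|xi [r [xi1 /andP[r0 r1] [_ /= qr] Or]]] := Oh q.
  by split; [exact: O1|split=> // /interior_subset].
set c := (1 - r) *: xi in qr; exists (r^-1 *: (c - q)); split.
  by rewrite sqnormZ sqnormBC qr -exprMn mulVf ?expr1n // gt_eqF.
move=> x /Or; rewrite /horoball /= -/c => xr.
rewrite dotZl mulr_gt0 ?invr_gt0 //.
have xE : x - c = (x - q) + (q - c) by rewrite addrA subrK.
have -> : c - q = - (q - c) by rewrite opprB.
move: xr; rewrite xE; move: qr; move: (x - q) (q - c) => X Y qr.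
rewrite sqnormD qr [dot (- _) _]dotC dotNr => h.
by have := sqnorm_ge0 X; move: h; lra.
Qed.

End Geometry.

(** * The lower bound for the gap *)

Section Assembly.
Context {R : realType} {N : nat}.
Implicit Types (x y z p : 'rV[R]_N) (D : R) (Omega : set 'rV[R]_N).
Notation ball1 := (@hyperbolic_space R N).
Notation del x := (1 - sqnorm x).
Notation cf := (@conformal_factor R N).

(** The centre p is the midpoint of two points at distance more than half the diameter, and sizes
are measured by 1 - |p|^2, the Euclidean scale of a hyperbolic unit length at p. *)
Lemma horoconvex_size D : 0 < D -> exists k K : R, [/\ 0 < k, 0 < K &
  forall Omega, domain Omega -> horoconvex Omega -> hdiameter Omega = D%:E ->
  [/\ closure Omega `<=` ball1, supported Omega & exists p, [/\ Omega p,
    forall z, sqnorm (z - p) <= (k * del p) ^+ 2 -> Omega z &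
    forall z, Omega z -> [/\ sqnorm (z - p) <= K * del p ^+ 2, del z <= K * del p & del p <= K * del z]]]].
Proof.
(* q bounds the squared chord from above, q1 that of the two chosen points from below *)
move=> D0; pose q := expR D; have q0 : 0 < q by exact: expR_gt0.
have [q1 q1E q10] : exists2 q1 : R, q1 = ((expR (D / 2) + (expR (D / 2))^-1) / 2 - 1) / 2 & 0 < q1.
  eexists; first by []; set s := expR _; have s1 : 1 < s by rewrite expR_gt1 divr_gt0.
  have s0 : 0 < s by lra.
  have -> : ((s + s^-1) / 2 - 1) / 2 = (s - 1) ^+ 2 / (4 * s) by field; rewrite gt_eqF.
  by rewrite divr_gt0 ?exprn_gt0 ?subr_gt0 // mulr_gt0.
pose S := Num.sqrt (1 + q1).
have S1 : 1 < S by rewrite -[X in X < _]sqrtr1 ltr_sqrt; lra.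
have S53 : 0 < 5 + 3 * S by lra.
pose k := Num.min 8^-1 ((S - 1) / (5 + 3 * S)).
have k0 : 0 < k by rewrite lt_min invr_gt0 ltr0n /= divr_gt0 // subr_gt0.
have k8 : k <= 8^-1 by rewrite ge_min lexx.
have kS : k * (5 + 3 * S) <= S - 1 by rewrite -ler_pdivlMr // ge_min lexx orbT.
pose K := (q + 1) * (4 * q + 2).
have qK : q * (4 * q + 2) <= K by rewrite /K; lra.
have qK1 : 4 * q + 2 <= K by have := mulr_ge0 (ltW q0) (ltW q0); rewrite /K; lra.
exists k, K; split=> //; first by rewrite (lt_le_trans _ qK1) // ltr_wpDl // mulr_ge0 // ltW.
move=> Omega [nO O1 Oo _] Oh OD.
have dist x y : Omega x -> Omega y -> hdist x y <= D.
  move=> Ox Oy; rewrite -lee_fin -OD; have /ereal_supP := lexx (hdiameter Omega); apply.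
  by exists (x, y).
have rat x y : Omega x -> Omega y -> sqnorm (x - y) <= q * (del x * del y).
  by move=> Ox Oy; apply: hdist_le; [exact: O1|exact: O1|exact: dist].
have dr x y : Omega x -> Omega y -> del x <= (4 * q + 2) * del y.
  by move=> Ox Oy; apply: del_ratio; [exact: O1|exact: O1|exact: ltW|exact: rat].
have K20 : 0 < 4 * q + 2 by lra.
have cO1 : closure Omega `<=` ball1.
  have [x0 Ox0] := nO; have d0 := del_gt0 (O1 _ Ox0).
  have : Omega `<=` [set y | sqnorm (y - 0) <= 1 - del x0 / (4 * q + 2)].
    move=> y Oy /=; have := dr x0 y Ox0 Oy; rewrite mulrC -ler_pdivrMr // subr0; lra.
  move=> /closureS; set A := [set y | _]; have Ac : closed A.
    by apply: (closed_comp (f := fun y => sqnorm (y - 0)) (D := [set z | z <= 1 - del x0 / (4 * q + 2)]));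
      [move=> y _; exact: continuous_sqnormB|exact: closed_le].
  rewrite -(closure_id A).1 // => OA y /OA; rewrite /A /= subr0 /hyperbolic_space /=.
  by move=> /le_lt_trans; apply; rewrite gtrBl divr_gt0.
split=> //; first exact: horoconvex_supported.
have [x [y [Ox Oy xy]]] : exists x y, [/\ Omega x, Omega y & D / 2 < hdist x y].
  apply: contrapT => H; have : (hdiameter Omega <= (D / 2)%:E)%E.
    apply/ereal_supP => _ [[x y] [/= Ox Oy] <-]; rewrite lee_fin leNgt; apply/negP => xy.
    by apply: H; exists x, y.
  by rewrite OD lee_fin; move: D0; lra.
have dd : 0 < del x * del y by rewrite mulr_gt0 ?del_gt0 //; exact: O1.
pose T := Num.sqrt (1 + sqnorm (x - y) / (del x * del y)).
have TQ : q1 <= sqnorm (x - y) / (del x * del y).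
  by rewrite q1E ler_pdivlMr // ltW // hdist_gt //; exact: O1.
have ST : S <= T by apply: ler_wsqrtr; lra.
have T0 : 0 < T by lra.
have TE : T ^+ 2 = 1 + sqnorm (x - y) / (del x * del y) by rewrite sqr_sqrtr //; lra.
have [m m1 mH] := midpoint (O1 _ Ox) (O1 _ Oy) T0 TE.
have kT : 1 + 5 * k <= T * (1 - 3 * k).
  have : 0 <= (T - S) * (1 - 3 * k) by rewrite mulr_ge0 //; move: ST k8; clear; lra.
  by move: kS; clear; lra.
have mb z : sqnorm (z - m) <= (k * del m) ^+ 2 -> Omega z.
  move=> zm; apply: (horoconvex_inter Oo cO1 Oh Ox) => xi r xi1 r01 Or.
  apply: (near_midpoint m1 xi1 r01 (mH _ _ xi1 r01 (Or _ Ox) (Or _ Oy)) _ kT zm).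
  by rewrite k0.
have Om : Omega m by apply: mb; rewrite subrr sqnorm0 sqr_ge0.
exists m; split=> // z Oz; have dm := del_gt0 m1; have dz := del_gt0 (O1 _ Oz); split.
- apply: (le_trans (rat _ _ Oz Om)).
  have h := ler_wpM2r (ltW dm) (dr _ _ Oz Om).
  have h2 := ler_wpM2l (ltW q0) h.
  have h3 := ler_wpM2r (sqr_ge0 (del m)) qK.
  by rewrite expr2 in h3; move: h2 h3; rewrite expr2; clear; lra.
- by rewrite (le_trans (dr _ _ Oz Om)) // ler_wpM2r // ltW.
- by rewrite (le_trans (dr _ _ Om Oz)) // ler_wpM2r // ltW.
Qed.

Lemma eigenvalue_eigenfunction Omega (lam : nat -> R) n : dirichlet_eigenvalues Omega lam ->
  exists2 u, dirichlet_solution Omega (lam n) u & exists2 x, Omega x & u x != 0.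
Proof.
move=> [_ mult]; have [[|m] [[e [es ei _]] card]] := mult (lam n).
  by move: card; rewrite II0 card_eq0 => /eqP E; have : [set k | lam k = lam n] n by []; rewrite E.
exists (e ord0); first exact: es.
apply: contrapT => H.
have e0 x : Omega x -> \sum_(i < m.+1) (i == ord0)%:R * e i x = 0.
  move=> Ox; rewrite (bigD1 ord0) //= mul1r big1 ?addr0; last by move=> i /negPf ->; rewrite mul0r.
  by apply: contrapT => /eqP ex; apply: H; exists x.
by have /eqP := ei _ e0 ord0; rewrite eqxx oner_eq0.
Qed.

Lemma eigenvalue_listed Omega (lam : nat -> R) l u x : dirichlet_eigenvalues Omega lam ->
  dirichlet_solution Omega l u -> Omega x -> u x != 0 -> exists n, lam n = l.
Proof.
move=> [_ mult] su Ox ux; have [[|m] [[e [_ _ eb]] card]] := mult l.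
  by have [a /(_ x Ox)] := eb u su; rewrite big_ord0 => /eqP; rewrite (negPf ux).
apply: contrapT => H; move: card; have -> : [set k | lam k = l] = set0.
  by apply/seteqP; split=> // n /= ln; apply: H; exists n.
by rewrite card_eq_sym card_eq0 => /eqP E; have : `I_m.+1 0%N by []; rewrite E.
Qed.

(** The eigenspace would have dimension at least two, but consist of multiples of one function. *)
Lemma repeated_eigenvalue Omega (lam : nat -> R) f : dirichlet_eigenvalues Omega lam ->
  lam 0%N = lam 1%N ->
  (forall u, dirichlet_solution Omega (lam 1%N) u -> exists b, forall x, Omega x -> u x = b * f x) ->
  False.
Proof.
move=> [_ mult] l01 simple; have [m [[e [es ei _]] card]] := mult (lam 1%N).
have m2 : (2 <= m)%N.
  rewrite -card_le_II; apply: (@card_le_trans _ _ _ [set k | lam k = lam 1%N]).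
    by apply: subset_card_le => -[|[|]] //=.
  by move: card; rewrite card_eq_le => /andP[].
have [n mE] : exists n, m = n.+2 by exists m.-2; lia.
subst m; have [a aE] := simple _ (es ord0); have [b bE] := simple _ (es (lift ord0 ord0)).
have coef (s t : R) : s * a + t * b = 0 -> s = 0 /\ t = 0.
  move=> st; pose g (i : 'I_n.+2) : R := if i == ord0 then s else if i == lift ord0 ord0 then t else 0.
  have g0 := ei g; have {}g0 : forall i, g i = 0.
    apply: g0 => x Ox; rewrite big_ord_recl big_ord_recl big1 ?addr0; last first.
      by move=> i _; rewrite /g /= mul0r.
    by rewrite /g /= aE // bE // !mulrA -mulrDl st mul0r.
  by split; [have := g0 ord0|have := g0 (lift ord0 ord0)].
have [b0 /eqP] := coef b (- a) (ltac:(ring)); rewrite oppr_eq0 => /eqP a0.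
have [/eqP] := coef 1 0 (ltac:(rewrite a0; ring)).
by rewrite oner_eq0.
Qed.

End Assembly.


Theorem theorem1p2 (R : realType) (N : nat) (hN : (2 <= N)%N)
    (D : R) (hD : 0 < D) :
  exists2 c : R, 0 < c &
    forall Omega : set 'rV[R]_N,
      domain Omega -> horoconvex Omega -> hdiameter Omega = D%:E ->
      forall lam : nat -> R, dirichlet_eigenvalues Omega lam ->
        c <= fundamental_gap lam.
Proof.
have N0 : (0 < N)%N by exact: ltn_trans hN.
have NR : 1 <= N%:R :> R by rewrite ler1n.
have [k [K [k0 K0 size]]] := @horoconvex_size R N D hD.
pose v : R := (K + 1) * N%:R / k + 4 * K ^+ 2 * k ^+ 2 + 1.
pose L0 : R := (4 * N%:R ^+ 2 + 8 * N%:R) * K ^+ 2 / (4 * k ^+ 2).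
have a0 : 0 <= (K + 1) * N%:R / k by rewrite divr_ge0 ?(ltW k0) // mulr_ge0 // addr_ge0 // ltW.
have b0 : 0 <= 4 * K ^+ 2 * k ^+ 2 by exact: (mulr_ge0 (mulr_ge0 _ (sqr_ge0 K)) (sqr_ge0 k)).
have v1 : 1 <= v by rewrite /v; lra.
have L00 : 0 <= L0.
  have h1 : 0 <= 4 * N%:R ^+ 2 + 8 * N%:R :> R by have := sqr_ge0 (N%:R : R); lra.
  exact: (divr_ge0 (mulr_ge0 h1 (sqr_ge0 K)) (mulr_ge0 _ (sqr_ge0 k))).
have [c c0 simple] := uniform_simplicity N0 v1 L00.
exists c => // Omega Od Oh OD lam lamP.
have [cO1 Os [p [Op pb pO]]] := size Omega Od Oh OD.
have [nO O1 Oo _] := Od.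
have dp := del_gt0 (O1 _ Op); set d := 1 - sqnorm p in dp pb pO.
pose V x := @conformal_factor R N x ^+ 2.
have VE x : V x = 4 / (1 - sqnorm x) ^+ 2.
  by rewrite /V /conformal_factor expr_div_n; congr (_ / _); ring.
have V0 x : Omega x -> 0 < V x by move=> /O1 x1; rewrite exprn_gt0 // conformal_factor_gt0.
have kd : 0 < k * d by rewrite mulr_gt0.
have VB x : Omega x -> 4 / (K * d) ^+ 2 <= V x <= 4 * K ^+ 2 / d ^+ 2.
  move=> Ox; have [_ h1 h2] := pO x Ox; have dx := del_gt0 (O1 _ Ox).
  have Kd : 0 < K * d by exact: mulr_gt0.
  have sK : 0 < (K * d) ^+ 2 by exact: exprn_gt0.
  have sx : 0 < (1 - sqnorm x) ^+ 2 by exact: exprn_gt0.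
  have sd : 0 < d ^+ 2 by exact: exprn_gt0.
  have le1 : (1 - sqnorm x) ^+ 2 <= (K * d) ^+ 2 by apply: lerXn2r => //; rewrite nnegrE ltW.
  have le2 : d ^+ 2 <= (K * (1 - sqnorm x)) ^+ 2.
    by apply: lerXn2r => //; rewrite nnegrE ltW // mulr_gt0.
  rewrite VE; apply/andP; split; first by rewrite ler_pM2l // lef_pV2.
  rewrite -mulrA ler_pM2l // ler_pdivlMr // mulrC ler_pdivrMr //.
  by rewrite -exprMn.
(* the bounds on the eigenvalue are scale invariant: rho^2 is comparable to 1 / d^2 *)
have [u0 [mu [u0c u0o u0C [u0_ge0 [x0 [Ox0 u0x0]]] [u0eq /andP[mu0 muL]]]]] :
    exists u mu, [/\ continuous u, forall x, ~ Omega x -> u x = 0, class_C 2 Omega u,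
      (forall x, Omega x -> 0 <= u x) /\ (exists x, Omega x /\ 0 < u x) &
      (forall x, Omega x -> \sum_i partial i (partial i u) x = - (mu * V x * u x)) /\
      0 <= mu <= (4 * N%:R ^+ 2 + 8 * N%:R) / ((k * d) ^+ 2 * (4 / (K * d) ^+ 2))].
  apply: (@exists_ground_state R N Omega V p (k * d) (4 / (K * d) ^+ 2) (4 * K ^+ 2 / d ^+ 2)) => //.
  - move=> x /O1 x1 i; have := @normr_coord_sqnorm _ _ x i 1 ler01; rewrite !mxE subr0; apply.
    by rewrite expr1n ltW.
  - by move=> x /ltW/pb.
  - by rewrite divr_gt0 // exprn_gt0 // mulr_gt0.
  - move=> x Ox; have xc := class_C_cont (class_C_conformal_factor 0 Oo O1) Ox.
    apply: (@cvgM _ _ _ (nbhs_filter x)); exact: xc.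
  - exact: lbdk_conformal_factor.
have u0l x : Omega x -> has_lap u0 x (- (mu * V x * u0 x)).
  by move=> Ox; rewrite -u0eq //; exact: (class_C2_has_lap Oo u0C Ox).
have s0 : solves Omega V mu u0 by split.
have muL0 : mu <= L0.
  rewrite (le_trans muL) // le_eqVlt; apply/orP; left; apply/eqP.
  by rewrite /L0; field; rewrite !gt_eqF.
have [v2 v20 VL] : exists2 v2, 0 <= v2 & forall x, Omega x -> mu * V x <= v2.
  exists (mu * (4 * K ^+ 2 / d ^+ 2)).
    by rewrite mulr_ge0 // divr_ge0 ?sqr_ge0 // mulr_ge0 ?sqr_ge0.
  by move=> x Ox; rewrite ler_wpM2l //; have /andP[] := VB x Ox.
have u0p x : Omega x -> 0 < u0 x.
  apply: (@nonneg_positive R N Omega v2 u0 x0) => // y Oy; split; first exact: u0_ge0.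
  exists (- (mu * V y * u0 y)); first exact: u0l.
  have m0 : 0 <= mu * V y by rewrite mulr_ge0 // ltW // V0.
  rewrite normrN ger0_norm ?(mulr_ge0 m0 (u0_ge0 _ Oy)) //.
  by rewrite (ler_wpM2r (u0_ge0 _ Oy)) // VL.
have r0 : 0 < k * d / N%:R by rewrite divr_gt0 // (lt_le_trans ltr01).
have N00 : 0 < N%:R :> R by rewrite (lt_le_trans ltr01).
have rO : box p (k * d / N%:R) `<=` Omega.
  move=> z zp; apply: pb; rewrite (le_trans (sqnorm_box zp)) //.
  have -> : N%:R * (k * d / N%:R) ^+ 2 = (k * d) ^+ 2 / N%:R by field; rewrite gt_eqF.
  by rewrite ler_pdivrMr // ler_peMr // sqr_ge0.
have Ob : Omega `<=` box p (v * (k * d / N%:R)).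
  move=> z Oz; apply: (@box_le _ _ _ ((K + 1) * d)).
    have h : (K + 1) * N%:R / k <= v by rewrite /v; lra.
    apply: le_trans (ler_wpM2r (ltW r0) h); rewrite le_eqVlt; apply/orP; left; apply/eqP.
    by field; rewrite !gt_eqF.
  have Kd : 0 <= (K + 1) * d by rewrite mulr_ge0 ?(ltW dp) // addr_ge0 // ltW.
  move=> i; have [h _ _] := pO z Oz; have := @normr_coord_sqnorm _ _ (z - p) i _ Kd.
  rewrite !mxE; apply; rewrite (le_trans h) // exprMn ler_wpM2r ?sqr_ge0 //.
  by move: (sqr_ge0 K) K0; rewrite !expr2; clear; lra.
have Vv x : Omega x -> 0 < V x /\ (k * d / N%:R) ^+ 2 * V x <= v.
  move=> Ox; split; first exact: V0.
  have [_ h1 h2] := pO x Ox; have dx := del_gt0 (O1 _ Ox).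
  apply: (@le_trans _ _ (4 * K ^+ 2 * k ^+ 2)); last by rewrite /v; lra.
  apply: (@le_trans _ _ ((k * d) ^+ 2 * V x)).
    rewrite ler_wpM2r ?(ltW (V0 _ Ox)) // lerXn2r ?nnegrE ?(ltW r0) ?(ltW kd) //.
    by rewrite ler_pdivrMr // ler_peMr // ltW.
  rewrite VE mulrA ler_pdivrMr ?exprn_gt0 //.
  have -> : (k * d) ^+ 2 * 4 = 4 * k ^+ 2 * d ^+ 2 by ring.
  have -> : 4 * K ^+ 2 * k ^+ 2 * (1 - sqnorm x) ^+ 2 = 4 * k ^+ 2 * (K * (1 - sqnorm x)) ^+ 2 by ring.
  rewrite ler_wpM2l ?(mulr_ge0 _ (sqr_ge0 k)) // lerXn2r ?nnegrE ?(ltW dp) //.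
  by rewrite mulr_ge0 // ltW.
pose bot := @conformal_shift R N; pose l0 := mu + bot.
have sol0 : dirichlet_solution Omega l0 (fun x => (weight x)^-1 * u0 x).
  exact: solution_dirichlet.
have ext u l : dirichlet_solution Omega l u -> solves Omega V (l - bot) (extend Omega u).
  exact: solves_extend.
have [eps eps0 [Ot Kp]] : exists2 eps, 0 < eps & thin Omega eps v2 /\ inner Omega eps p.
  have w0 : 0 <= 2 * v2 * N%:R ^+ 2 by rewrite (mulr_ge0 _ (sqr_ge0 _)) // mulr_ge0.
  have w1 : 0 < 2 * v2 * N%:R ^+ 2 + 1 by rewrite ltr_wpDl.
  pose e := Num.min (k * d / N%:R) (2 * v2 * N%:R ^+ 2 + 1)^-1.
  have e0 : 0 < e by rewrite lt_min r0 invr_gt0.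
  exists e => //; split; last by apply: box_inner rO; rewrite ge_min lexx.
  split=> //; first by exists p, (v * (k * d / N%:R)).
  split=> //; have ew : e * (2 * v2 * N%:R ^+ 2 + 1) <= 1 by rewrite -ler_pdivlMr // mul1r ge_min lexx orbT.
  have e1 : e <= 1.
    by apply: le_trans ew; rewrite ler_peMr ?(ltW e0) // lerDr.
  have h : v2 * N%:R ^+ 2 * e <= 2^-1 by move: ew e0; clear; lra.
  have -> : v2 * (N%:R * e) ^+ 2 = e * (v2 * N%:R ^+ 2 * e) by ring.
  apply: le_trans h; rewrite ler_piMl // mulr_ge0 ?(ltW e0) //; move: w0; clear; lra.
have minimal u l : dirichlet_solution Omega l u -> l < l0 -> forall x, Omega x -> u x = 0.
  move=> /ext su ll x Ox; have lb : l - bot < mu by rewrite ltrBlDr.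
  have := principal_min Ot Kp s0 u0p V0 VL su lb x; rewrite extendE // => /eqP.
  by rewrite mulf_eq0 gt_eqF ?weight_gt0 //= => /eqP.
have lam_ge n : l0 <= lam n.
  have [u su [x Ox ux]] := eigenvalue_eigenfunction n lamP; rewrite leNgt; apply/negP => ll.
  by move: ux; rewrite (minimal u _ su ll x Ox) eqxx.
have lam00 : lam 0%N = l0.
  have nz : (weight x0)^-1 * u0 x0 != 0 by rewrite mulf_neq0 ?invr_eq0 // gt_eqF // weight_gt0.
  have [n ln] := eigenvalue_listed lamP sol0 Ox0 nz.
  apply/le_anti; rewrite lam_ge andbT -ln; have [mono _] := lamP; exact: mono.
rewrite /fundamental_gap lam00 leNgt; apply/negP => gap.
have lam1 : l0 <= lam 1%N by exact: lam_ge.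
have multiple u : dirichlet_solution Omega (lam 1%N) u ->
    exists b, forall x, extend Omega u x = b * u0 x.
  move=> /ext su; apply: (simple Omega V (k * d / N%:R) p mu (lam 1%N - bot) u0) => //.
  - by rewrite mu0.
  - by rewrite lerBrDr lam1 lerBlDr addrAC -lerBlDl ltW.
(* a multiple of the ground state satisfies both equations, so the eigenvalues agree; but then the
eigenspace is too small *)
have [eqlam|neqlam] := eqVneq (lam 1%N) l0.
  apply: (@repeated_eigenvalue _ _ Omega lam (fun x => (weight x)^-1 * u0 x) lamP).
    by rewrite eqlam.
  move=> u /multiple[b bE]; exists b => x Ox.
  by have := bE x; rewrite extendE // mulrCA => <-; rewrite mulKf // gt_eqF // weight_gt0.
have [u su [x Ox ux]] := eigenvalue_eigenfunction 1 lamP; have [b bE] := multiple u su.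
have [_ _ l1] := ext _ _ su; have [_ _ l2] := solvesZ b s0.
have uE : extend Omega u = (fun x => b * u0 x) by apply/funext.
have := l1 x Ox; rewrite uE => l1x; have := has_lap_unique l1x (l2 x Ox).
have nz : b * u0 x != 0 by rewrite -bE extendE // mulf_neq0 // gt_eqF // weight_gt0.
have Vx : V x != 0 by rewrite gt_eqF // V0.
move/oppr_inj; move/(mulIf nz)/(mulIf Vx)/eqP; rewrite subr_eq; apply/negP.
by rewrite -/l0 neqlam.
Qed.
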